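(* Let $\Gamma$ be a finite simple graph, with complement $\overline{\Gamma}$. Then the following are equivalent: (1) $\Gamma$ is isomorphic to the prime graph of some pseudo $A_6$-solvable group $G$. (2) $\overline{\Gamma}$ is $3$-colorable and has at most one triangle, which must be isolated if it exists.
   Context: All groups are finite and all graphs are simple. For a finite group $G$, the prime graph $\Gamma(G)$ has as vertices the prime divisors of $|G|$; two distinct vertices $p,q$ are adjacent if and only if $G$ contains an element of order $pq$. A group $G$ is pseudo $A_6$-solvable if each of its composition factors is abelian or isomorphic to the alternating group $A_6$ (in particular solvable groups are allowed). A triangle in a graph is isolated if none of its three vertices is adjacent to a vertex outside the triangle. *)

(* Defs.v *)
From HB Require Import structures.
From mathcomp Require Import all_boot all_fingroup all_solvable.

Set Implicit Arguments.
Unset Strict Implicit.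
Unset Printing Implicit Defensive.

Local Open Scope group_scope.

Record sgraph := SGraph {
  vertex :> finType;
  adj : rel vertex;
  adj_sym : symmetric adj;
  adj_irrefl : irreflexive adj }.

Definition graph_isomorphic (A B : sgraph) : Prop :=
  exists2 f : A -> B, bijective f & {mono f : x y / adj x y >-> adj x y}.

Section Complement.
Variable A : sgraph.

Definition compl_adj : rel A := [rel x y | (x != y) && ~~ adj x y].

Lemma compl_adj_sym : symmetric compl_adj.
Proof. by move=> x y; rewrite /compl_adj /= eq_sym adj_sym. Qed.

Lemma compl_adj_irrefl : irreflexive compl_adj.
Proof. by move=> x; rewrite /compl_adj /= eqxx. Qed.

Definition complement : sgraph := SGraph compl_adj_sym compl_adj_irrefl.
End Complement.

Definition colorable (k : nat) (A : sgraph) : Prop :=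
  exists c : A -> 'I_k, forall x y : A, adj x y -> c x != c y.

Definition triangle (A : sgraph) (T : {set A}) : Prop :=
  #|T| = 3 /\ {in T &, forall x y, x != y -> adj x y}.

Definition at_most_one_triangle (A : sgraph) : Prop :=
  forall T1 T2 : {set A}, triangle T1 -> triangle T2 -> T1 = T2.

Definition isolated (A : sgraph) (T : {set A}) : Prop :=
  forall x y : A, x \in T -> y \notin T -> ~~ adj x y.

Section PrimeGraph.
Variables (gT : finGroupType) (G : {group gT}).

(* [seq_sub (primes #|G|)] is the finite type of prime divisors of #|G|. *)
Definition prime_adj : rel (seq_sub (primes #|G|)) :=
  [rel p q | (p != q) && [exists x in G, #[x] == (val p * val q)%N]].

Lemma prime_adj_sym : symmetric prime_adj.
Proof. by move=> p q; rewrite /prime_adj /= eq_sym mulnC. Qed.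

Lemma prime_adj_irrefl : irreflexive prime_adj.
Proof. by move=> p; rewrite /prime_adj /= eqxx. Qed.

Definition prime_graph : sgraph := SGraph prime_adj_sym prime_adj_irrefl.
End PrimeGraph.

Definition composition_factor (gT : finGroupType) (G : {group gT})
    (K : section gT) : Prop :=
  exists2 s : seq {group gT}, comps G s & K \in pairmap (@mkSec gT) G s.

(* By Jordan-Holder the factors of any one composition series would suffice. *)
Definition pseudo_A6_solvable (gT : finGroupType) (G : {group gT}) : Prop :=
  forall K : section gT,
    composition_factor G K -> abelian K \/ K \isog 'Alt_('I_6).

(* Main.v *)
(* Call two primes opposite in [G] if they are not adjacent in its prime graph.

   Necessity.  In a solvable group an opposite pair is oriented by its Hall
   subgroup: [p -> q] if [p] divides the order of the abelianization of a Hall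
   [{p, q}]-subgroup.  Minimal counterexamples show that there is no triangle and
   no oriented path with three edges, so colouring sources, inner vertices and
   sinks is a proper 3-colouring.  If [A_6] is a factor and [t > 5] is opposite to
   [w <= 5], a quotient of [G] contains a cover of [A_6] acting on a [t]-group so
   that the elements of order [w] have no fixed points.  This forces [w -> t], and
   it is impossible for [w = 3], for [w = 2] if 2 and 5 are opposite, and for
   [w = 5] if 2, 3 and 5 are pairwise opposite.  Solvable subgroups whose index is
   divisible only by two of the primes 2, 3, 5 then reduce the colouring, and the
   location of the triangles, to the solvable case.

   Sufficiency.  Start from 1, or from [A_6] if there is a triangle, and add the
   other vertices in the order of their colours 0, 1, 2.  To add a vertex with a set
   [N] of neighbours in the complement, take [M <= L <= G] with [L / M] cyclic such
   that an element of prime order is in [L] but not in [M] exactly if its order is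
   in [N], and a prime [r] such that the field with [r] elements contains the
   [|G|]-th roots of unity; the new group is the semidirect product of [G] with the
   module induced from a faithful character of [L / M] over that field. *)

From HB Require Import structures.
Require Import Defs.
From mathcomp Require Import all_boot all_fingroup all_solvable all_algebra all_field.

Set Implicit Arguments.
Unset Strict Implicit.
Unset Printing Implicit Defensive.

Import GRing.Theory.
Local Open Scope group_scope.
Local Notation A6 := 'Alt_('I_6).

(** * Fixed-point-free action and averaging *)

(** If p and q are opposite, every element of order q acts without fixed points on each p-subgroup
    that it normalises. Two averaging arguments on an abelian group of coprime order exploit this: a
    noncyclic elementary abelian group cannot act so that all its nontrivial elements are free of
    fixed points, and a group centralises the module if some element of prime order acts without
    fixed points on both. Neither excludes [A6] with only its elements of order 5 free of fixed
    points, since its Sylow 5-subgroups are cyclic; there the sum of these subgroups is inverted in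
    the rational group algebra by computation, with a denominator prime to the module. In the
    construction, the obstacle is that a new Sylow subgroup must fit into a later cyclic quotient
    [L / M]. If [L = G], the module has dimension one and is centralised by [M], so it can be joined
    to a section inside [M]; this serves colours 0 and 1. For colour 0 also [M = G], and the
    enlarged section can still start at the whole group. A vertex of colour 2 never has to be joined
    to a later one. *)

Lemma big_cycle (gT : finGroupType) (V : nmodType) (f : gT -> V) (y : gT) n :
  n = #[y] -> (\sum_(h in <[y]>) f h = \sum_(i < n) f (y ^+ i)%g)%R.
Proof.
move=> ->; have -> : <[y]> = [set y ^+ (i : 'I_#[y]) | i in setT].
  apply/setP=> z; apply/idP/imsetP=> [/cyclePmin[i lti ->]|[i _ ->]].
    by exists (Ordinal lti).
  exact: mem_cycle.
rewrite big_imset /=; first by apply: eq_bigl => i; rewrite inE.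
move=> i j _ _ /eqP; rewrite eq_expg_mod_order !modn_small // => /eqP.
exact: val_inj.
Qed.

Section Averaging.
Import FiniteModule.
Variables (gT : finGroupType) (A : {group gT}) (abA : abelian A).
Implicit Types (H F : {group gT}) (x : gT) (u : fmod_of abA).

(** An element of [H] permutes the summands, so the sum is a fixed point. *)
Lemma fmod_fix_sum H u : H \subset 'N(A) -> 'C_A(H) = 1 ->
  (\sum_(h in H) u ^@ h = 0)%R.
Proof.
move=> nAH C1; apply: val_inj => /=.
have nA h : h \in H -> h \in 'N(A) by apply: (subsetP nAH).
suff: fmval (\sum_(h in H) u ^@ h)%R \in 'C_A(H) by rewrite C1 => /set1P.
rewrite inE fmodP; apply/centP=> g Hg; apply/commgP/conjg_fixP.
rewrite -fmvalJ ?nA // actr_sum; congr fmval.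
rewrite [RHS](reindex_inj (mulIg g)) /=; apply: eq_big => h.
  by rewrite groupMr.
by move=> Hh; rewrite actrM ?nA.
Qed.

Lemma fmod_natmul_eq0 n u : coprime #|A| n -> (u *+ n = 0)%R -> u = 0%R.
Proof.
move=> coAn /(congr1 fmval); rewrite fmvalZ fmval0 => un1; apply: val_inj => /=.
have Au : fmval u \in A by apply: fmodP.
apply/eqP; rewrite -order_eq1 -dvdn1 -(eqP (coprime_dvdl (order_dvdG Au) coAn)).
by rewrite dvdn_gcd dvdnn order_dvdn un1 eqxx.
Qed.

(* If [x] moves every nontrivial element of [F], then each coset [F x^i] other
   than [F] is a single [F]-class; summing [v] over the conjugates of [<[x]>],
   where every inner sum vanishes, shows that [#|F| v] is fixed by [F]. *)
Lemma cent_fpf F x : F \subset 'N(A) -> x \in 'N(A) -> x \in 'N(F) ->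
  coprime #|A| #|F| -> prime #[x] -> 'C_A[x] = 1 -> 'C_F[x] = 1 ->
  F \subset 'C(A).
Proof.
move=> nAF nAx nFx coAF pr_x CA1 CF1.
have nA f : f \in F -> f \in 'N(A) by apply: (subsetP nAF).
have nAX i : x ^+ i \in 'N(A) by rewrite groupX.
have Fx i : x ^+ i \in 'N(F) by rewrite groupX.
suff fixF : forall (u : fmod_of abA) f, f \in F -> (u ^@ f = u)%R.
  apply/centsP=> f Ff a Aa; apply/commute_sym/commgP/conjg_fixP.
  by move: (congr1 fmval (fixF (fmod abA a) f Ff)); rewrite fmvalJ ?nA ?fmodK.
pose s (v : fmod_of abA) := (\sum_(g in F) v ^@ g)%R.
have sfix v g : g \in F -> (s v ^@ g = s v)%R.
  move=> Fg; rewrite /s actr_sum [RHS](reindex_inj (mulIg g)) /=.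
  by apply: eq_big => h; rewrite ?groupMr // => Fh; rewrite actrM ?nA.
have sum0 (v : fmod_of abA) g : g \in F -> (\sum_(i < #[x]) v ^@ ((x ^+ i) ^ g) = 0)%R.
  move=> Fg; have nAxg : <[x ^ g]> \subset 'N(A).
    by rewrite cycle_subG memJ_norm // (subsetP (normG _)) // nA.
  rewrite -[RHS](@fmod_fix_sum <[x ^ g]>%G v nAxg); last first.
    rewrite /= cent_cycle; apply/trivgP/subsetP=> a /setIP[Aa /cent1P cxa].
    have : a ^ g^-1 \in 'C_A[x].
      rewrite inE memJ_norm ?groupV ?nA // Aa; apply/cent1P.
      by rewrite /commute -[x](conjgK g) -!conjMg cxa.
    by rewrite CA1 => /set1P/(canRL (conjgKV _)); rewrite conj1g inE => ->.
  rewrite (big_cycle _ (esym (orderJ x g))).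
  by apply: eq_bigr => i _; rewrite conjXg.
have sumi (v : fmod_of abA) (i : 'I_#[x]) : i != 0 :> nat ->
    (\sum_(f in F) v ^@ ((x ^+ i) ^ f) = s v ^@ (x ^+ i))%R.
  (* Here [(x ^+ i) ^ f = h f * x ^+ i]. The map [h] permutes [F]: elements with the same image
     differ by a fixed point of [x ^+ i], which generates [<[x]>]. *)
  move=> i0; pose h f := f^-1 * f ^ (x ^- i).
  have Fh f : f \in F -> h f \in F.
    by move=> Ff; rewrite groupM ?groupV // memJ_norm ?groupV.
  have injh : {in F &, injective h}.
    move=> f g Ff Fg /= efg; apply/eqP; rewrite eq_mulgV1; apply/eqP.
    have cfg : (f * g^-1) ^ (x ^- i) = f * g^-1.
      rewrite conjMg conjVg.
      have -> : f ^ (x ^- i) = f * h f by rewrite /h mulKVg.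
      have -> : g ^ (x ^- i) = g * h g by rewrite /h mulKVg.
      by rewrite efg invMg mulgA mulgK.
    have Ffg : f * g^-1 \in F by rewrite groupM ?groupV.
    apply/set1P; rewrite -[[set 1]]CF1 inE Ffg -cent_cycle.
    have <- : <[x ^+ i]> = <[x]>.
      apply/esym/eqP; rewrite -/(generator _ _) generator_coprime prime_coprime //.
      by apply/negP=> /dvdn_leq; rewrite lt0n => /(_ i0); rewrite leqNgt ltn_ord.
    rewrite cent_cycle; apply/cent1P/commgP/conjg_fixP.
    by rewrite -{1}cfg conjgKV.
  have imh : h @: F = F.
    apply/eqP; rewrite eqEcard card_in_imset // leqnn andbT.
    by apply/subsetP=> _ /imsetP[f Ff ->]; apply: Fh.
  rewrite /s actr_sum -[in RHS]imh big_imset //=; apply: eq_bigr => f Ff.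
  rewrite -(actrM (nA _ (Fh _ Ff)) (nAX i)); congr (_ ^@ _)%R.
  by rewrite /h conjgE /conjg invgK !mulgA mulgVK.
move=> u f Ff; set n := #|F|.
have nfix (v : fmod_of abA) g : g \in F -> ((v *+ n) ^@ g = v *+ n)%R.
  move=> Fg.
  have E : (v *+ n = - \sum_(i < #[x] | i != 0 :> nat) s v ^@ (x ^+ i))%R.
    apply/eqP; rewrite -addr_eq0; apply/eqP.
    transitivity (\sum_(f in F) \sum_(i < #[x]) v ^@ ((x ^+ i) ^ f))%R; last first.
      by apply: big1 => h Fh'; apply: sum0.
    rewrite [RHS]exchange_big /= [RHS](bigD1 (Ordinal (order_gt0 x))) //=; congr (_ + _)%R.
      rewrite (eq_bigr (fun=> v)) ?sumr_const // => h _.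
      by rewrite expg0 conj1g actr1.
    by apply: eq_bigr => i i0; rewrite sumi.
  rewrite E actNr actr_sum; congr (- _)%R; apply: eq_bigr => i _.
  have Fgx : g ^ x ^- i \in F by rewrite memJ_norm ?groupV.
  by rewrite -(actrM (nAX i) (nA _ Fg)) conjgCV (actrM (nA _ Fgx) (nAX i)) sfix.
apply/eqP; rewrite -subr_eq0; apply/eqP/(@fmod_natmul_eq0 n) => //.
by rewrite mulrnBl -actZr nfix // subrr.
Qed.

End Averaging.

Section AveragingAbelem.
Import FiniteModule.
Variables (gT : finGroupType) (A E : {group gT}) (r : nat).

(* With [a], [b] independent in [E], the identity
   [r v = \sum_i s_<a b^i> v - \sum_(j <> 0) s_<b^j> (v^(a^j))] kills [A]. *)
Lemma fpf_abelem_cyclic : abelian A -> A :!=: 1 -> E \subset 'N(A) ->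
  r.-abelem E -> coprime #|A| r -> {in E^#, forall e, 'C_A[e] = 1} -> cyclic E.
Proof.
move=> abA ntA nAE abE coAr fpf.
have [->|ntE] := eqVneq E 1%G; first exact: cyclic1.
have [r_pr _ _] := pgroup_pdiv (abelem_pgroup abE) ntE.
have ordE e : e \in E -> e != 1 -> #[e] = r by apply: abelem_order_p.
have cE := centsP (abelem_abelian abE).
have nA e : e \in E -> e \in 'N(A) by apply: (subsetP nAE).
have [a Ea nt_a] := trivgPn _ ntE.
have [sEa|] := boolP (E \subset <[a]>).
  by apply: cyclicS sEa _; apply: cycle_cyclic.
case/subsetPn=> b Eb not_ab; case/negP: ntA; apply/eqP/trivgP/subsetP=> v Av.
have ab1 i : a * b ^+ i != 1.
  apply: contra not_ab; rewrite -eq_invg_mul => /eqP ab.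
  have [b1|nt_b] := eqVneq b 1; first by rewrite b1 group1.
  have nt_bi : b ^+ i != 1 by rewrite -ab invg_eq1.
  have : b \in <[b ^+ i]>.
    rewrite (_ : <[b ^+ i]> = <[b]>) ?cycle_id //; apply/eqP.
    by rewrite eqEcard cycleX -!orderE !ordE ?groupX ?leqnn.
  by rewrite -ab cycleV.
have bj1 (j : 'I_r) : j != 0 :> nat -> b ^+ j != 1.
  move=> j0; rewrite -order_dvdn (ordE b) //.
    by rewrite gtnNdvd ?lt0n.
  by apply: contraNneq not_ab => ->; rewrite group1.
have sum0 (u : fmod_of abA) e : e \in E -> e != 1 ->
    (\sum_(i < r) u ^@ (e ^+ i)%g = 0)%R.
  move=> Ee nt_e; rewrite -(big_cycle (fun h => u ^@ h)%R (esym (ordE e Ee nt_e))).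
  rewrite (@fmod_fix_sum _ _ abA <[e]>%G) ?cycle_subG ?nA //.
  by rewrite cent_cycle fpf // !inE nt_e.
pose u := fmod abA v.
suff u0 : u = 0%R by rewrite inE -(fmodK abA Av) -/u u0.
apply: (fmod_natmul_eq0 coAr).
have : (\sum_(i < r) \sum_(j < r) u ^@ ((a * b ^+ i) ^+ j)%g = 0)%R.
  by apply: big1 => i _; rewrite sum0 ?groupM ?groupX.
rewrite exchange_big /= (bigD1 (Ordinal (prime_gt0 r_pr))) //=.
rewrite [X in (_ + X)%R]big1 ?addr0 => [<-|j j0].
  rewrite (eq_bigr (fun=> u)) ?sumr_const ?card_ord // => i _.
  by rewrite expg0 actr1.
rewrite -[RHS](sum0 (u ^@ (a ^+ j)%g)%R (b ^+ j)) ?groupX ?bj1 //.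
apply: eq_bigr => i _; rewrite -(actrM (nA _ _) (nA _ _)) ?groupX //.
by rewrite -expgM mulnC expgM -expgMn //; apply: cE; rewrite ?groupX.
Qed.

End AveragingAbelem.

(** * Non-adjacent primes *)

(** A relation on numbers and not on the vertices of one prime graph, so that it can be compared
    between a group, its subgroups and its quotients. *)
Definition nonadj (gT : finGroupType) (G : {group gT}) (p q : nat) : bool :=
  [&& p \in \pi(G), q \in \pi(G), p != q & [forall x in G, #[x] != (p * q)%N]].

Section Nonadj.
Variable gT : finGroupType.
Implicit Types (G H N V : {group gT}) (p q : nat) (x y : gT).

Lemma nonadjP G p q : reflect
  [/\ p \in \pi(G), q \in \pi(G), p != q & forall x, x \in G -> #[x] != (p * q)%N]
  (nonadj G p q).
Proof.
apply: (iffP and4P) => [] [-> -> -> H]; split=> //; first exact/forall_inP.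
exact/forall_inP.
Qed.

Lemma nonadj_sym G p q : nonadj G p q = nonadj G q p.
Proof.
by rewrite /nonadj eq_sym mulnC; do 2!case: (_ \in _).
Qed.

Lemma nonadj_primes G p q : nonadj G p q -> [/\ prime p, prime q & p != q].
Proof.
case/nonadjP; rewrite !mem_primes => /and3P[p_pr _ _] /and3P[q_pr _ _] neq _.
by split.
Qed.

Lemma pi_of_order G x p : prime p -> x \in G -> #[x] = p -> p \in \pi(G).
Proof.
by move=> p_pr Gx ox; rewrite mem_primes p_pr cardG_gt0 -ox order_dvdG.
Qed.

Lemma nonadj_comm G p q x y : nonadj G p q -> x \in G -> y \in G ->
  #[x] = p -> #[y] = q -> ~ commute x y.
Proof.
move=> npq Gx Gy ox oy cxy; have [p_pr q_pr neq] := nonadj_primes npq.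
case/nonadjP: npq => _ _ _ /(_ (x * y)); rewrite groupM // => /(_ isT)/eqP[].
by rewrite orderM // ox oy // prime_coprime // dvdn_prime2.
Qed.

(** A nontrivial fixed point would yield one of order [p], whose product with [x] has order [p * q].
    Nonadjacency is mostly used in this form. *)
Lemma nonadj_cent1 G V p q x : nonadj G p q -> x \in G -> #[x] = q ->
  V \subset G -> p.-group V -> 'C_V[x] = 1.
Proof.
move=> npq Gx ox sVG pV; apply/eqP/idPn=> ntC.
have sCV : 'C_V[x] \subset V by apply: subsetIl.
have [p_pr pC _] := pgroup_pdiv (pgroupS sCV pV) ntC.
have [y /setIP[Vy /cent1P cxy] oy] := Cauchy p_pr pC.
by apply: (nonadj_comm npq (subsetP sVG _ Vy) Gx oy ox); apply: commute_sym.
Qed.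

Lemma nonadjS G H p q : H \subset G -> p \in \pi(H) -> q \in \pi(H) ->
  nonadj G p q -> nonadj H p q.
Proof.
move=> sHG piHp piHq /nonadjP[_ _ neq no_pq]; apply/nonadjP; split=> // x Hx.
by apply: no_pq; apply: (subsetP sHG).
Qed.

Lemma order_quotient_lift G N n (x : coset_of N) : x \in G / N -> n %| #[x] ->
  exists2 y, y \in G & #[y] = n.
Proof.
case/morphimP=> y Ny Gy ->{x} n_dv; exists (y ^+ (#[y] %/ n)); first exact: groupX.
have dv : n %| #[y] by apply: dvdn_trans n_dv (morph_order _ Ny).
have [k Ek] := dvdnP dv; have := order_gt0 y; rewrite Ek muln_gt0 => /andP[k0 n0].
by rewrite mulnK // orderXdiv Ek ?dvdn_mulr // mulKn.
Qed.

End Nonadj.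

Lemma nonadj_quotient (gT : finGroupType) (G N : {group gT}) p q :
  p \in \pi(G / N) -> q \in \pi(G / N) -> nonadj G p q -> nonadj (G / N) p q.
Proof.
move=> pip piq /nonadjP[_ _ neq no_pq]; apply/nonadjP; split=> // x GNx.
apply/negP=> /eqP ox; have [|y Gy /eqP] := order_quotient_lift (n := (p * q)%N) GNx.
  by rewrite ox.
by apply/negP/no_pq.
Qed.

(* A solvable group whose order has exactly two prime divisors [p], [q], not
   adjacent, is a Frobenius or 2-Frobenius group, so that exactly one of them
   divides the index of the derived subgroup. *)
Definition arrow (gT : finGroupType) (G : {group gT}) (p q : nat) : bool :=
  nonadj G p q && [exists H : {group gT},
    (pred2 p q).-Hall(G) H && (p %| #|H : H^`(1)|)].

Lemma pi_Hall (gT : finGroupType) (pi : nat_pred) (G H : {group gT}) p :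
  pi.-Hall(G) H -> p \in pi -> (p \in \pi(H)) = (p \in \pi(G)).
Proof.
move=> hallH pi_p; rewrite /= !mem_primes (card_Hall hallH) part_gt0 cardG_gt0 /=.
case p_pr: (prime p) => //=; apply/idP/idP=> [|pG].
  by move/dvdn_trans; apply; apply: dvdn_part.
by rewrite -(part_pnat_id (pi := pi) (n := p)) ?pnatE // partn_dvd.
Qed.

Section Arrow.
Variable gT : finGroupType.
Implicit Types (G H K N P : {group gT}) (p q : nat).

Lemma arrow_nonadj G p q : arrow G p q -> nonadj G p q.
Proof. by case/andP. Qed.

(* The order of the abelian group [H / B] would be divisible by [p] and [q]. *)
Lemma nonadj_abelian_index H (B : {group gT}) p q : nonadj H p q -> B <| H -> abelian (H / B) ->
  p %| #|H : B| -> q %| #|H : B| -> False.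
Proof.
move=> npq nsBH abHB pB qB; have [p_pr q_pr neq] := nonadj_primes npq.
rewrite -card_quotient ?normal_norm // in pB qB.
have [x Hx ox] := Cauchy p_pr pB; have [y Hy oy] := Cauchy q_pr qB.
have {}npq : nonadj (H / B) p q.
  by apply: nonadj_quotient npq; rewrite mem_primes ?p_pr ?q_pr cardG_gt0.
exact: (nonadj_comm npq Hx Hy ox oy (centsP abHB _ Hx _ Hy)).
Qed.

(** The abelianization of [H / N] is a quotient of that of [H]. *)
Lemma index_der1_quotient H N : H \subset 'N(N) ->
  #|H / N : (H / N)^`(1)| %| #|H : H^`(1)|.
Proof.
move=> nNH; have nNH' := subset_trans (der_sub 1 H) nNH.
rewrite -quotient_der // -(quotientMidl N H^`(1)) -(quotientMidl N H).
rewrite -!norm_joinEr // index_quotient_eq.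
- rewrite /= (_ : N <*> H = (N <*> H^`(1)) * H).
    by rewrite indexMg indexgS // joing_subr.
  by rewrite !norm_joinEr // -mulgA (mulSGid (der_sub 1 H)).
- by rewrite subIset // joing_subl orbT.
- by rewrite /= !norm_joinEr // mulgS // der_sub.
by rewrite join_subG normG.
Qed.

Lemma sol_index_der1 (pi : nat_pred) H : solvable H -> H :!=: 1 -> pi.-group H ->
  exists2 p, p \in pi & prime p && (p %| #|H : H^`(1)|).
Proof.
move=> solH ntH piH; have /andP[sH'H ltH'H] := sol_der1_proper solH (subxx _) ntH.
have gt1 : 1 < #|H : H^`(1)| by rewrite indexg_gt1.
exists (pdiv #|H : H^`(1)|); last by rewrite pdiv_prime ?pdiv_dvd.
apply: (pgroupP piH); rewrite ?pdiv_prime //.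
by apply: dvdn_trans (pdiv_dvd _) (dvdn_indexg _ _).
Qed.

Lemma pred2C p q : pred2 p q =i pred2 q p.
Proof. by move=> r; rewrite !inE orbC. Qed.

Lemma arrow_total G p q : solvable G -> nonadj G p q ->
  arrow G p q || arrow G q p.
Proof.
move=> solG npq; have [H hallH] := Hall_exists (pred2 p q) solG.
have [p_pr q_pr _] := nonadj_primes npq; have [piGp _ _ _] := nonadjP _ _ _ npq.
have piHp : p \in \pi(H) by rewrite (pi_Hall hallH) ?inE ?eqxx.
have ntH : H :!=: 1 by apply: contraTneq piHp => /= ->; rewrite cards1.
have solH := solvableS (pHall_sub hallH) solG.
have [r] := sol_index_der1 solH ntH (pHall_pgroup hallH).
rewrite !inE => /orP[]/eqP-> /andP[_ rH]; apply/orP; [left|right].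
  by rewrite /arrow npq; apply/existsP; exists H; rewrite hallH.
rewrite /arrow nonadj_sym npq; apply/existsP; exists H; rewrite rH andbT.
by rewrite (eq_pHall _ _ (pred2C q p)).
Qed.

Lemma arrowP G p q H : solvable G -> (pred2 p q).-Hall(G) H -> arrow G p q ->
  p %| #|H : H^`(1)|.
Proof.
move=> solG hallH /andP[_ /existsP[K /andP[hallK]]].
have [x Gx ->] := Hall_trans solG hallK hallH.
by rewrite derJ indexJg.
Qed.

(* An abelian quotient of [G] of order divisible by [q] would restrict to one of
   the Hall [{p, q}]-subgroup. *)
Lemma arrow_abelian_index G (B : {group gT}) p q : solvable G -> arrow G p q -> B <| G ->
  abelian (G / B) -> q %| #|G : B| -> False.
Proof.
move=> solG apq nsBG abGB qB; have npq := arrow_nonadj apq.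
have [p_pr q_pr neq] := nonadj_primes npq; have [piGp piGq _ _] := nonadjP _ _ _ npq.
have [H hallH] := Hall_exists (pred2 p q) solG.
have sHG := pHall_sub hallH; have nBH := subset_trans sHG (normal_norm nsBG).
have npqH : nonadj H p q.
  by apply: nonadjS npq; rewrite ?(pi_Hall hallH) ?inE ?eqxx ?orbT.
apply: (nonadj_abelian_index npqH (der_normal 1 H) (der_abelian 0 H)).
  exact: arrowP apq.
have der_le : H^`(1) \subset B.
  by rewrite der1_min // (abelianS _ abGB) //; apply: quotientS.
apply: dvdn_trans (indexgS _ der_le); rewrite -card_quotient //.
have hallHB := quotient_pHall nBH hallH.
have : q \in \pi(H / B).
  rewrite (pi_Hall hallHB) ?inE ?eqxx ?orbT // mem_primes q_pr cardG_gt0.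
  by rewrite /= card_quotient ?normal_norm.
by rewrite mem_primes => /and3P[].
Qed.

End Arrow.

Lemma arrow_asym (gT : finGroupType) (G : {group gT}) p q : solvable G ->
  arrow G p q -> ~~ arrow G q p.
Proof.
move=> solG apq; apply/negP=> aqp.
have [H hallH] := Hall_exists (pred2 p q) solG.
have npq := arrow_nonadj apq; have [piGp piGq _ _] := nonadjP _ _ _ npq.
have npqH : nonadj H p q.
  by apply: nonadjS (pHall_sub hallH) _ _ npq; rewrite (pi_Hall hallH) ?inE ?eqxx ?orbT.
apply: (nonadj_abelian_index npqH (der_normal 1 H) (der_abelian 0 H)).
  exact: arrowP apq.
by apply: arrowP aqp => //; rewrite (eq_pHall _ _ (pred2C q p)).
Qed.

(** The orientation cannot flip: if [q] divided the abelianization of the Hall subgroup of [G / N],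
    it would divide that of the Hall subgroup [H] of [G], along with [p]. *)
Lemma arrow_quotient (gT : finGroupType) (G N : {group gT}) p q : solvable G ->
  G \subset 'N(N) -> p \in \pi(G / N) -> q \in \pi(G / N) -> arrow G p q ->
  arrow (G / N) p q.
Proof.
move=> solG nNG piq pip apq; have npq := arrow_nonadj apq.
have npqN := nonadj_quotient piq pip npq.
case/orP: (arrow_total (quotient_sol N solG) npqN) => // aqp.
have [H hallH] := Hall_exists (pred2 p q) solG.
have sHG := pHall_sub hallH; have nNH := subset_trans sHG nNG.
have [piGp piGq _ _] := nonadjP _ _ _ npq.
have npqH : nonadj H p q.
  by apply: nonadjS sHG _ _ npq; rewrite (pi_Hall hallH) ?inE ?eqxx ?orbT.
case: (nonadj_abelian_index npqH (der_normal 1 H) (der_abelian 0 H)).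
  exact: arrowP apq.
have hallHN : (pred2 q p).-Hall(G / N) (H / N).
  by rewrite (eq_pHall _ _ (pred2C q p)) quotient_pHall.
exact: dvdn_trans (arrowP (quotient_sol N solG) hallHN aqp) (index_der1_quotient nNH).
Qed.

Lemma arrow_Hall (gT : finGroupType) (pi : nat_pred) (G K : {group gT}) p q :
  solvable G -> pi.-Hall(G) K -> p \in pi -> q \in pi ->
  arrow G p q = (nonadj G p q && arrow K p q).
Proof.
move=> solG hallK pi_p pi_q; have sKG := pHall_sub hallK.
have [H hallH] := Hall_exists (pred2 p q) (solvableS sKG solG).
have hallHG : (pred2 p q).-Hall(G) H.
  by apply: subHall_Hall hallK _ hallH => r; rewrite !inE => /orP[]/eqP->.
have [npq|] := boolP (nonadj G p q); last by move/negPf=> n; rewrite /arrow n.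
have npqK : nonadj K p q.
  have [piGp piGq _ _] := nonadjP _ _ _ npq.
  by apply: nonadjS npq; rewrite ?(pi_Hall hallK).
apply/idP/idP=> [apq|aK]; rewrite /arrow ?npq ?npqK; apply/existsP; exists H.
  by rewrite hallH (arrowP solG hallHG apq).
by rewrite hallHG (arrowP (solvableS sKG solG) hallH aK).
Qed.

Lemma pi_quotient (gT : finGroupType) (pi : nat_pred) (G N : {group gT}) r :
  N <| G -> pi.-group N -> r \notin pi -> r \in \pi(G) -> r \in \pi(G / N).
Proof.
case/andP=> sNG nNG piN pi'r; rewrite !mem_primes /= => /and3P[r_pr _ rG].
rewrite r_pr cardG_gt0 card_quotient //=; move: rG.
rewrite -(Lagrange sNG) Euclid_dvdM // => /orP[rN|//]; case/negP: pi'r.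
exact: pgroupP piN r r_pr rN.
Qed.

Lemma Sylow_pi_quotient (gT : finGroupType) (G P : {group gT}) p :
  p.-Sylow(G) P -> P <| G -> p \notin \pi(G / P).
Proof.
case/and3P=> _ _ p'GP nsPG; rewrite mem_primes /= card_quotient ?normal_norm //.
apply/and3P=> [[p_pr _ pGP]].
by have := pnatP _ (indexg_gt0 _ _) p'GP p p_pr pGP; rewrite !inE eqxx.
Qed.

(** Modulo [P] the Hall subgroup becomes a nontrivial [q]-group, so [q] divides its
    abelianization. *)
Lemma arrow_normal_Sylow (gT : finGroupType) (G P : {group gT}) p q : solvable G ->
  arrow G p q -> p.-Sylow(G) P -> P <| G -> False.
Proof.
move=> solG apq sylP nsPG; have npq := arrow_nonadj apq.
have [p_pr q_pr neq] := nonadj_primes npq; have [piGp piGq _ _] := nonadjP _ _ _ npq.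
have [H hallH] := Hall_exists (pred2 p q) solG; have sHG := pHall_sub hallH.
have nPH := subset_trans sHG (normal_norm nsPG).
have npqH : nonadj H p q.
  by apply: nonadjS sHG _ _ npq; rewrite (pi_Hall hallH) ?inE ?eqxx ?orbT.
apply: (nonadj_abelian_index npqH (der_normal 1 H) (der_abelian 0 H)).
  exact: arrowP apq.
have hallHP := quotient_pHall nPH hallH.
have piHPq : q \in \pi(H / P).
  rewrite (pi_Hall hallHP) ?inE ?eqxx ?orbT //.
  by apply: pi_quotient (pHall_pgroup sylP) _ piGq => //; rewrite !inE eq_sym.
have qHP : q.-group (H / P).
  apply/pgroupP=> r r_pr rHP; have := pgroupP (pHall_pgroup hallHP) r r_pr rHP.
  rewrite !inE => /orP[/eqP rp|//]; case/negP: (Sylow_pi_quotient sylP nsPG).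
  by rewrite -rp -(pi_Hall hallHP) ?inE ?rp ?eqxx // mem_primes -rp r_pr cardG_gt0.
have ntHP : (H / P)%G :!=: 1 by apply: contraTneq piHPq => /= ->; rewrite cards1.
have [r] := sol_index_der1 (quotient_sol P (solvableS sHG solG)) ntHP qHP.
rewrite inE => /eqP-> /andP[_ rHP].
exact: dvdn_trans rHP (index_der1_quotient nPH).
Qed.

(** * Solvable groups *)

(** The dichotomy behind the inductions: a minimal normal subgroup can be divided out, or it is a
    full Sylow subgroup for one of the primes concerned. *)
Lemma Sylow_of_pi_quotient (gT : finGroupType) (G N : {group gT}) (t p : nat) :
  N <| G -> t.-group N -> p \in \pi(G) -> p \notin \pi(G / N) ->
  p = t /\ t.-Sylow(G) N.
Proof.
move=> nsNG tN piGp pi'p; have [sNG nNG] := andP nsNG.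
have pt : p = t.
  by apply/eqP/idPn=> neq; case/negP: pi'p; apply: pi_quotient tN _ piGp.
split=> //; rewrite /pHall sNG tN -card_quotient //=.
apply/pgroupP=> r r_pr rGN; rewrite !inE; apply: contraNneq pi'p => rt.
by rewrite pt -rt mem_primes r_pr cardG_gt0.
Qed.

Section SolvableNonadj.
Variable gT : finGroupType.
Implicit Types G H K M N P : {group gT}.

(** A minimal normal subgroup [M] of the Hall subgroup [H] belongs to one of [p] and [q]; an element
    of [H] of the other order acts without fixed points on [M] and on [N]. By [cent_fpf], [M]
    centralises [N], although their primes are opposite. *)
Lemma nonadj_abelem_normal G N p q r : solvable G -> nonadj G p q ->
  nonadj G p r -> nonadj G q r -> N <| G -> r.-Sylow(G) N -> abelian N -> False.
Proof.
move=> solG npq npr nqr nsNG sylN abN; have [sNG nNG] := andP nsNG.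
have [H hallH] := Hall_exists (pred2 p q) solG; have sHG := pHall_sub hallH.
have solH := solvableS sHG solG.
have [piGp piGr neq_pr _] := nonadjP _ _ _ npr.
have [_ piGq neq_pq _] := nonadjP _ _ _ npq; have [_ _ neq_qr _] := nonadjP _ _ _ nqr.
have ntN : N :!=: 1.
  by rewrite -cardG_gt1 (card_Hall sylN) p_part_gt1.
suff key a b : nonadj G a b -> nonadj G a r -> nonadj G b r -> b \in \pi(H) ->
    forall M : {group gT}, M <| H -> M :!=: 1 -> a.-group M -> False.
  have ntH : H :!=: 1.
    have : p \in \pi(H) by rewrite (pi_Hall hallH) ?inE ?eqxx.
    by apply: contraTneq => /= ->; rewrite cards1.
  have [M [sMH nsMH ntM /is_abelemP[t t_pr /abelem_pgroup tM]]] :=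
    solvable_norm_abelem solH (normal_refl H) ntH.
  have [_ tdvM _] := pgroup_pdiv tM ntM.
  have := pgroupP (pHall_pgroup hallH) t t_pr (dvdn_trans tdvM (cardSg sMH)).
  rewrite !inE => /orP[]/eqP tE; rewrite tE in tM.
    by apply: (key p q) tM; rewrite ?(pi_Hall hallH) ?inE ?eqxx ?orbT.
  by apply: (key q p) tM; rewrite ?(pi_Hall hallH) ?inE ?eqxx // nonadj_sym.
move=> nab nar nbr; rewrite mem_primes /= => /and3P[b_pr _ bH] M /andP[sMH nMH] ntM aM.
have [x Hx ox] := Cauchy b_pr bH; have Gx := subsetP sHG x Hx.
have sMG := subset_trans sMH sHG.
have [a_pr r_pr neq_ar] := nonadj_primes nar.
have rN := pHall_pgroup sylN.
have cMN : M \subset 'C(N).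
  apply: (@cent_fpf _ _ abN M x); rewrite ?(subset_trans sMG) ?(subsetP nNG) ?ox //.
  - exact: (subsetP nMH).
  - apply: (pnat_coprime rN); apply: sub_pgroup aM => c; rewrite !inE => /eqP->.
    by [].
  - by apply: (nonadj_cent1 _ Gx ox sNG rN); rewrite nonadj_sym.
  exact: nonadj_cent1 nab Gx ox sMG aM.
have [_ advM _] := pgroup_pdiv aM ntM; have [y My oy] := Cauchy a_pr advM.
have [_ rdvN _] := pgroup_pdiv rN ntN; have [z Nz oz] := Cauchy r_pr rdvN.
apply: (nonadj_comm nar (subsetP sMG y My) (subsetP sNG z Nz) oy oz).
exact: (centsP cMN).
Qed.

End SolvableNonadj.

(** In a minimal counterexample a minimal normal subgroup is a Sylow subgroup for one of the three
    primes, as a quotient keeping all three would be smaller. *)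
Lemma solvable_no_triangle (gT : finGroupType) (G : {group gT}) p q r :
  solvable G -> nonadj G p q -> nonadj G p r -> nonadj G q r -> False.
Proof.
have [n] := ubnP #|G|; elim: n => // n IHn in gT G *.
move=> /ltnSE-leGn solG npq npr nqr.
have [piGp piGr neq_pr _] := nonadjP _ _ _ npr.
have [_ piGq neq_pq _] := nonadjP _ _ _ npq.
have ntG : G :!=: 1 by apply: contraTneq piGp => /= ->; rewrite cards1.
have [N [sNG nsNG ntN /is_abelemP[t t_pr abN]]] :=
  solvable_norm_abelem solG (normal_refl G) ntG.
have Sy := Sylow_of_pi_quotient nsNG (abelem_pgroup abN).
have cN := abelem_abelian abN.
have [pip|/(Sy _ piGp)[E]] := boolP (p \in \pi(G / N)); last first.
  by rewrite -E => sylN; apply: nonadj_abelem_normal (nqr) _ _ nsNG sylN cN; rewrite // nonadj_sym.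
have [piq|/(Sy _ piGq)[E]] := boolP (q \in \pi(G / N)); last first.
  by rewrite -E => sylN; apply: nonadj_abelem_normal (npr) _ _ nsNG sylN cN; rewrite // nonadj_sym.
have [pir|/(Sy _ piGr)[E]] := boolP (r \in \pi(G / N)); last first.
  by rewrite -E => sylN; apply: nonadj_abelem_normal (npq) _ _ nsNG sylN cN.
apply: (IHn _ (G / N)%G); rewrite ?quotient_sol ?nonadj_quotient //.
by rewrite (leq_trans _ leGn) // ltn_quotient.
Qed.

(** Automorphism groups of cyclic groups are abelian. *)
Lemma der1_cent_cyclic (gT : finGroupType) (K C : {group gT}) :
  cyclic C -> K \subset 'N(C) -> K^`(1) \subset 'C(C).
Proof.
move=> cycC nCK; have nCK' := subset_trans (der_sub 1 K) nCK.
rewrite -ker_conj_aut -sub_morphim_pre // morphim_der //.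
suff /derG1P-> : abelian (conj_aut C @* K) by apply: sub1G.
exact: abelianS (Aut_conj_aut _ _) (Aut_cyclic_abelian cycC).
Qed.

(** * Oriented paths with three edges *)

Section ArrowPath.
Variables (gT : finGroupType) (G S : {group gT}) (p q r s : nat).
Hypotheses (solG : solvable G) (apq : arrow G p q) (nqr : nonadj G q r).
Hypotheses (nrs : nonadj G r s) (neq_ps : p != s) (neq_qs : q != s) (neq_pr : p != r).
Hypothesis piG : [pred t | t \in [:: p; q; r; s]].-group G.
Hypotheses (nsSG : S <| G) (sylS : s.-Sylow(G) S) (abS : abelian S).
Hypothesis s'core : forall E : {group gT}, E <| G -> s^'.-group E -> E :=: 1.

(** A complement [K] of [S] acts faithfully on [S], with elements of order [r] free of fixed points.
    The cases follow the prime of a minimal normal subgroup [M] of [K]; each produces a forbidden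
    centraliser or an abelian quotient of [K] of order divisible by [q], contrary to
    [arrow K p q]. *)
Lemma arrow_path_coprime : False.
Proof.
have npq := arrow_nonadj apq.
have [piGp piGq neq_pq _] := nonadjP _ _ _ npq.
have [piGr piGs neq_rs _] := nonadjP _ _ _ nrs.
have [p_pr q_pr _] := nonadj_primes npq; have [r_pr s_pr _] := nonadj_primes nrs.
have [_ _ neq_qr] := nonadj_primes nqr.
have [sSG nSG] := andP nsSG; have sS := pHall_pgroup sylS.
have [K hallK] := Hall_exists s^' solG; have sKG := pHall_sub hallK.
have solK := solvableS sKG solG; have s'K := pHall_pgroup hallK.
have defG : S * K = G.
  by have /sdprodP[] := sdprod_normal_p'HallP nsSG hallK sylS.
have ntS : S :!=: 1 by rewrite -cardG_gt1 (card_Hall sylS) p_part_gt1.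
have piK : [pred t | t \in [:: p; q; r]].-group K.
  apply/pgroupP=> t t_pr tK; have := pgroupP piG t t_pr (dvdn_trans tK (cardSg sKG)).
  rewrite !inE => /or4P[->|->|->|/eqP ts]; rewrite ?orbT //.
  by have := pgroupP s'K t t_pr tK; rewrite !inE ts eqxx.
have in_piK t : t != s -> t \in \pi(G) -> t %| #|K|.
  move=> ts; rewrite -(pi_Hall hallK) ?inE // mem_primes => /and3P[_ _ ->] //.
have coS (H : {group gT}) : H \subset K -> coprime #|S| #|H|.
  by move=> sHK; apply: pnat_coprime sS (pgroupS sHK s'K).
(* This centraliser is normalised by [K] and centralised by [S], hence normal in [G]. *)
have faith : 'C_K(S) = 1.
  apply: s'core (pgroupS (subsetIl _ _) s'K).
  rewrite /normal subIset ?sKG // -defG mulG_subG.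
  rewrite (subset_trans _ (cent_sub _)) /=; last by rewrite centsC subsetIr.
  by rewrite normsI ?normG // norms_cent // (subset_trans sKG).
have no_cent (H : {group gT}) : H \subset K -> H \subset 'C(S) -> H :=: 1.
  by move=> sHK cHS; apply/trivgP; rewrite -faith subsetI sHK.
have apqK : arrow K p q.
  by move: apq; rewrite (arrow_Hall solG hallK) ?inE // => /andP[].
have cycR (R : {group gT}) : R \subset K -> r.-abelem R -> cyclic R.
  move=> sRK abR; apply: (fpf_abelem_cyclic abS _ _ abR) => //.
  - exact: subset_trans sRK (subset_trans sKG nSG).
  - rewrite coprime_sym prime_coprime // -p'natE // -/(pgroup _ _).
    by apply: sub_pgroup sS => c; rewrite !inE => /eqP->; rewrite eq_sym.
  move=> e /setD1P[nt_e Re]; have Ge := subsetP (subset_trans sRK sKG) e Re.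
  by apply: (nonadj_cent1 _ Ge (abelem_order_p abR Re nt_e) sSG sS); rewrite nonadj_sym.
have no_q_cent (C H : {group gT}) : H :!=: 1 -> r.-group H -> H \subset K ->
    C \subset K -> C \subset 'C(H) -> ~~ (q %| #|C|).
  move=> ntH rH sHK sCK cCH; apply/negP=> qC; have [x Cx ox] := Cauchy q_pr qC.
  have [_ rdvH _] := pgroup_pdiv rH ntH; have [y Hy oy] := Cauchy r_pr rdvH.
  have sub := subset_trans _ sKG.
  apply: (nonadj_comm nqr (subsetP (sub _ sCK) _ Cx) (subsetP (sub _ sHK) _ Hy) ox oy).
  exact: (centsP cCH).
have ntK : K :!=: 1.
  by apply: contraTneq (in_piK p neq_ps piGp) => ->; rewrite cards1 dvdn1 neq_ltn prime_gt1 ?orbT.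
have [M minM sMK] : {M : {group gT} | minnormal M K & M \subset K}.
  by apply: mingroup_exists; rewrite ntK normG.
have [nMK ntM /is_abelemP[t t_pr abM]] := minnormal_solvable minM sMK solK.
have nsMK : M <| K by rewrite /normal sMK.
have tM := abelem_pgroup abM; have [_ tdvM _] := pgroup_pdiv tM ntM.
have := pgroupP piK t t_pr (dvdn_trans tdvM (cardSg sMK)).
have sMG := subset_trans sMK sKG.
rewrite !inE => /or3P[]/eqP tE; subst t.
(* [M] is a [p]-group, so its centraliser [C] has order prime to [q]. Next comes a minimal normal
   subgroup [D / C] of [K / C], with a Sylow subgroup [Q] of [D] that covers it. *)
- have nsCK : 'C_K(M) <| K by rewrite /normal subsetIl normsI ?normG ?norms_cent.
  move: nsCK; set C := ('C_K(M))%G => nsCK; have [sCK nCK] := andP nsCK.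
  have cCM : C \subset 'C(M) by apply: subsetIr.
  have p'q_cent x : x \in C -> #[x] != q.
    move=> Cx; apply/negP=> /eqP ox; have [y My oy] := Cauchy p_pr tdvM.
    apply: (nonadj_comm npq (subsetP sMG _ My) _ oy ox).
      by rewrite (subsetP sKG) // (subsetP sCK).
    by apply: commute_sym; apply: (centsP cCM).
  have q'C : ~~ (q %| #|C|).
    by apply/negP=> /(Cauchy q_pr)[x Cx /eqP]; rewrite (negPf (p'q_cent x Cx)).
  have qK := in_piK q neq_qs piGq.
  have ntKC : (K / C)%G :!=: 1.
    rewrite -cardG_gt1 /= card_quotient // -(@ltn_pmul2l #|C|) ?cardG_gt0 //.
    rewrite muln1 Lagrange // ltn_neqAle subset_leq_card // andbT.
    by apply: contraNneq q'C => ->.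
  have [Db [sDbK nsDb ntDb /is_abelemP[u u_pr abDb]]] :=
    solvable_norm_abelem (quotient_sol C solK) (normal_refl _) ntKC.
  have [D defDb sCD nsDK] := inv_quotientN nsCK nsDb.
  have [sDK nDK] := andP nsDK.
  have uDC : u.-group (D / C) by rewrite -defDb abelem_pgroup.
  have nCD := subset_trans sDK nCK.
  have not_DC : ~~ (D \subset C).
    by apply: contra ntDb => sDC; rewrite defDb -subG1 quotient_sub1.
  have [Q sylQ] := Sylow_exists u D; have sQD := pHall_sub sylQ.
  have sQK := subset_trans sQD sDK.
  have uQ := pHall_pgroup sylQ; have defD : C * Q = D.
    have := quotient_pHall (subset_trans sQD nCD) sylQ.
    rewrite (pHallE u) => /andP[_ /eqP oQ].
    have eQD : Q / C = D / C.
      by apply/eqP; rewrite eqEcard quotientS //= oQ part_pnat_id.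
    by apply/eqP; rewrite eqEsubset mul_subG //= -quotientSK // eQD.
  have not_QC : ~~ (Q \subset C).
    by apply: contra not_DC => sQC; rewrite -defD mulG_subG subxx.
  have frat := Frattini_arg nsDK sylQ.
  have norm_elt a : prime a -> a %| #|K : D| ->
      exists2 x, x \in 'N_K(Q) & #[x] = a.
    rewrite -{1}frat indexMg => a_pr aKD.
    have [x] := Cauchy a_pr (dvdn_trans aKD (dvdn_indexg _ _)); by exists x.
  have qKD : u != q -> q %| #|K : D|.
    move=> neq_uq; move: qK; rewrite -(Lagrange sDK) Euclid_dvdM // => /orP[|//].
    apply: contraLR => _; rewrite -(Lagrange sCD) Euclid_dvdM // negb_or q'C /=.
    rewrite -card_quotient //; apply/negP=> qD.
    by have := pgroupP uDC q q_pr qD; rewrite inE eq_sym (negPf neq_uq).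
  have ntDC : (D / C)%G :!=: 1 by rewrite /= -defDb.
  have [_ udvDC _] := pgroup_pdiv uDC ntDC.
  have udvK : u %| #|K|.
    by rewrite (dvdn_trans udvDC) // (dvdn_trans (dvdn_quotient _ _)) ?cardSg.
  have : [|| u == p, u == r | u == q].
    by have := pgroupP piK u u_pr udvK; rewrite !inE (orbC (u == r)).
  case/or3P=> /eqP uE; subst u.
  (* In the [p]-group [M <*> Q], [M] meets the centre; so ['C_M(D)] is nontrivial and by minimality
     equals [M]. *)
  + case/negP: not_QC; rewrite subsetI sQK /=.
    have nMQ := subset_trans sQK nMK.
    have pMQ : p.-group (M <*> Q) by rewrite norm_joinEr // pgroupM tM.
    have nsM : M <| M <*> Q by rewrite normalYl.
    have ntC := meet_center_nil (pgroup_nil pMQ) nsM ntM.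
    have [_ /(_ 'C_M(D)%G)minM'] := mingroupP minM.
    suff <- : 'C_M(D) = M by rewrite centsC (subset_trans (subsetIr _ _)) // centS.
    apply: minM'; last exact: subsetIl.
    rewrite normsI ?norms_cent // andbT.
    apply: contraNneq ntC => /= C1; rewrite -subG1 -C1 subsetI subsetIl /= -defD centM.
    have cMC : M \subset 'C(C) by rewrite centsC.
    rewrite subsetI (subset_trans (subsetIl _ _) cMC) /=.
    by rewrite subIset // subIset ?centS ?joing_subr ?orbT.
  (* [Q] is an [r]-group. By the Frattini argument an element of order [q] normalises it; acting
     without fixed points on [M] and [Q], it forces [Q] to centralise [M]. *)
  + rewrite eq_sym in neq_qr; have qD := qKD neq_qr.
    have [x /setIP[Kx nQx] ox] := norm_elt q q_pr qD.
    have Gx := subsetP sKG x Kx; case/negP: not_QC; rewrite subsetI sQK /=.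
    apply: (@cent_fpf _ _ (abelem_abelian abM) Q x); rewrite ?ox //.
    - exact: subset_trans sQK nMK.
    - exact: (subsetP nMK).
    - apply: (pnat_coprime tM); apply: sub_pgroup uQ => c; rewrite !inE => /eqP->.
      by rewrite eq_sym.
    - exact: nonadj_cent1 npq Gx ox sMG tM.
    by apply: (nonadj_cent1 _ Gx ox (subset_trans sQK sKG) uQ); rewrite nonadj_sym.
  (* [Q] is a [q]-group. An element of order [r] normalising it would force [Q] to centralise [S];
     otherwise [r] divides the order of [C]. *)
  have [rK|r'KD] := boolP (r %| #|K : D|).
    have [y /setIP[Ky nQy] oy] := norm_elt r r_pr rK; have Gy := subsetP sKG y Ky.
    case/negP: not_QC; rewrite (no_cent Q) ?sub1G //.
    apply: (@cent_fpf _ _ abS Q y); rewrite ?coS ?oy ?(subsetP nSG) //.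
    - by rewrite (subset_trans sQK) // (subset_trans sKG).
    - by apply: (nonadj_cent1 _ Gy oy sSG sS); rewrite nonadj_sym.
    exact: nonadj_cent1 nqr Gy oy (subset_trans sQK sKG) uQ.
  have rC : r %| #|C|.
    have := in_piK r neq_rs piGr; rewrite -(Lagrange sDK) Euclid_dvdM // (negPf r'KD).
    rewrite orbF -(Lagrange sCD) Euclid_dvdM // -card_quotient // => /orP[//|rDC].
    by have := pgroupP uDC r r_pr rDC; rewrite inE eq_sym (negPf neq_qr).
  have [R sylR] := Sylow_exists r C; have sRC := pHall_sub sylR.
  have sRK := subset_trans sRC sCK; have rR := pHall_pgroup sylR.
  have ntR : R :!=: 1 by rewrite -cardG_gt1 (card_Hall sylR) p_part_gt1 mem_primes r_pr cardG_gt0.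
  pose R0 := 'Ohm_1('Z(R))%G; pose N := 'N_K(R)%G.
  have sR0R : R0 \subset R by rewrite /= (subset_trans (Ohm_sub 1 _)) ?center_sub.
  have rR0 : r.-group R0 := pgroupS sR0R rR.
  have ntR0 : R0 :!=: 1 by rewrite Ohm1_eq1 center_nil_eq1 ?(pgroup_nil rR).
  have nR0N : N \subset 'N(R0).
    by apply: (char_norm_trans (gFchar_trans _ (center_char R))); apply: subsetIr.
  have cycR0 : cyclic R0.
    apply: cycR; first exact: subset_trans sR0R sRK.
    by rewrite Ohm1_abelem ?center_abelian ?(pgroupS (center_sub R)).
  pose X := ('C_N(R0))%G; have sNK : N \subset K := subsetIl _ _.
  have sXK : X \subset K := subset_trans (subsetIl _ _) sNK.
  have q'X : ~~ (q %| #|X|).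
    exact: no_q_cent ntR0 rR0 (subset_trans sR0R sRK) sXK (subsetIr _ _).
  have fratC := Frattini_arg nsCK sylR.
  have nXN : N \subset 'N(X) by rewrite normsI ?normG // norms_cent.
  have nCX := subset_trans sXK nCK; have nCN := subset_trans sNK nCK.
  have nsBK : C <*> X <| K.
    rewrite /normal join_subG sCK sXK -{1}fratC mulG_subG.
    by rewrite (subset_trans (joing_subl C X) (normG _)) normsY.
  apply: (arrow_abelian_index solK apqK nsBK).
    have -> : K / (C <*> X) = N / (C <*> X).
      rewrite -{1}fratC quotientMl ?(subset_trans (joing_subl C X) (normG _)) //.
      rewrite quotientS1 ?joing_subl // mul1g //.
    rewrite sub_der1_abelian // (subset_trans _ (joing_subr C X)) // subsetI der_sub.
    exact: der1_cent_cyclic.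
  move: qK; rewrite -(Lagrange (normal_sub nsBK)) Euclid_dvdM // => /orP[|//].
  move=> qB; have : q %| #|C| * #|X|.
    by rewrite (dvdn_trans qB) //= norm_joinEr // mul_cardG dvdn_mulr.
  by rewrite Euclid_dvdM // (negPf q'C) (negPf q'X).
(* [M] is a [q]-group: an element of order [r] has no fixed points on [M] or [S], so [M] centralises
   [S]. *)
- have [y Ky oy] := Cauchy r_pr (in_piK r neq_rs piGr).
  have Gy := subsetP sKG y Ky.
  case/eqP: ntM; apply: no_cent => //.
  apply: (@cent_fpf _ _ abS M y); rewrite ?coS ?oy ?(subsetP nSG) //.
  - exact: subset_trans sMG nSG.
  - exact: (subsetP nMK).
  - by apply: (nonadj_cent1 _ Gy oy sSG sS); rewrite nonadj_sym.
  exact: nonadj_cent1 nqr Gy oy sMG tM.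
(* [M] is an [r]-group, hence cyclic, and [K] modulo its centraliser is abelian of order divisible
   by [q]. *)
have cycM := cycR M sMK abM.
have nsCK : 'C_K(M) <| K by rewrite /normal subsetIl normsI ?normG ?norms_cent.
apply: (arrow_abelian_index solK apqK nsCK).
  by rewrite sub_der1_abelian // subsetI der_sub der1_cent_cyclic.
have /negPf qC : ~~ (q %| #|'C_K(M)|).
  exact: (no_q_cent _ M ntM tM sMK (subsetIl _ _) (subsetIr _ _)).
have := in_piK q neq_qs piGq; rewrite -(Lagrange (normal_sub nsCK)).
by rewrite Euclid_dvdM // qC.
Qed.

End ArrowPath.

(** A minimal counterexample involves only the four primes. A minimal normal subgroup must be a
    Sylow subgroup for one of them, which cannot be the tail of an arrow by [arrow_normal_Sylow], so
    it is the one for [s]. This leaves no nontrivial normal subgroup of order prime to [s]. *)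
Lemma no_arrow_path (gT : finGroupType) (G : {group gT}) p q r s : solvable G ->
  arrow G p q -> arrow G q r -> arrow G r s -> p != s -> p != r -> q != s -> False.
Proof.
have [n] := ubnP #|G|; elim: n => // n IHn in gT G *.
move=> /ltnSE-leGn solG apq aqr ars ps pr qs.
pose pi : nat_pred := [pred t | t \in [:: p; q; r; s]].
have [piG|] := boolP (pi.-group G); last first.
  have [H hallH] := Hall_exists pi solG; have sHG := pHall_sub hallH.
  move=> pi'G; have ltHG : #|H| < #|G|.
    rewrite proper_card // properE sHG; apply: contra pi'G => sGH.
    exact: pgroupS sGH (pHall_pgroup hallH).
  have aH a b : a \in pi -> b \in pi -> arrow G a b -> arrow H a b.
    by move=> pia pib; rewrite (arrow_Hall solG hallH) // => /andP[].
  apply: (IHn _ H (leq_trans ltHG leGn) (solvableS sHG solG)) => //;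
    by apply: aH => //; rewrite !inE eqxx ?orbT.
have [piGp piGq _ _] := nonadjP _ _ _ (arrow_nonadj apq).
have [piGr piGs _ _] := nonadjP _ _ _ (arrow_nonadj ars).
have ntG : G :!=: 1 by apply: contraTneq piGp => /= ->; rewrite cards1.
have step (N : {group gT}) : N <| G -> N :!=: 1 -> is_abelem N ->
    s.-Sylow(G) N /\ s.-abelem N.
  move=> nsNG ntN /is_abelemP[t t_pr abN].
  have Sy := Sylow_of_pi_quotient nsNG (abelem_pgroup abN).
  have [pip|/(Sy _ piGp)[E]] := boolP (p \in \pi(G / N)); last first.
    by rewrite -E => sylN; case: (arrow_normal_Sylow solG apq sylN nsNG).
  have [piq|/(Sy _ piGq)[E]] := boolP (q \in \pi(G / N)); last first.
    by rewrite -E => sylN; case: (arrow_normal_Sylow solG aqr sylN nsNG).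
  have [pir|/(Sy _ piGr)[E]] := boolP (r \in \pi(G / N)); last first.
    by rewrite -E => sylN; case: (arrow_normal_Sylow solG ars sylN nsNG).
  have [pis|/(Sy _ piGs)[E]] := boolP (s \in \pi(G / N)); last by rewrite -E in abN *.
  have solGN := quotient_sol N solG.
  case: (IHn _ (G / N)%G) => //; rewrite ?arrow_quotient ?normal_norm //.
  by rewrite (leq_trans _ leGn) // ltn_quotient // normal_sub.
have [S [sSG nsSG ntS abS]] := solvable_norm_abelem solG (normal_refl G) ntG.
have [sylS sabS] := step S nsSG ntS abS.
apply: (@arrow_path_coprime _ G S p q r s) => //; try exact: arrow_nonadj.
  exact: abelem_abelian sabS.
move=> E nsEG s'E; apply/eqP/idPn => ntE; have [sEG nEG] := andP nsEG.
have [N [sNE nsNG ntN abN]] := solvable_norm_abelem (solvableS sEG solG) nsEG ntE.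
have [_ /abelem_pgroup sN] := step N nsNG ntN abN.
by case/negP: ntN; rewrite trivg_card1; apply/eqP/(pnat_1 sN (pgroupS sNE s'E)).
Qed.

(** * Computing in the alternating group of degree six *)

(** A permutation is the list of its images; as in [permM], the left factor is applied first. *)
Definition mulw (a b : seq nat) : seq nat := [seq nth 0 b i | i <- a].
Definition onew : seq nat := iota 0 6.
Definition expw (a : seq nat) (n : nat) : seq nat := iter n (mulw a) onew.
Definition swapw (i j : nat) : seq nat :=
  [seq if k == i then j else if k == j then i else k | k <- onew].
Fixpoint inversions (a : seq nat) : nat :=
  if a is x :: b then count (fun y => y < x) b + inversions b else 0.
Definition words : seq (seq nat) := permutations onew.
Definition even_words : seq (seq nat) := [seq a <- words | ~~ odd (inversions a)].
Definition fixw (a : seq nat) : nat := count (fun i => nth 6 a i == i) onew.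

(** The inductive step that identifies the parity of inversions with [odd_perm] along a product of
    transpositions. *)
Lemma swap_parity : all (fun a => all (fun i => all (fun j => (i <= j) ||
    (odd (inversions (mulw (swapw i j) a)) == ~~ odd (inversions a)))
  onew) onew) words.
Proof. by vm_cast_no_check (erefl true). Qed.

(* The number of fixed points determines the order of an even permutation of six
   points, except that it vanishes for the cycle types 3+3 and 4+2. *)
Definition wpos (a : seq nat) : nat :=
  if fixw a is 0 then if fixw (mulw a a) is 0 then 3 else 8
  else nth 0 [:: 0; 0; 8; 3; 0; 0; 498] (fixw a).
(** The even permutations with a single fixed point are the 5-cycles. Their negative coefficient is
    kept apart because the check is made in [nat]. *)
Definition wneg (a : seq nat) : nat := if fixw a is 1 then 12 else 0.

(* One generator of each Sylow 5-subgroup: it maps the least moved point to the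
   next one. *)
Definition gens5 : seq (seq nat) :=
  [seq a <- even_words | (fixw a == 1%N) &&
    (if nth 0 a 0 == 0 then nth 0 a 1 == 2
     else nth 0 a 0 == (if nth 0 a 1 == 1%N then 2 else 1%N))].
(** The identity occurs once for each of the 36 subgroups. *)
Definition powers5 : seq (seq nat) :=
  [seq expw a i | a <- gens5, i <- iota 0 5].

(* In the rational group algebra, [36] plus the sum of the elements of order 5,
   which is the sum over the Sylow 5-subgroups, has as inverse [1/16200] times the
   sum with coefficients 498, 8, 3, 8, -12 at the elements of order 1, ..., 5. *)
Lemma sum_Sylow5_unit :
  all (fun a => sumn [seq wpos (mulw b a) | b <- powers5] ==
                sumn [seq wneg (mulw b a) | b <- powers5] + (a == onew) * (90 * 180))
  even_words.
Proof. by vm_cast_no_check (erefl true). Qed.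

Lemma even_word_orders :
  all (fun a => [&& (expw a 6 == onew) ==> (expw a 2 == onew) || (expw a 3 == onew),
                    (expw a 10 == onew) ==> (expw a 2 == onew) || (expw a 5 == onew),
                    (expw a 15 == onew) ==> (expw a 3 == onew) || (expw a 5 == onew) &
                    (expw a 9 == onew) ==> (expw a 3 == onew)]) even_words.
Proof. by vm_cast_no_check (erefl true). Qed.

Definition code (s : 'S_6) : seq nat := [seq val (s i) | i <- enum 'I_6].

Lemma code1 : code 1 = onew.
Proof. by rewrite /onew -val_enum_ord; apply: eq_map => i; rewrite perm1. Qed.

Lemma nth_code s (i : 'I_6) x0 : nth x0 (code s) i = s i.
Proof. by rewrite (nth_map i) ?size_enum_ord // nth_ord_enum. Qed.

Lemma codeM s t : code (s * t) = mulw (code s) (code t).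
Proof.
by rewrite /mulw /code -map_comp; apply: eq_map => i /=; rewrite nth_code permM.
Qed.

Lemma codeX s n : code (s ^+ n) = expw (code s) n.
Proof. by elim: n => [|n IHn]; rewrite ?expg0 ?code1 // expgS codeM IHn. Qed.

Lemma code_inj : injective code.
Proof.
by move=> s t eq_st; apply/permP=> i; apply/val_inj; rewrite /= -!(nth_code _ _ 0) eq_st.
Qed.

Lemma code_words s : code s \in words.
Proof.
rewrite mem_permutations; apply: uniq_perm; rewrite ?iota_uniq //.
  by rewrite map_inj_uniq ?enum_uniq // => i j /val_inj/perm_inj.
move=> k; rewrite mem_iota add0n; apply/mapP/idP=> [[i _ ->]|lt_k6] //.
  exact: ltn_ord.
by exists (s^-1 (Ordinal lt_k6)); rewrite ?mem_enum // permKV.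
Qed.

Lemma code_surj a : a \in words -> exists s, code s = a.
Proof.
have u_codes : uniq (map code (enum [set: 'S_6])).
  by rewrite map_inj_uniq ?enum_uniq //; apply: code_inj.
have sub : {subset map code (enum [set: 'S_6]) <= words}.
  by move=> _ /mapP[s _ ->]; apply: code_words.
have [|_ eq_w] := uniq_min_size u_codes sub.
  by rewrite size_map -cardE card_Sym card_ord; vm_compute.
by rewrite -eq_w => /mapP[s _ ->]; exists s.
Qed.

Lemma code_tperm (i j : 'I_6) : code (tperm i j) = swapw i j.
Proof.
rewrite /swapw /onew -val_enum_ord -map_comp; apply: eq_map => k /=.
by rewrite permE /= -!val_eqE /=; case: ifP => // _; case: ifP.
Qed.

Lemma code_odd s : odd (inversions (code s)) = odd_perm s.
Proof.
have [ts -> nts] := prod_tpermP s; elim: ts nts => [|[i j] ts IHts] /=.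
  by rewrite big_nil code1 odd_perm1.
case/andP=> nij /IHts{}IHts; rewrite big_cons odd_mul_tperm nij -IHts.
rewrite codeM code_tperm; set t := \prod_(u <- ts) _.
wlog lt_ji : i j nij / j < i => [IH|].
  have [lt|le] := ltnP j i; first exact: IH.
  rewrite (_ : swapw i j = swapw j i) ?IH //; first by rewrite eq_sym.
    by rewrite ltn_neqAle le andbT.
  by apply: eq_map => k; case: eqP => [->|_]; case: eqP.
have /allP/(_ _ (code_words t))/allP := swap_parity.
have in_onew (k : 'I_6) : val k \in onew by rewrite mem_iota /= ltn_ord.
move/(_ _ (in_onew i))/allP/(_ _ (in_onew j)).
by rewrite leqNgt lt_ji => /eqP.
Qed.

Lemma code_even s : (code s \in even_words) = (s \in 'Alt_('I_6)).
Proof. by rewrite mem_filter code_words andbT code_odd Alt_even. Qed.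


Lemma card_Alt6 : #|A6| = 360%N.
Proof.
by apply/eqP; rewrite -(eqn_pmul2l (isT : 0 < 2)%N) card_Alt card_ord.
Qed.

Lemma pi_Alt6 : \pi(A6) =i [:: 2; 3; 5]%N.
Proof. by move=> p; rewrite /= card_Alt6. Qed.

Lemma expw_order s n : (expw (code s) n == onew) = (#[s] %| n).
Proof. by rewrite -codeX -code1 (inj_eq code_inj) order_dvdn. Qed.

Lemma Alt6_order s : s \in A6 -> #[s] \notin [:: 6; 9; 10; 15]%N.
Proof.
rewrite -code_even => /(allP even_word_orders); rewrite !expw_order.
by rewrite !inE; case/and4P => h6 h10 h15 h9; apply/norP; split;
   [|apply/norP; split; [|apply/norP; split]];
   apply/negP=> /eqP o; rewrite o in h6 h10 h15 h9.
Qed.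

Lemma Alt6_nonadj p q : p != q -> p \in [:: 2; 3; 5]%N -> q \in [:: 2; 3; 5]%N ->
  nonadj A6 p q.
Proof.
move=> neq pi_p pi_q; apply/nonadjP; rewrite !pi_Alt6; split=> // s /Alt6_order.
by move: pi_p pi_q neq; rewrite !inE => /or3P[]/eqP-> /or3P[]/eqP->;
  rewrite //= => _; case/norP=> ? /norP[? /norP[? ?]].
Qed.

Lemma Alt6_elt4 : exists2 s, s \in A6 & #[s] = 4%N.
Proof.
have [s cs] : exists s, code s = [:: 1; 2; 3; 0; 5; 4]%N by apply: code_surj.
exists s; first by rewrite -code_even cs.
have : #[s] %| 4 by rewrite -expw_order cs.
have : ~~ (#[s] %| 2) by rewrite -expw_order cs.
by have := @dvdn_leq #[s] 4 isT; case: #[s] => [|[|[|[|[|?]]]]] // ->.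
Qed.

Lemma Alt6_Klein : exists E : {group 'S_6},
  [/\ E \subset A6, 2.-abelem E & ~~ cyclic E].
Proof.
have [s cs] : exists s, code s = [:: 1; 0; 3; 2; 4; 5]%N by apply: code_surj.
have [t ct] : exists t, code t = [:: 2; 3; 0; 1; 4; 5]%N by apply: code_surj.
have cst : commute s t by apply: code_inj; rewrite !codeM cs ct.
have [As At] : s \in A6 /\ t \in A6 by rewrite -!code_even cs ct.
have o2 u : expw (code u) 2 == onew -> code u != onew -> #[u] = 2.
  rewrite expw_order -code1 (inj_eq code_inj) order_dvdn => /eqP u2.
  exact: nt_prime_order.
have os : #[s] = 2 by apply: o2; rewrite cs.
have ot : #[t] = 2 by apply: o2; rewrite ct.
have cEE : <[t]> \subset 'C(<[s]>).
  by rewrite cent_cycle cycle_subG; apply/cent1P.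
have abE : 2.-abelem (<[s]> <*> <[t]>).
  have cE : <[s]> \* <[t]> = <[s]> <*> <[t]> by rewrite cprodEY.
  by rewrite (cprod_abelem _ cE) !prime_abelem.
exists (<[s]> <*> <[t]>)%G; split=> //.
  by rewrite join_subG !cycle_subG As.
rewrite (abelem_cyclic abE) -ltnNge ltnNge; apply/negP=> le1.
have : t \in <[s]>.
  rewrite (_ : <[s]> = <[s]> <*> <[t]>) ?mem_gen ?inE ?cycle_id ?orbT //; apply/eqP.
  rewrite eqEcard joing_subl /= -orderE os (card_pgroup (abelem_pgroup abE)).
  by rewrite -[2%N in leqRHS]expn1 leq_exp2l.
case/cyclePmin=> i; rewrite os => lt_i2 ts; move: ct; rewrite ts codeX cs.
by move: lt_i2; case: i {ts} => [|[|]].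
Qed.

(** * Inverting the sum of the Sylow 5-subgroups *)

Section Sylow5.
Variables (V : zmodType) (R : 'S_6 -> V).
Hypothesis sumR0 : forall x h, x \in A6 -> #[x] = 5%N -> h \in A6 ->
  (\sum_(i < 5) R (x ^- i * h)%g = 0)%R.

(** The integers multiplying [R g] are the coefficients of a product in the group algebra with one
    factor the sum of the Sylow 5-subgroups. Expanding that factor splits the sum into ones that
    vanish by [sumR0]. *)
Lemma Alt6_sum_coef (w : seq nat -> nat) :
  (\sum_(g in A6) R g *+ sumn [seq w (mulw b (code g)) | b <- powers5] = 0)%R.
Proof.
pose X := [seq x <- enum A6 | code x \in gens5].
have XA x : x \in X -> x \in A6 by rewrite mem_filter mem_enum => /andP[].
have X5 x : x \in X -> #[x] = 5%N.
  rewrite mem_filter mem_enum => /andP[cx Ax].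
  have /allP/(_ _ cx)/andP[] : all (fun a => (expw a 5 == onew) && (a != onew)) gens5.
    by vm_cast_no_check (erefl true).
  rewrite expw_order order_dvdn -code1 (inj_eq code_inj) => /eqP x5.
  exact: nt_prime_order.
have defX : perm_eq (map code X) gens5.
  apply: uniq_perm.
  - by rewrite (map_inj_uniq code_inj) filter_uniq // enum_uniq.
  - by rewrite filter_uniq // filter_uniq // permutations_uniq.
  move=> a; apply/mapP/idP=> [[x Xx ->]|ga].
    by move: Xx; rewrite mem_filter => /andP[].
  have [s cs] : exists s, code s = a.
    by apply: code_surj; move: ga; rewrite !mem_filter => /and3P[].
  exists s => //; rewrite mem_filter mem_enum -code_even cs ga.
  by move: ga; rewrite mem_filter => /andP[].
transitivity (\sum_(x <- X) \sum_(i < 5) \sum_(g in A6) R g *+ w (code (x ^+ i * g)%g))%R.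
  under [RHS]eq_bigr => x _ do rewrite exchange_big.
  rewrite [RHS]exchange_big; apply: eq_bigr => g _.
  rewrite sumnE big_map /powers5 big_allpairs_dep -(perm_big _ defX) big_map -sumrMnr.
  apply: eq_bigr => x _; rewrite -sumrMnr.
  rewrite -(big_mkord xpredT (fun i => R g *+ w (code (x ^+ i * g)%g))%R).
  by apply: eq_bigr => i _; rewrite codeM codeX.
rewrite big_seq big1 // => x Xx.
transitivity (\sum_(i < 5) \sum_(h in A6) R (x ^- i * h)%g *+ w (code h))%R.
  apply: eq_bigr => i _; rewrite (reindex_inj (mulgI (x ^- i))) /=.
  apply: eq_big => h; last by rewrite mulKVg.
  by rewrite groupMl // groupV groupX ?XA.
rewrite exchange_big big1 //= => h Ah.
by rewrite sumrMnl (sumR0 (XA x Xx) (X5 x Xx) Ah) mul0rn.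
Qed.

(** By [sum_Sylow5_unit], the relations for [wpos] and [wneg] differ only in the term at 1. *)
Lemma Alt6_fixed_sum : (R 1%g *+ (90 * 180) = 0)%R.
Proof.
have := Alt6_sum_coef wpos; have := Alt6_sum_coef wneg.
have E g : g \in A6 -> sumn [seq wpos (mulw b (code g)) | b <- powers5] =
    (sumn [seq wneg (mulw b (code g)) | b <- powers5] + (g == 1%g) * (90 * 180))%N.
  rewrite -code_even => /(allP sum_Sylow5_unit)/eqP->.
  by rewrite -code1 (inj_eq code_inj).
move=> neg0; under eq_bigr => g Ag do rewrite (E g Ag) mulrnDr.
rewrite big_split /= neg0 add0r (bigD1 1%g) ?group1 //= eqxx mul1n.
by rewrite big1 ?addr0 // => g /andP[_ /negPf->].
Qed.

End Sylow5.

Section Alt6Action.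
Import FiniteModule.

(** As [D] centralises [A], the quotient [A6] acts on [A], and [Alt6_fixed_sum] applies to the
    translates of a vector [u]. It gives [16200 u = 0], where 16200 has only the prime divisors 2, 3
    and 5. *)
Lemma Alt6_fpf5 (gT : finGroupType) (L D A : {group gT}) :
  D <| L -> L / D \isog A6 -> D \subset 'C(A) -> L \subset 'N(A) -> abelian A ->
  coprime #|A| 30 -> {in L, forall x, #[x] = 5%N -> 'C_A[x] = 1} -> A :=: 1.
Proof.
case/andP=> sDL nDL /isogP[f injf fLD] cDA nAL abA coA30 fpf.
have nA x : x \in L -> x \in 'N(A) by apply: (subsetP nAL).
have nD x : x \in L -> x \in 'N(D) by apply: (subsetP nDL).
(* A choice of representatives, not a morphism; [eq_act] shows that the action depends only on the
   image in [A6]. *)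
pose l s := odflt 1 [pick x in L | f (coset D x) == s].
have lP s : s \in A6 -> l s \in L /\ f (coset D (l s)) = s.
  rewrite -{1}fLD => /morphimP[xb _ /morphimP[x _ Lx ->] ->].
  rewrite /l; case: pickP => [y /andP[Ly /eqP] //|/(_ x)].
  by rewrite Lx eqxx.
have eq_act (u : fmod_of abA) x y : x \in L -> y \in L ->
    f (coset D x) = f (coset D y) -> (u ^@ x = u ^@ y)%R.
  move=> Lx Ly /(injmP injf) exy.
  have := exy (mem_quotient D Lx) (mem_quotient D Ly).
  move/(rcoset_kercosetP (nD x Lx) (nD y Ly))/rcosetP=> [d Dd ->].
  have Ld := subsetP sDL d Dd; rewrite actrM ?nA //; congr (actr _ y).
  apply: val_inj; rewrite /= fmvalJ ?nA //; apply/conjg_fixP/commgP/commute_sym.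
  by apply: (centsP cDA) => //; apply: fmodP.
(* Here [y] may have order a proper multiple of 5. The sum is fixed by [y], hence by its power of
   order 5. *)
have sum0 (u : fmod_of abA) y : y \in L -> #[f (coset D y)] = 5%N ->
    (\sum_(i < 5) u ^@ (y ^+ i)%g = 0)%R.
  move=> Ly oy; apply: val_inj => /=; apply/set1P.
  have Lyi i : y ^+ i \in L by rewrite groupX.
  have oy5 : 5 %| #[y].
    rewrite -oy (dvdn_trans (morph_order _ _)) ?mem_quotient //.
    by rewrite morph_order ?nD.
  rewrite -[[set _]]/[1] -(_ : 'C_A[y ^+ (#[y] %/ 5)] = 1); last first.
    by apply: fpf => //; rewrite orderXdiv ?divn_dvd // ?dvdn_div // divnA // mulKn.
  rewrite inE fmodP -cent_cycle (subsetP (centS (cycleX y _))) // cent_cycle.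
  apply/cent1P/commgP/conjg_fixP; rewrite -fmvalJ ?nA //; congr (fmval _).
  rewrite actr_sum; under eq_bigr => i _ do rewrite -(actrM (nA _ (Lyi i)) (nA _ Ly)) -expgSr.
  rewrite big_ord_recr [RHS]big_ord_recl /= addrC expg0; congr (_ + _)%R.
  apply: eq_act; rewrite ?group1 // !morphX ?mem_quotient ?nD // !morph1.
  by apply/eqP; rewrite -order_dvdn oy.
apply/trivgP/subsetP=> a Aa; pose u := fmod abA a.
suff u0 : u = 0%R by rewrite inE -(fmodK abA Aa) -/u u0.
apply: (@fmod_natmul_eq0 _ _ abA (90 * 180)).
  have co n : n %| 30 -> coprime #|A| n by move/coprime_dvdr->.
  by rewrite (_ : 90 = 30 * 3)%N // (_ : 180 = 30 * 6)%N // !coprimeMr !co.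
have [L1 f1] := lP 1 (group1 _).
have <- : (u ^@ (l 1%g) = u)%R.
  by rewrite (eq_act u _ 1%g) ?group1 ?actr1 // f1 !morph1.
apply: (@Alt6_fixed_sum _ (fun s => u ^@ l s)%R) => x h Ax ox Ah.
have [Lx fx] := lP x Ax; have [Lh fh] := lP h Ah.
transitivity ((\sum_(i < 5) u ^@ ((l x)^-1 ^+ i)%g) ^@ l h)%R; last first.
  by rewrite sum0 ?groupV ?act0r // morphV ?nD // morphV ?mem_quotient // fx orderV.
rewrite actr_sum; apply: eq_bigr => i _.
have Lxi : (l x)^-1 ^+ i \in L by rewrite groupX ?groupV.
rewrite -(actrM (nA _ Lxi) (nA _ Lh)); apply: eq_act; rewrite ?groupM //.
  by case: (lP (x ^- i * h)); rewrite // groupM ?groupV ?groupX.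
have [_ ->] : l (x ^- i * h) \in L /\ f (coset D (l (x ^- i * h))) = x ^- i * h.
  by apply: lP; rewrite groupM ?groupV ?groupX.
rewrite morphM ?nD // morphM ?mem_quotient // fh morphX ?nD ?groupV //.
rewrite morphX ?mem_quotient ?groupV // morphV ?nD // morphV ?mem_quotient //.
by rewrite fx expgVn.
Qed.

End Alt6Action.

(** * Composition factors *)

Definition abelian_or_Alt6 (gT : finGroupType) (K : {set gT}) : bool :=
  abelian K || (K \isog A6).

Lemma abelian_or_Alt6_isog (gT rT : finGroupType) (K : {group gT}) (M : {group rT}) :
  K \isog M -> abelian_or_Alt6 K = abelian_or_Alt6 M.
Proof.
by move=> isoKM; rewrite /abelian_or_Alt6 (isog_abelian isoKM) (isog_transl _ isoKM).
Qed.

Definition factors_ok (gT : finGroupType) (G : {group gT}) (s : seq {group gT}) :=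
  all (fun K : section gT => abelian_or_Alt6 K) (pairmap (@mkSec gT) G s).

Lemma pseudo_A6P (gT : finGroupType) (G : {group gT}) s : comps G s ->
  pseudo_A6_solvable G <-> factors_ok G s.
Proof.
move=> csG; split=> [psG|/allP okG K [t ctG]].
  by apply/allP=> K sK; apply/orP/psG; exists s.
have eqf := JordanHolderUniqueness ctG csG.
move=> /(map_f (@section_repr gT)); rewrite -/(mkfactors G t) (perm_mem eqf).
case/mapP=> M sM eqKM; apply/orP; rewrite -/(abelian_or_Alt6 K).
have isoKM : K \isog M.
  by rewrite -(isog_transr _ (section_reprP M)) -eqKM isog_sym section_reprP.
by rewrite (abelian_or_Alt6_isog isoKM) okG.
Qed.

Lemma maxnormal_simple (gT : finGroupType) (G H : {group gT}) :
  maxnormal H G G = (H <| G) && simple (G / H).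
Proof.
have [nsHG|] := boolP (H <| G); first by rewrite quotient_simple.
by apply: contraNF => /maxnormal_normal.
Qed.

(** The preimages of a composition series of [X] continue into one of [N], with isomorphic
    factors. *)
Lemma factors_ok_cosetpre (gT : finGroupType) (N : {group gT}) t
    (X : {group coset_of N}) s : comps N t -> comps X s ->
  exists2 u, comps (coset N @*^-1 X)%G u
    & factors_ok (coset N @*^-1 X)%G u = factors_ok X s && factors_ok N t.
Proof.
move=> ctN; elim: s X => [|Y s IHs] X csX.
  have defN : (coset N @*^-1 X)%G = N.
    apply: val_inj => /=; have := trivg_comps csX; rewrite eqxx => /eqP->.
    by rewrite -kerE ker_coset.
  by exists t; rewrite defN.
have [u cu ok_u] := IHs Y (comps_cons csX).
have /compsP[_ /= /andP[maxY _]] := csX.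
have [nsYX simXY] : Y <| X /\ simple (X / Y) by apply/andP; rewrite -maxnormal_simple.
have nsYX' : coset N @*^-1 Y <| coset N @*^-1 X by rewrite cosetpre_normal.
have isoXY : (coset N @*^-1 X / coset N @*^-1 Y) \isog (X / Y).
  rewrite isog_sym.
  have := @third_isog _ (coset N @*^-1 X)%G N (coset N @*^-1 Y)%G.
  rewrite /= !cosetpreK isog_sym; apply; rewrite ?sub_cosetpre //.
  by rewrite /normal sub_cosetpre subsetIl.
exists ((coset N @*^-1 Y)%G :: u).
  apply/compsP; have /compsP[ls /= pu] := cu; split=> //=.
  by rewrite pu maxnormal_simple nsYX' (isog_simple isoXY) simXY.
rewrite /factors_ok /= -!/(factors_ok _ _) ok_u andbA; congr (_ && _ && _).
exact: (abelian_or_Alt6_isog isoXY).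
Qed.

Lemma pseudo_A6_extension (gT : finGroupType) (G N : {group gT}) : N <| G ->
  pseudo_A6_solvable G <-> pseudo_A6_solvable N /\ pseudo_A6_solvable (G / N).
Proof.
move=> nsNG; have [t ctN] := exists_comps N; have [s csGN] := exists_comps (G / N).
have [u] := factors_ok_cosetpre ctN csGN.
have -> : (coset N @*^-1 (G / N))%G = G by apply: val_inj; rewrite /= quotientGK.
move=> cuG ok; have [[toG ofG] [toN ofN]] := (pseudo_A6P cuG, pseudo_A6P ctN).
have [toGN ofGN] := pseudo_A6P csGN.
split=> [/toG|[/toN okN /toGN okGN]]; last by apply: ofG; rewrite ok okN okGN.
by rewrite ok => /andP[/ofGN ? /ofN].
Qed.

Lemma pseudo_A6_simple (gT : finGroupType) (G : {group gT}) : simple G ->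
  pseudo_A6_solvable G <-> abelian_or_Alt6 G.
Proof.
move=> simG; have csG : comps G [:: 1%G].
  by rewrite /comps eqxx /= andbT -simple_maxnormal.
have := pseudo_A6P csG; rewrite /factors_ok /= andbT.
by rewrite -(abelian_or_Alt6_isog (quotient1_isog G)).
Qed.

Lemma solvable_pseudo_A6 (gT : finGroupType) (G : {group gT}) : solvable G ->
  pseudo_A6_solvable G.
Proof.
have [n] := ubnP #|G|; elim: n => // n IHn in gT G *.
move=> /ltnSE-leGn solG; have [G1|ntG] := eqVneq G 1%G.
  have csG : comps G [::] by rewrite /comps G1 eqxx.
  exact/(pseudo_A6P csG).
have [N maxN] := ex_maxnormal_ntrivg ntG.
have nsNG := maxnormal_normal maxN; apply/(pseudo_A6_extension nsNG); split.
  apply: IHn (solvableS (normal_sub nsNG) solG).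
  by rewrite (leq_trans _ leGn) // proper_card // (maxnormal_proper maxN).
have simGN : simple (G / N) by rewrite quotient_simple.
apply/(pseudo_A6_simple simGN); rewrite /abelian_or_Alt6.
by rewrite cyclic_abelian // prime_cyclic // simple_sol_prime // quotient_sol.
Qed.

Lemma pseudo_A6_isog (gT rT : finGroupType) (G : {group gT}) (H : {group rT}) :
  G \isog H -> pseudo_A6_solvable G -> pseudo_A6_solvable H.
Proof.
have [n] := ubnP #|G|; elim: n => // n IHn in gT rT G H *.
move=> /ltnSE-leGn isoGH psG; have [simG|nsimG] := boolP (simple G).
  have simH : simple H by rewrite -(isog_simple isoGH).
  apply/(pseudo_A6_simple simH); rewrite -(abelian_or_Alt6_isog isoGH).
  exact/(pseudo_A6_simple simG).
have [G1|ntG] := eqVneq G 1%G.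
  apply: solvable_pseudo_A6; rewrite -(isog_sol isoGH) G1; exact: solvable1.
have [N maxN] := ex_maxnormal_ntrivg ntG; have nsNG := maxnormal_normal maxN.
have [psN psGN] := (pseudo_A6_extension nsNG).1 psG.
have ltNG := proper_card (maxnormal_proper maxN).
have ntN : N :!=: 1.
  apply: contraNneq nsimG => N1; rewrite simple_maxnormal.
  by rewrite -[1]N1.
have [f injf fG] := isogP isoGH.
have nsfN : f @* N <| H by rewrite -fG morphim_normal.
apply/(pseudo_A6_extension nsfN); split.
  apply: IHn psN; first exact: leq_trans ltNG leGn.
  exact: sub_isog (normal_sub nsNG) injf.
apply: IHn psGN; first by rewrite (leq_trans _ leGn) // ltn_quotient ?normal_sub.
apply/isogP; exists (quotm_morphism f nsNG); first exact: injm_quotm.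
by rewrite /= morphim_quotm fG.
Qed.

(** * Groups involving the alternating group of degree six *)

Section MinnormalAlt6.
Variables (gT : finGroupType) (G N : {group gT}).
Hypotheses (psG : pseudo_A6_solvable G) (minN : minnormal N G) (sNG : N \subset G).
Hypothesis nsolN : ~~ solvable N.

(** [N] is generated by the conjugates of a minimal normal subgroup [S] of [N], any two of which
    coincide or commute. The listed properties replace an explicit decomposition into a direct
    product; the fourth one says that [N] has trivial centre. *)
Lemma minnormal_Alt6_factor : exists S : {group gT},
  [/\ S <| N, S \isog A6, N \subset S <*> 'C(S),
      forall x, x \in N -> (forall g, g \in G -> x \in 'C(S :^ g)) -> x = 1
    & forall y, y \in G -> S :^ y = S \/ S :^ y \subset 'C(S)].
Proof.
have [/andP[ntN nNG] minNP] := mingroupP minN.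
have [S minS sSN] : {S : {group gT} | minnormal S N & S \subset N}.
  by apply: mingroup_exists; rewrite ntN normG.
have [/andP[ntS nSN] minSP] := mingroupP minS; have nsSN : S <| N by apply/andP.
have sSgN g : g \in G -> S :^ g \subset N.
  by move=> Gg; rewrite -(normsP nNG g Gg) conjSg.
have conjS g : g \in G -> S :^ g = S \/ S :^ g \subset 'C(S).
  move=> Gg; have nSgN : N \subset 'N(S :^ g).
    by rewrite normJ -{1}(normsP nNG g Gg) conjSg.
  have [TI|ntI] := eqVneq (S :^ g :&: S) 1; [right | left].
    rewrite (sameP commG1P trivgP) -TI subsetI commg_subl commg_subr.
    by rewrite (subset_trans sSN) // (subset_trans (sSgN g Gg)).
  have sub : S :^ g :&: S = S.
    by apply: (minSP [group of S :^ g :&: S]); rewrite ?subsetIr ?ntI ?normsI.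
  by apply/eqP; rewrite eq_sym eqEcard cardJg leqnn andbT -{1}sub subsetIl.
have defN : <<class_support S G>> = N.
  apply: (minNP [group of <<class_support S G>>]).
    rewrite norms_gen ?class_support_norm // andbT.
    apply: contraNneq ntS => S1; rewrite -subG1 -S1 sub_gen // sub_class_support.
    done.
  rewrite gen_subG class_supportEr; apply/bigcupsP=> g Gg; exact: sSgN.
have sub_all (X : {group gT}) : (forall g, g \in G -> S :^ g \subset X) -> N \subset X.
  move=> sX; rewrite -defN gen_subG class_supportEr; apply/bigcupsP=> g Gg; exact: sX.
(* A normal subgroup of [S] is normalised by every conjugate of [S], hence by [N]. *)
have simS : simple S.
  apply/simpleP; split=> // M nsM; have [->|ntM] := eqVneq M 1%G; first by left.
  right; have [sMS nMS] := andP nsM; apply: minSP => //; rewrite ntM.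
  apply: sub_all => g Gg; case: (conjS g Gg) => [->|cS] //.
  by rewrite cents_norm // (subset_trans cS) // centS.
have nsNG : N <| G by apply/andP.
have [psN _] := (pseudo_A6_extension nsNG).1 psG.
have [psS _] := (pseudo_A6_extension nsSN).1 psN.
have isoS : S \isog A6.
  (* If [S] were abelian, all its conjugates would commute and [N] would be abelian. *)
  have := (pseudo_A6_simple simS).1 psS; case/orP=> // abS; case/negP: nsolN.
  apply: abelian_sol; apply: (sub_all [group of 'C(N)]) => g Gg /=.
  rewrite centsC; apply: (sub_all [group of 'C(S :^ g)]) => h Gh /=.
  have Ghg : h * g^-1 \in G by rewrite groupM ?groupV.
  rewrite -(conjSg _ _ g^-1) -conjsgM centJ conjsgK.
  by case: (conjS _ Ghg) => [->|].
have ntZ : 'Z(N) = 1.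
  apply/eqP/idPn=> ntZ; case/negP: nsolN; apply: abelian_sol.
  have defZ : 'Z(N) = N.
    apply: (minNP [group of 'Z(N)]); rewrite ?center_sub // ntZ /=.
    exact: char_norm_trans (center_char N) nNG.
  by rewrite -defZ center_abelian.
exists S; split=> //.
  apply: (sub_all [group of S <*> 'C(S)]) => g Gg /=.
  by case: (conjS g Gg) => [->|/subset_trans-> //]; rewrite ?joing_subl ?joing_subr.
move=> x Nx cx; apply/set1P; rewrite -[[set 1]]ntZ inE Nx /= -sub1set centsC.
apply: (sub_all [group of 'C([set x])]) => g Gg /=.
by rewrite centsC sub1set cx.
Qed.

End MinnormalAlt6.

Section PrimeOutside.
Variables (gT : finGroupType) (G S : {group gT}) (y : gT) (w t : nat).
Hypotheses (sSG : S \subset G) (isoS : S \isog A6) (Gy : y \in G) (oy : #[y] = t).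
Hypotheses (w235 : w \in [:: 2; 3; 5]%N) (t235 : t \notin [:: 2; 3; 5]%N).
Hypothesis nwt : nonadj G w t.

(** By coprime action [y] normalises a Sylow [w]-subgroup [W] of [S], without fixed points, so [t]
    divides [#|W| - 1], which is 7, 8 or 4. Only [w = 2], [t = 7] survives. *)
Lemma nonadj_norm_Alt6 : y \in 'N(S) -> False.
Proof.
move=> nSy; have [w_pr t_pr neq_wt] := nonadj_primes nwt.
have oS : #|S| = 360%N by rewrite (card_isog isoS) card_Alt6.
have coSt : coprime #|S| #|<[y]>|.
  rewrite -orderE oy oS coprime_sym prime_coprime //.
  by apply: contra t235 => t360; rewrite -[_ :: _]/(primes 360) mem_primes t_pr.
have nSyy : <[y]> \subset 'N(S) by rewrite cycle_subG.
have [W sylW nWy] := sol_coprime_Sylow_exists w (abelian_sol (cycle_abelian y)) nSyy coSt.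
have sWS := pHall_sub sylW; have wW := pHall_pgroup sylW.
have C1 : 'C_W[y] = 1 by apply: nonadj_cent1 nwt Gy oy (subset_trans sWS sSG) wW.
have reg : semiregular W <[y]>.
  move=> x /setD1P[ntx yx]; apply/trivgP; rewrite -C1 /=.
  rewrite -[in X in X \subset _]cent_cycle -cent_cycle.
  apply: setIS; apply: centS; apply: prime_meetG; rewrite -?orderE ?oy //.
  by apply/trivgPn; exists x; rewrite // inE yx cycle_id.
have := regular_norm_dvd_pred nWy reg; rewrite -orderE oy (card_Hall sylW) oS p_part.
have dv_235 n : t %| n -> 0 < n -> t \in primes n by rewrite mem_primes t_pr => -> ->.
have Ww : #|W| = (w ^ logn w 360)%N by rewrite (card_Hall sylW) oS p_part.
move: w235 Ww sylW; rewrite !inE => /or3P[]/eqP->; last 2 first.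
- by move=> _ _ /dv_235/(_ isT); rewrite inE => /eqP t2; case/negP: t235; rewrite t2.
- by move=> _ _ /dv_235/(_ isT); rewrite inE => /eqP t2; case/negP: t235; rewrite t2.
move=> oW' sylW2; have {oW'} oW : #|W| = 8%N by rewrite oW'.
move/dv_235/(_ isT); rewrite inE => /eqP t7'; have {t7'} t7 : t = 7%N by rewrite t7'.
have [s As os] := Alt6_elt4; have /isogP[f injf fS] : A6 \isog S by rewrite isog_sym.
have Sv : f s \in S by rewrite -fS mem_morphim.
have ov : #[f s] = 4%N by rewrite order_injm.
have [||x Sx svW] := Sylow_subJ sylW2 (_ : <[f s]> \subset S).
- by rewrite cycle_subG.
- by rewrite /pgroup -orderE ov.
have {svW} Wv : f s ^ x^-1 \in W by rewrite -mem_conjg -cycle_subG.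
have {}ov : #[f s ^ x^-1] = 4%N by rewrite orderJ.
move: (f s ^ x^-1) Wv ov => v Wv ov.
have ntv : v != 1 by rewrite -order_eq1 ov.
have Wv1 : v \in W^# by rewrite !inE ntv.
(* The seven conjugates of [v] exhaust [W^#], but [v] has order 4 and its square has not. *)
have defW : v ^: <[y]> = W^#.
  apply/eqP; rewrite eqEcard class_sub_norm ?normD1 // Wv1 /=.
  rewrite -index_cent1 ['C__[v]](semiregular_sym reg) // indexg1 -orderE oy t7.
  by move: oW; rewrite (cardsD1 1) group1 add1n => -[->].
have : v ^+ 2 \in W^# by rewrite !inE groupX // andbT -order_dvdn ov.
rewrite -defW => /imsetP[z _ ev]; have := orderXdvd v 2.
have : #[v ^+ 2] = 4%N by rewrite ev orderJ.
by rewrite (orderXdiv (n := 2)) ov.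
Qed.

Lemma isog_Alt6_center (rT : finGroupType) (T : {group rT}) : T \isog A6 -> 'Z(T) = 1.
Proof.
move=> isoT; have simT : simple T by rewrite (isog_simple isoT) simple_Alt5 ?card_ord.
have /simpleP[_ /(_ 'Z(T)%G (center_normal T))[//|/= ZT]] := simT.
have : solvable A6 by rewrite -(isog_sol isoT) abelian_sol // -ZT center_abelian.
by rewrite solvable_AltF ?card_ord.
Qed.

(* The product of the conjugates of an element of [S] by the powers of [y] is
   centralised by [y], and not trivial as all factors but one centralise [S]. *)
Lemma nonadj_move_Alt6 :
  (forall z, z \in G -> S :^ z = S \/ S :^ z \subset 'C(S)) -> False.
Proof.
move=> conjS; have [w_pr t_pr neq_wt] := nonadj_primes nwt.
have [nSy|not_nSy] := boolP (y \in 'N(S)); first exact: nonadj_norm_Alt6.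
have sYG : <[y]> \subset G by rewrite cycle_subG.
have cS z : z \in <[y]> -> z != 1 -> S :^ z \subset 'C(S).
  move=> Yz ntz; case: (conjS z (subsetP sYG z Yz)) => // nSz.
  case/negP: not_nSy; rewrite -cycle_subG.
  apply: (subset_trans (_ : _ \subset <[z]>)).
    apply: prime_meetG; rewrite -?orderE ?oy //.
    by apply/trivgPn; exists z; rewrite // inE Yz cycle_id.
  by rewrite cycle_subG inE nSz.
have wS : w %| #|S|.
  rewrite (card_isog isoS); have : w \in \pi(A6) by rewrite pi_Alt6.
  by rewrite mem_primes => /and3P[].
have [s Ss os] := Cauchy w_pr wS.
have abX : abelian <<s ^: <[y]> >>.
  rewrite abelian_gen; apply/centsP=> _ /imsetP[a Ya ->] _ /imsetP[b Yb ->].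
  have [<-|neq_ab] := eqVneq a b; first exact: commute_refl.
  have ntab : a * b^-1 != 1 by rewrite -eq_mulgV1.
  have Yab : a * b^-1 \in <[y]> by rewrite groupM ?groupV.
  have csb : commute (s ^ (a * b^-1)) s.
    by apply: (centsP (cS _ Yab ntab)); rewrite // memJ_conjg.
  have eb : (s ^ (a * b^-1)) ^ b = s ^ a by rewrite -conjgM mulgKV.
  by rewrite /commute -eb -conjMg csb conjMg.
pose X := <<s ^: <[y]> >>%G.
have Xs : s \in X by rewrite mem_gen ?class_refl.
have nXY : <[y]> \subset 'N(X) by rewrite norms_gen ?class_norm.
have sXG : X \subset G.
  by rewrite gen_subG class_sub_norm ?(subsetP sSG) // (subset_trans sYG) ?normG.
have wX : w.-group X.
  rewrite -pnat_exponent; apply: (@pnat_dvd _ w); last by rewrite pnat_id.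
  have abs : abelian (s ^: <[y]>) by move: abX; rewrite abelian_gen.
  rewrite /= (abelian_exponent_gen abs).
  have ex a : a \in s ^: <[y]> -> a ^+ w = 1.
    by case/imsetP=> b _ ->; rewrite -conjXg -os expg_order conj1g.
  exact/exponentP.
have CX1 : 'C_X(<[y]>) = 1.
  by rewrite cent_cycle; apply: nonadj_cent1 nwt Gy oy sXG wX.
have := fmod_fix_sum (FiniteModule.fmod abX s) nXY CX1.
rewrite (bigD1 1) ?group1 //= FiniteModule.actr1 => /(congr1 (@FiniteModule.fmval _ _ _)).
rewrite FiniteModule.fmvalA FiniteModule.fmodK // FiniteModule.fmval0 => /eqP.
rewrite -eq_invg_mul.
set r := (\sum_(z in _ | _) _)%R => /eqP sr.
have : s \in 'Z(S).
  rewrite inE Ss -groupV sr /r; elim/big_rec: _ => [|z u /andP[Yz ntz] cu].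
    by rewrite FiniteModule.fmval0 group1.
  rewrite FiniteModule.fmvalA groupM // FiniteModule.fmvalJ ?(subsetP nXY) //.
  by rewrite FiniteModule.fmodK // (subsetP (cS z Yz ntz)) // memJ_conjg.
by rewrite (isog_Alt6_center isoS) => /set1P s1; move: os w_pr; rewrite s1 order1 => <-.
Qed.

End PrimeOutside.

Lemma nonsolvable_Alt6_section (gT : finGroupType) (G : {group gT}) :
  pseudo_A6_solvable G -> ~~ solvable G ->
  exists B C : {group gT}, [/\ B \subset G, C <| B & B / C \isog A6].
Proof.
have [n] := ubnP #|G|; elim: n => // n IHn in G *; move=> /ltnSE-leGn psG nsolG.
have ntG : G :!=: 1 by apply: contraNneq nsolG => ->; rewrite solvable1.
have [N maxN] := ex_maxnormal_ntrivg ntG; have nsNG := maxnormal_normal maxN.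
have [psN psGN] := (pseudo_A6_extension nsNG).1 psG.
have simGN : simple (G / N) by rewrite quotient_simple.
have /orP[abGN|isoGN] := (pseudo_A6_simple simGN).1 psGN; last first.
  by exists G, N; split.
have [||B [C [sBN nsCB isoBC]]] := IHn N _ psN.
- by rewrite (leq_trans _ leGn) // proper_card // (maxnormal_proper maxN).
- by apply: contra nsolG => solN; rewrite (series_sol nsNG) solN abelian_sol.
by exists B, C; rewrite (subset_trans sBN) ?normal_sub.
Qed.

Lemma nonsolvable_pi (gT : finGroupType) (G : {group gT}) p :
  pseudo_A6_solvable G -> ~~ solvable G -> p \in [:: 2; 3; 5]%N -> p \in \pi(G).
Proof.
move=> psG nsolG; rewrite -pi_Alt6 => pA.
have [B [C [sBG nsCB isoBC]]] := nonsolvable_Alt6_section psG nsolG.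
move: pA; rewrite !mem_primes /= -(card_isog isoBC) => /and3P[-> _ pBC] /=.
by rewrite cardG_gt0 (dvdn_trans pBC) // (dvdn_trans (dvdn_quotient _ _)) ?cardSg.
Qed.

(** Given a section [B / C] isomorphic to [A6], take [L] minimal with [C * L = B]. A maximal
    subgroup of [L] not containing [C :&: L] would be a smaller supplement. *)
Lemma nonsolvable_Alt6_cover (gT : finGroupType) (G : {group gT}) :
  pseudo_A6_solvable G -> ~~ solvable G ->
  exists L D : {group gT}, [/\ L \subset G, D <| L, L / D \isog A6 & D \subset 'Phi(L)].
Proof.
move=> psG nsolG; have [B [C [sBG nsCB isoBC]]] := nonsolvable_Alt6_section psG nsolG.
have [sCB nCB] := andP nsCB.
have [L minL sLB] : {L : {group gT} | [min L | C * L == B] & L \subset B}.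
  by apply: mingroup_exists; rewrite mulSGid.
have [/eqP defB minLP] := mingroupP minL; have nCL := subset_trans sLB nCB.
exists L, (C :&: L)%G; split; first exact: subset_trans sLB sBG.
- by rewrite /normal subsetIr normsI ?normG.
- rewrite (isog_transl _ (second_isog nCL)) -(isog_transr _ isoBC).
  have eqLC : L / C = B / C by rewrite -defB quotientMidl.
  by rewrite /= eqLC isog_refl.
apply/bigcapsP=> M; case/predU1P=> [->|maxM]; first exact: subsetIr.
have [/andP[sML ltML] maxMP] := maxgroupP maxM.
apply/idPn=> not_sCLM; case/negP: ltML; rewrite (minLP M) //.
have nML : M \subset 'N(C :&: L) by rewrite (subset_trans sML) ?normsI ?normG.
have eqL : (C :&: L) * M = L.
  apply/eqP; rewrite -norm_joinEr // eqEsubset join_subG subsetIr sML /=.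
  apply: contraR not_sCLM => not_sL.
  rewrite -(maxMP ((C :&: L) <*> M)%G) ?joing_subl ?joing_subr //.
  by rewrite /proper join_subG subsetIr sML.
have CLM : C * L = C * M.
  by rewrite -eqL mulgA (mulGSid (subsetIl C L)).
by rewrite -CLM defB.
Qed.

(** Solvable minimal normal subgroups are divided out until one is a Sylow [t]-subgroup; nonsolvable
    ones are excluded by [nonadj_move_Alt6]. The result is a quotient of [G] itself, so that
    subgroups of [G] have images in it. *)
Lemma outside_reduction (gT : finGroupType) (G : {group gT}) w t :
  pseudo_A6_solvable G -> ~~ solvable G -> nonadj G w t ->
  w \in [:: 2; 3; 5]%N -> t \notin [:: 2; 3; 5]%N ->
  exists M : {group gT}, [/\ M <| G, ~~ solvable (G / M), nonadj (G / M) w t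
    & t.-Sylow(G / M) 'O_t(G / M)].
Proof.
move=> psG nsolG nwt w235 t235.
(* Stated with orders, the Sylow condition passes along the third isomorphism by comparing
   cardinals. *)
suff [M [nsMG nsolGM nwtM oM]] : exists M : {group gT}, [/\ M <| G, ~~ solvable (G / M),
    nonadj (G / M) w t & (#|'O_t(G / M)| == #|G / M|`_t)%N].
  by exists M; split; rewrite // pHallE pcore_sub.
have [n] := ubnP #|G|; elim: n => // n IHn in gT G psG nsolG nwt *.
move=> /ltnSE-leGn; have [piGw piGt _ _] := nonadjP _ _ _ nwt.
have ntG : G :!=: 1 by apply: contraNneq nsolG => ->; rewrite solvable1.
have [N minN sNG] : {N : {group gT} | minnormal N G & N \subset G}.
  by apply: mingroup_exists; rewrite ntG normG.
have [nNG ntN] : G \subset 'N(N) /\ N :!=: 1 by case/andP: (mingroupp minN).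
have nsNG : N <| G by apply/andP.
have [_ psGN] := (pseudo_A6_extension nsNG).1 psG.
have [solN|nsolN] := boolP (solvable N); last first.
  have [S [nsSN isoS _ _ conjS]] := minnormal_Alt6_factor psG minN sNG nsolN.
  have [_ t_pr _] := nonadj_primes nwt.
  have tG : t %| #|G| by move: piGt; rewrite mem_primes => /and3P[].
  have [y Gy oy] := Cauchy t_pr tG.
  have sSG := subset_trans (normal_sub nsSN) sNG.
  by case: (nonadj_move_Alt6 sSG isoS Gy oy w235 t235 nwt conjS).
have nsolGN : ~~ solvable (G / N).
  by apply: contra nsolG => solGN; rewrite (series_sol nsNG) solN.
have [_ _ /is_abelemP[u u_pr /abelem_pgroup uN]] := minnormal_solvable minN (subxx _) solN.
have [piGNt|pi'GNt] := boolP (t \in \pi(G / N)).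
  have nwtN : nonadj (G / N) w t.
    by apply: nonadj_quotient piGNt nwt; apply: nonsolvable_pi.
  have ltGN : #|(G / N)%G| < n by rewrite (leq_trans _ leGn) // ltn_quotient.
  have [Mb [nsMb nsolMb nwtMb tMb]] := IHn _ (G / N)%G psGN nsolGN nwtN ltGN.
  have [M defM sNM nsMG] := inv_quotientN nsNG nsMb.
  have iso : (G / N / (M / N)) \isog (G / M) by apply: third_isog.
  have {defM} defM : Mb = (M / N)%G by apply: val_inj.
  subst Mb; have nsolGM : ~~ solvable (G / M) by rewrite -(isog_sol iso).
  exists M; rewrite -(card_isog iso) -(card_isog (isog_pcore t iso)).
  split=> //; apply: nonadj_quotient nwt.
    by apply: nonsolvable_pi => //; case: ((pseudo_A6_extension nsMG).1 psG).
  by case/nonadjP: nwtMb => _; rewrite /= (card_isog iso).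
have [tu sylN] := Sylow_of_pi_quotient nsNG uN piGt pi'GNt; subst u.
have iso1 := quotient1_isog G; exists 1%G; rewrite normal1.
rewrite -(isog_sol iso1) -(card_isog iso1) -(card_isog (isog_pcore _ iso1)).
split=> //; first by apply: nonadj_quotient nwt; rewrite /= -(card_isog iso1).
rewrite -(card_Hall sylN) eqn_leq !subset_leq_card //.
  by rewrite pcore_max // uN.
exact: pcore_sub_Hall.
Qed.

(** In the quotient of [outside_reduction] the image of [K] still involves [w] and [t] and has a
    normal Sylow [t]-subgroup, contrary to [arrow_normal_Sylow]. *)
Lemma arrow_from_Alt6 (gT : finGroupType) (G K : {group gT}) w t :
  pseudo_A6_solvable G -> ~~ solvable G -> K \subset G -> solvable K ->
  w \in [:: 2; 3; 5]%N -> t \notin [:: 2; 3; 5]%N ->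
  ~~ (w %| #|G : K|) -> ~~ (t %| #|G : K|) -> nonadj G w t -> ~~ arrow K t w.
Proof.
move=> psG nsolG sKG solK w235 t235 w'GK t'GK nwt; apply/negP=> atw.
have [M [nsMG nsolGM nwtM sylO]] := outside_reduction psG nsolG nwt w235 t235.
have nMK := subset_trans sKG (normal_norm nsMG).
have [w_pr t_pr _] := nonadj_primes nwt; have [piMw piMt _ _] := nonadjP _ _ _ nwtM.
have piKM r : prime r -> ~~ (r %| #|G : K|) -> r \in \pi(G / M) -> r \in \pi(K / M).
  move=> r_pr r'GK; rewrite !mem_primes r_pr !cardG_gt0 /=.
  rewrite -(Lagrange (quotientS M sKG)) Euclid_dvdM // => /orP[//|rGKM].
  case/negP: r'GK; apply: dvdn_trans rGKM _.
  have [sMG nMG] := andP nsMG; rewrite /= -(quotientMidl M K) -norm_joinEr //.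
  rewrite index_quotient_eq ?indexgS ?joing_subr //.
    by rewrite subIset // joing_subl orbT.
  by rewrite join_subG sMG.
have atwM := arrow_quotient solK nMK (piKM t t_pr t'GK piMt) (piKM w w_pr w'GK piMw) atw.
apply: (arrow_normal_Sylow (quotient_sol M solK) atwM (P := 'O_t(G / M) :&: (K / M))%G).
  have [sOG tO t'GO] := and3P sylO; have sKMG := quotientS M sKG.
  rewrite /pHall subsetIr (pgroupS (subsetIl _ _) tO) /= setIC indexgI -indexMg.
  have nOK := subset_trans sKMG (gFnorm _ _).
  rewrite -norm_joinEr ?(subset_trans sKMG) ?gFnorm //.
  by apply: (pnat_dvd _ t'GO); rewrite indexSg ?joing_subl // join_subG sOG.
by rewrite /normal subsetIr normsI ?normG // (subset_trans (quotientS M sKG)) ?gFnorm.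
Qed.

(** * Covers of [A6] with kernel in the Frattini subgroup *)

Section Alt6Cover.
Variables (gT : finGroupType) (L D : {group gT}).
Hypotheses (nsDL : D <| L) (isoLD : L / D \isog A6) (sDPhi : D \subset 'Phi(L)).

(** [L / D] is perfect, so [D] and the derived subgroup generate [L]; elements of the Frattini
    subgroup are nongenerators. *)
Lemma cover_der1 : L^`(1) = L.
Proof.
have [sDL nDL] := andP nsDL.
have simLD : simple (L / D) by rewrite (isog_simple isoLD) simple_Alt5 ?card_ord.
have /simpleP[_ /(_ (L / D)^`(1)%G (der_normal 1 _))[/derG1P abLD|/= perf]] := simLD.
  have : solvable A6 by rewrite -(isog_sol isoLD) abelian_sol.
  by rewrite solvable_AltF ?card_ord.
rewrite -quotient_der // in perf; have nDL' := subset_trans (der_sub 1 L) nDL.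
rewrite -[LHS]genGid; apply: Phi_nongen; apply/eqP.
rewrite eqEsubset join_subG Phi_sub der_sub /=.
apply: subset_trans (_ : D * L^`(1) \subset _).
  by rewrite -quotientSK // perf.
by rewrite -norm_joinEr // genS // setSU.
Qed.

(** By the Frattini argument [L] is generated by [D] and the normaliser of [P], and [D] can be
    omitted. *)
Lemma cover_Sylow_normal r (P : {group gT}) : r.-Sylow(D) P -> P <| L.
Proof.
move=> sylP; have sPL := subset_trans (pHall_sub sylP) (normal_sub nsDL).
have frat := Frattini_arg nsDL sylP.
have defN : 'N_L(P) = L.
  rewrite -[LHS]genGid; apply: Phi_nongen; apply/eqP.
  rewrite eqEsubset join_subG Phi_sub subsetIl /= -{1}frat.
  by rewrite mul_subG ?joing_subr // (subset_trans sDPhi) ?joing_subl.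
by rewrite /normal sPL -defN subsetIr.
Qed.

(** [P] is a normal Sylow subgroup of [L], so it has a complement; as [P] consists of nongenerators,
    the complement is [L]. *)
Lemma cover_Sylow_outside r (P : {group gT}) : r \notin [:: 2; 3; 5]%N ->
  r.-Sylow(D) P -> P :=: 1.
Proof.
move=> r235 sylP; have nsPL := cover_Sylow_normal sylP.
have [sDL nDL] := andP nsDL.
have r'LD : r^'.-nat #|L : D|.
  rewrite -card_quotient // (card_isog isoLD) -[_.-nat _]/(r^'.-group _).
  apply/pgroupP=> q q_pr qA; rewrite !inE; apply: contraNneq r235 => <-.
  by rewrite -pi_Alt6 mem_primes q_pr cardG_gt0.
have sylPL : r.-Sylow(L) P.
  have [sPD rP r'DP] := and3P sylP.
  by rewrite /pHall (normal_sub nsPL) rP -(Lagrange_index sDL sPD) pnatM r'LD.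
have /splitsP[K] := SchurZassenhaus_split (pHall_Hall sylPL) nsPL.
case/complP=> TI defL.
have defK : K = L.
  apply: val_inj; rewrite /= -[LHS]genGid; apply: Phi_nongen; apply/eqP.
  have sKL : K \subset L by rewrite -defL mulG_subr.
  rewrite eqEsubset join_subG Phi_sub sKL -{1}defL mul_subG ?joing_subr //.
  by rewrite (subset_trans (pHall_sub sylP)) // (subset_trans sDPhi) ?joing_subl.
by rewrite -TI defK (setIidPl (normal_sub nsPL)).
Qed.

Variables (A : {group gT}) (t : nat).
Hypotheses (abA : abelian A) (ntA : A :!=: 1) (nAL : L \subset 'N(A)) (tA : t.-group A).
Hypothesis t235 : t \notin [:: 2; 3; 5]%N.

Lemma cover_coprime n : n \in [:: 2; 3; 5]%N -> coprime #|A| n.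
Proof.
move=> n235; have [t_pr _ [k ->]] := pgroup_pdiv tA ntA.
rewrite coprimeXl // prime_coprime //; apply: contra t235 => tn.
by move: n235 tn; rewrite !inE => /or3P[]/eqP->; rewrite dvdn_prime2 // => ->; rewrite ?orbT.
Qed.

Variable w : nat.
Hypotheses (w235 : w \in [:: 2; 3; 5]%N).
Hypothesis fpf : {in L, forall x, #[x] = w -> 'C_A[x] = 1}.

Lemma cover_abelem_cyclic (E : {group gT}) : E \subset L -> w.-abelem E -> cyclic E.
Proof.
move=> sEL abE; apply: (fpf_abelem_cyclic abA ntA _ abE).
- exact: subset_trans sEL nAL.
- exact: cover_coprime.
move=> x /setD1P[ntx Ex]; apply: fpf; first exact: (subsetP sEL).
exact: abelem_order_p abE Ex ntx.
Qed.

(** Otherwise [Z = 'Ohm_1('Z(P))] is cyclic and normal in the perfect group [L], hence central, and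
    an element of order [q] commutes with one of order [w]. *)
Lemma cover_Sylow_fpf q (P : {group gT}) : q \in [:: 2; 3; 5]%N -> nonadj L w q ->
  w.-Sylow(D) P -> P :=: 1.
Proof.
move=> q235 nwq sylP; apply/eqP/idPn=> ntP; have wP := pHall_pgroup sylP.
have [sPL nPL] := andP (cover_Sylow_normal sylP).
pose Z := 'Ohm_1('Z(P))%G.
have sZP : Z \subset P by rewrite /= (subset_trans (Ohm_sub 1 _)) ?center_sub.
have ntZ : Z :!=: 1 by rewrite Ohm1_eq1 center_nil_eq1 ?(pgroup_nil wP).
have sZL := subset_trans sZP sPL; have wZ := pgroupS sZP wP.
have nZL : L \subset 'N(Z).
  by apply: (char_norm_trans (gFchar_trans _ (center_char P))).
have cycZ : cyclic Z.
  apply: cover_abelem_cyclic => //.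
  by rewrite Ohm1_abelem ?center_abelian ?(pgroupS (center_sub P)).
have := der1_cent_cyclic cycZ nZL; rewrite cover_der1 => cLZ.
have [_ piq _ _] := nonadjP _ _ _ nwq; have [w_pr q_pr _] := nonadj_primes nwq.
have [_ wdvZ _] := pgroup_pdiv wZ ntZ; have [x Zx ox] := Cauchy w_pr wdvZ.
have [y Ly oy] : {y | y \in L & #[y] = q}.
  by apply: Cauchy => //; move: piq; rewrite mem_primes => /and3P[].
apply: (nonadj_comm nwq (subsetP sZL _ Zx) Ly ox oy).
by apply: commute_sym; apply: (centsP cLZ).
Qed.

End Alt6Cover.

Section NonsolvableNonadj.
Variables (gT : finGroupType) (G : {group gT}) (t : nat).
Hypotheses (psG : pseudo_A6_solvable G) (nsolG : ~~ solvable G).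
Hypothesis t235 : t \notin [:: 2; 3; 5]%N.

Lemma outside_cover w : w \in [:: 2; 3; 5]%N -> nonadj G w t ->
  exists (rT : finGroupType) (L D A : {group rT}),
    [/\ D <| L, L / D \isog A6 & D \subset 'Phi(L)] /\
    [/\ abelian A, A :!=: 1, L \subset 'N(A) & t.-group A] /\
    {in L, forall x, #[x] = w -> 'C_A[x] = 1} /\
    forall p q, p \in [:: 2; 3; 5]%N -> q \in [:: 2; 3; 5]%N -> nonadj G p q -> nonadj L p q.
Proof.
move=> w235 nwt; have [M [nsMG nsolGM nwtM sylO]] := outside_reduction psG nsolG nwt w235 t235.
have [_ psGM] := (pseudo_A6_extension nsMG).1 psG.
have [L [D [sLG nsDL isoLD sDPhi]]] := nonsolvable_Alt6_cover psGM nsolGM.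
have [_ piMt _ _] := nonadjP _ _ _ nwtM; have tO := pcore_pgroup t (G / M).
have ntO : 'O_t(G / M) != 1.
  rewrite -cardG_gt1 (card_Hall sylO) p_part_gt1.
  by move: piMt; rewrite !mem_primes /= => /and3P[-> _ ->]; rewrite cardG_gt0.
have sZO := center_sub 'O_t(G / M); have tZ := pgroupS sZO tO.
have piL p : p \in [:: 2; 3; 5]%N -> p \in \pi(L).
  rewrite -pi_Alt6 !mem_primes /= -(card_isog isoLD) => /and3P[-> _ pLD].
  by rewrite cardG_gt0 (dvdn_trans pLD) ?dvdn_quotient.
exists _, L, D, 'Z('O_t(G / M))%G; split; last split; last split; first by split.
- split; rewrite ?center_abelian ?center_nil_eq1 ?(pgroup_nil tO) //.
  apply: (subset_trans sLG); apply: char_norm_trans (center_char _) (gFnorm _ _).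
- move=> x Lx ox; apply: nonadj_cent1 (subsetP sLG x Lx) ox _ tZ.
    by rewrite nonadj_sym; apply: nwtM.
  by rewrite (subset_trans sZO) ?pcore_sub.
move=> p q p235 q235 npq; apply: (nonadjS sLG); rewrite ?piL //.
by apply: nonadj_quotient npq; apply: nonsolvable_pi.
Qed.

(** The Sylow 3-subgroups of the cover have rank one, so they are cyclic, but [A6] has no element of
    order 9. *)
Lemma nonadj_3_outside : nonadj G 3 t -> False.
Proof.
case/outside_cover=> // rT [L [D [A [[nsDL isoLD sDPhi] [[abA ntA nAL tA] [fpf _]]]]]].
have [P sylP] := Sylow_exists 3 L; have sPL := pHall_sub sylP.
have [sDL nDL] := andP nsDL.
have pP := pHall_pgroup sylP.
have cycP : cyclic P.
  rewrite (odd_pgroup_rank1_cyclic pP) ?(odd_pgroup_odd _ pP) // leqNgt.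
  apply/negP=> /p_rank_geP[E /pnElemP[sEP abE dimE]].
  have : cyclic E.
    by apply: (cover_abelem_cyclic abA ntA nAL tA t235 _ fpf) => //; apply: subset_trans sEP sPL.
  by rewrite (abelem_cyclic abE) dimE.
have /isogP[f injf fA] := isoLD.
have sylPD := quotient_pHall (subset_trans sPL nDL) sylP.
have cycf : cyclic (f @* (P / D)) by rewrite morphim_cyclic ?quotient_cyclic.
have of9 : #|f @* (P / D)| = 9%N.
  rewrite card_injm ?quotientS // (card_Hall sylPD) (card_isog isoLD) card_Alt6.
  by rewrite p_part.
have [x defx] := cyclicP cycf.
have Ax : x \in A6 by rewrite -cycle_subG -defx -fA morphimS // quotientS.
by have := Alt6_order Ax; rewrite orderE -defx of9.
Qed.

(** The first hypothesis excludes covers such as the special linear group of degree 2 over nine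
    elements, whose only involution is central. It makes [D] of odd order, so a Klein four-group of
    [A6] lifts to the cover. *)
Lemma nonadj_2_outside : nonadj G 2 5 -> nonadj G 2 t -> False.
Proof.
move=> n25 /outside_cover[] // rT [L [D [A [[nsDL isoLD sDPhi] [[abA ntA nAL tA] [fpf nL]]]]]].
have {n25} n25 := nL 2 5 isT isT n25; have [sDL nDL] := andP nsDL.
have [P sylP] := Sylow_exists 2 D.
have P1 : P :=: 1.
  by apply: (cover_Sylow_fpf nsDL isoLD sDPhi abA ntA nAL tA t235 _ fpf _ n25 sylP).
have oddD : 2^'.-group D.
  by rewrite -partG_eq1 -(card_Hall sylP) P1 cards1.
have [E0 [sE0A abE0 ncycE0]] := Alt6_Klein.
have /isogP[f injf fA] : A6 \isog L / D by rewrite isog_sym.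
have sEL : f @* E0 \subset L / D by rewrite -fA morphimS.
have [X defX sDX sXL] := inv_quotientS nsDL sEL.
have [Q sylQ] := Sylow_exists 2 X; have sQX := pHall_sub sylQ.
have sQL := subset_trans sQX sXL; have nDQ := subset_trans sQL nDL.
have TI : D :&: Q = 1.
  by apply: coprime_TIg; rewrite coprime_sym (pnat_coprime (pHall_pgroup sylQ) oddD).
have isoE : E0 \isog Q.
  rewrite (isog_transl _ (sub_isog sE0A injf)) isog_sym.
  rewrite (isog_transl _ (quotient_isog nDQ TI)) -/(_ / _).
  have sylQD := quotient_pHall nDQ sylQ.
  rewrite /= -(_ : Q / D = f @* E0) ?isog_refl //.
  apply/esym; rewrite /= defX; apply: (sub_pHall sylQD); rewrite ?quotientS //.
  by rewrite /= -defX morphim_pgroup // abelem_pgroup.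
case/negP: ncycE0; rewrite (isog_cyclic isoE).
apply: (cover_abelem_cyclic abA ntA nAL tA t235 _ fpf) => //.
by rewrite -(isog_abelem isoE).
Qed.

(** The Sylow 2- and 3-subgroups of [D] centralise [A] by [cent_fpf], applied to an element of order
    5; the others are trivial. So [A6] itself acts on [A], and [Alt6_fpf5] applies. *)
Lemma nonadj_5_outside : nonadj G 2 5 -> nonadj G 3 5 ->
  nonadj G 5 t -> False.
Proof.
move=> n25 n35.
move=> /outside_cover[] // rT [L [D [A [[nsDL isoLD sDPhi] [[abA ntA nAL tA] [fpf nL]]]]]].
have {n25} n25 := nL 2 5 isT isT n25; have {n35} n35 := nL 3 5 isT isT n35.
have n52 : nonadj L 5 2 by rewrite nonadj_sym.
have [sDL nDL] := andP nsDL.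
have [x Lx ox] : {x | x \in L & #[x] = 5%N}.
  apply: Cauchy => //; have [_ ] := nonadjP _ _ _ n25.
  by rewrite mem_primes => /and3P[].
have cDA : D \subset 'C(A).
  rewrite -(Sylow_gen D) gen_subG; apply/bigcupsP=> P /SylowP[r r_pr sylP].
  have [r235|r235] := boolP (r \in [:: 2; 3; 5]%N); last first.
    by rewrite (cover_Sylow_outside nsDL isoLD sDPhi r235 sylP) sub1G.
  have [sPL nPL] := andP (cover_Sylow_normal nsDL sDPhi sylP).
  have rP := pHall_pgroup sylP.
  have [r5|r5] := eqVneq r 5.
    rewrite r5 in sylP.
    by rewrite (cover_Sylow_fpf nsDL isoLD sDPhi abA ntA nAL tA t235 _ fpf _ n52 sylP) ?sub1G.
  have n5r : nonadj L r 5.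
    by move: r235 r5; rewrite !inE => /or3P[]/eqP->.
  apply: (@cent_fpf _ _ abA P x).
  - exact: subset_trans sPL nAL.
  - exact: (subsetP nAL).
  - exact: (subsetP nPL).
  - rewrite (pnat_coprime tA) //; apply: sub_pgroup rP => c; rewrite !inE => /eqP->.
    by apply: contraNneq t235 => <-.
  - by rewrite ox.
  - exact: fpf.
  exact: nonadj_cent1 n5r Lx ox sPL rP.
case/eqP: (ntA); apply: (Alt6_fpf5 nsDL isoLD cDA nAL abA _ fpf).
by rewrite (_ : 30 = 2 * 3 * 5)%N // !coprimeMr !(cover_coprime ntA tA t235).
Qed.

End NonsolvableNonadj.

Lemma nonadj_isog (gT rT : finGroupType) (G : {group gT}) (H : {group rT}) p q :
  G \isog H -> nonadj G p q -> nonadj H p q.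
Proof.
move=> isoGH /nonadjP[pip piq neq no_pq]; apply/nonadjP.
rewrite /= -(card_isog isoGH); split=> // y Hy; have /isogP[f injf fG] := isoGH.
move: Hy; rewrite -fG => /morphimP[x _ Gx ->]; rewrite order_injm //.
exact: no_pq.
Qed.

Lemma prime_semiregular (gT : finGroupType) (P : {group gT}) x :
  prime #[x] -> 'C_P[x] = 1 -> semiregular P <[x]>.
Proof.
move=> x_pr C1 y /setD1P[nty xy]; apply/trivgP.
rewrite -C1 /= -[in X in X \subset _]cent_cycle -cent_cycle.
apply: setIS; apply: centS; apply: prime_meetG; rewrite -?orderE //.
by apply/trivgPn; exists y; rewrite // inE xy cycle_id.
Qed.

(* No element of order 3 or 5 acts fixed point freely on a group of order 8, and
   none of order 3 on a group of order 5. *)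
Lemma Alt6_Sylow_norm_sol (gT : finGroupType) (H P : {group gT}) p :
  H \isog A6 -> p \in [:: 2; 5]%N -> p.-Sylow(H) P -> solvable 'N_H(P).
Proof.
move=> isoH p25 sylP; have sPH := pHall_sub sylP; have pP := pHall_pgroup sylP.
have sPN : P \subset 'N_H(P) by rewrite subsetI sPH normG.
have nsPN : P <| 'N_H(P) by rewrite /normal sPN subsetIr.
rewrite (series_sol nsPN) (nilpotent_sol (pgroup_nil pP)) /=.
have sylPN := pHall_subl sPN (subsetIl _ _) sylP.
apply: (@nilpotent_sol _ (_ / _)); apply: (@pgroup_nil _ 2); apply/pgroupP=> r r_pr rNP.
have r_p : r != p.
  apply: contraNneq (Sylow_pi_quotient sylPN nsPN) => <-.
  by rewrite mem_primes r_pr cardG_gt0.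
have rN : r %| #|'N_H(P)|.
  by rewrite (dvdn_trans rNP) ?dvdn_quotient.
have rH : r \in [:: 2; 3; 5]%N.
  rewrite -pi_Alt6 /= -(card_isog isoH) mem_primes r_pr cardG_gt0.
  by rewrite (dvdn_trans rN) // cardSg // subsetIl.
have [x /setIP[Hx nPx] ox] := Cauchy r_pr rN.
have nrp : nonadj H p r.
  apply: (nonadj_isog (_ : A6 \isog H)); first by rewrite isog_sym.
  apply: Alt6_nonadj; rewrite 1?eq_sym //.
  by move: p25; rewrite !inE => /orP[]->; rewrite ?orbT.
have C1 := nonadj_cent1 nrp Hx ox sPH pP.
have reg : semiregular P <[x]> by apply: prime_semiregular; rewrite ?ox.
have nPX : <[x]> \subset 'N(P) by rewrite cycle_subG.
have := regular_norm_dvd_pred nPX reg; rewrite -orderE ox.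
rewrite (card_Hall sylP) (card_isog isoH) card_Alt6 p_part.
have dv n : r %| n -> 0 < n -> r \in primes n by rewrite mem_primes r_pr => -> ->.
by move: p25 rH; rewrite !inE => /orP[]/eqP-> /or3P[]/eqP rE; rewrite rE //;
  move=> /dv/(_ isT); rewrite inE.
Qed.

Lemma quotient_cent_Alt6 (gT : finGroupType) (N T : {group gT}) : T <| N ->
  T \isog A6 -> N \subset T <*> 'C(T) -> N / 'C_N(T) \isog A6.
Proof.
case/andP=> sTN nTN isoT defN.
have nCN : N \subset 'N('C_N(T)) by rewrite normsI ?norms_cent ?normG.
have nCT := subset_trans sTN nCN.
have TI : 'C_N(T) :&: T = 1.
  by rewrite setIAC (setIidPr sTN) -(isog_Alt6_center isoT).
have eqNT : N / 'C_N(T) = T / 'C_N(T).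
  apply/eqP; rewrite eqEsubset (quotientS _ sTN) andbT quotientSK // group_modr //.
  by rewrite subsetI subxx (subset_trans defN) // joingC cent_joinEl.
by rewrite eqNT -(isog_transr _ isoT) isog_sym quotient_isog.
Qed.

(** * Solvable subgroups that preserve given primes *)

Section Minnormal235.
Variables (gT : finGroupType) (G N S : {group gT}).
Hypotheses (nsNG : N <| G) (nsSN : S <| N) (isoS : S \isog A6).
Hypothesis defN : N \subset S <*> 'C(S).
Hypothesis center1 : forall x, x \in N -> (forall g, g \in G -> x \in 'C(S :^ g)) -> x = 1.

Lemma quotient_cent_isog g : g \in G -> N / 'C_N(S :^ g) \isog A6.
Proof.
move=> Gg; have nNg := normsP (normal_norm nsNG) g Gg.
apply: quotient_cent_Alt6; first by rewrite -nNg normalJ.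
  by rewrite -(isog_transl _ (conj_isog _ _)).
by rewrite centJ -conjYg -{1}nNg conjSg.
Qed.

(** [N] embeds into the product of its quotients [N / 'C_N(S :^ g)], all isomorphic to [A6]. *)
Lemma minnormal_Alt6_pgroup : [pred r | r \in [:: 2; 3; 5]%N].-group N.
Proof.
apply/pgroupP=> r r_pr rN; rewrite -topredE /=; apply: contraT => r235.
have [x Nx ox] := Cauchy r_pr rN.
suff x1 : x = 1 by move: r_pr; rewrite -ox x1 order1.
apply: center1 => // g Gg; have isoQ := quotient_cent_isog Gg.
have nCx : x \in 'N('C_N(S :^ g)).
  apply: (subsetP _ x Nx); rewrite normsI ?normG // norms_cent //.
  by rewrite -(normsP (normal_norm nsNG) g Gg) normJ conjSg normal_norm.
have : x \in 'C_N(S :^ g); last by case/setIP.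
apply: (coset_idr nCx); apply/eqP; rewrite -order_eq1; apply/eqP.
have : #[coset 'C_N(S :^ g) x] %| r by rewrite -ox morph_order.
case/primeP: (r_pr) => _ r_pr' /r_pr'/orP[/eqP //|/eqP oxr].
case/negP: r235; rewrite -pi_Alt6 /= -(card_isog isoQ) mem_primes cardG_gt0.
by rewrite r_pr -oxr order_dvdG ?mem_quotient.
Qed.

(** A perfect subgroup of ['N_N(P)] has trivial image in every [N / 'C_N(S :^ g)], since it lands in
    the solvable normaliser of a Sylow subgroup of [A6]. *)
Lemma minnormal_Alt6_norm_sol p (P : {group gT}) : p \in [:: 2; 5]%N ->
  p.-Sylow(N) P -> solvable 'N_N(P).
Proof.
move=> p25 sylP; have sPN := pHall_sub sylP; apply/forall_inP=> Y.
rewrite subsetI => /andP[sYX sYY']; have sYN := subset_trans sYX (subsetIl _ _).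
rewrite -subG1; apply/subsetP=> y Yy; apply/set1P; apply: center1.
  exact: (subsetP sYN).
move=> g Gg; have isoQ := quotient_cent_isog Gg; set C := 'C_N(S :^ g) in isoQ.
have nCN : N \subset 'N(C).
  rewrite normsI ?normG // norms_cent //.
  by rewrite -(normsP (normal_norm nsNG) g Gg) normJ conjSg normal_norm.
have sylPC := quotient_pHall (subset_trans sPN nCN) sylP.
have solX := Alt6_Sylow_norm_sol isoQ p25 sylPC.
suff : Y \subset C by move/subsetP/(_ y Yy)/setIP=> [].
rewrite -quotient_sub1 ?(subset_trans sYN) // subG1.
apply: (forall_inP solX); rewrite subsetI -quotientR ?(subset_trans sYN) // quotientS // andbT.
rewrite (subset_trans (quotientS C sYX)) // subsetI quotientS ?subsetIl //=.
by rewrite (subset_trans (quotientS C (subsetIr _ _))) // quotient_norm.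
Qed.

End Minnormal235.

(** A nonsolvable minimal normal subgroup is reduced to the normaliser of a Sylow [p]-subgroup [P],
    chosen invariant under [J] by coprime action; the Frattini argument bounds the index by that of
    [P]. Prescribing [J] allows the supplements for [p = 2] and [p = 5] to share their outer
    part. *)
Lemma solvable_supplement (gT : finGroupType) (G J : {group gT}) p :
  pseudo_A6_solvable G -> p \in [:: 2; 5]%N -> J \subset G -> solvable J ->
  [pred r | r \notin [:: 2; 3; 5]%N].-group J ->
  exists K : {group gT}, [/\ J \subset K, K \subset G, solvable K
    & [pred r | (r \in [:: 2; 3; 5]%N) && (r != p)].-nat #|G : K|].
Proof.
have [n] := ubnP #|G|; elim: n => // n IHn in gT G J *.
move=> /ltnSE-leGn psG p25 sJG solJ piJ.
have [G1|ntG] := eqVneq G 1%G.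
  by exists G; rewrite sJG subxx G1 solvable1 indexgg.
have [N minN sNG] : {N : {group gT} | minnormal N G & N \subset G}.
  by apply: mingroup_exists; rewrite ntG normG.
have [nNG ntN] : G \subset 'N(N) /\ N :!=: 1 by case/andP: (mingroupp minN).
have nsNG : N <| G by apply/andP.
have [_ psGN] := (pseudo_A6_extension nsNG).1 psG.
have nNJ := subset_trans sJG nNG.
have ltGN : #|(G / N)%G| < n by rewrite (leq_trans _ leGn) // ltn_quotient.
have [Kb [sJKb sKbG solKb piKb]] :=
  IHn _ (G / N)%G (J / N)%G ltGN psGN p25 (quotientS N sJG)
    (quotient_sol N solJ) (quotient_pgroup N piJ).
have [X defX sNX sXG] := inv_quotientS nsNG sKbG.
have {defX} defX : Kb = (X / N)%G by apply: val_inj.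
subst Kb; have sJX : J \subset X by rewrite -(quotientSGK nNJ sNX).
have nsNX : N <| X := normalS sNX sXG nsNG.
have piGX : [pred r | (r \in [:: 2; 3; 5]%N) && (r != p)].-nat #|G : X|.
  by move: piKb; rewrite index_quotient_eq // (subset_trans (subsetIr _ _)).
have [solN|nsolN] := boolP (solvable N).
  by exists X; rewrite sJX sXG (series_sol nsNX) solN.
have [S [nsSN isoS defN center1 _]] := minnormal_Alt6_factor psG minN sNG nsolN.
have piN := minnormal_Alt6_pgroup nsNG nsSN isoS defN center1.
have coNJ : coprime #|N| #|J|.
  by apply: pnat_coprime piN _; apply: sub_pgroup piJ.
have [P sylP nPJ] := sol_coprime_Sylow_exists p solJ nNJ coNJ.
have solNP := minnormal_Alt6_norm_sol nsNG nsSN isoS defN center1 p25 sylP.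
have sPN := pHall_sub sylP; have frat := Frattini_arg nsNX sylP.
exists 'N_X(P)%G; rewrite subsetI sJX nPJ (subset_trans (subsetIl _ _) sXG); split=> //.
  have nsNNP : 'N_N(P) <| 'N_X(P).
    rewrite /normal setSI // -(setIidPl sNX) -setIA; apply/normsI; last exact: normG.
    by rewrite (subset_trans (subsetIl _ _)) ?normal_norm.
  rewrite (series_sol nsNNP) solNP /=.
  have nNX : 'N_X(P) \subset 'N(N) := subset_trans (subsetIl _ _) (normal_norm nsNX).
  have := second_isog nNX; rewrite setIA (setIidPl sNX) => iso2.
  rewrite (isog_sol iso2) (solvableS _ solKb) //= quotientS //.
  exact: subsetIl.
rewrite -(Lagrange_index sXG (subsetIl X 'N(P))) pnatM piGX /=.
have nNX := subset_trans (subsetIl X 'N(P)) (normal_norm nsNX).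
rewrite -[X in #|X : _|]frat -(normC nNX) indexMg.
have dv : #|N : 'N_X(P)| %| #|N : P|.
  by rewrite indexgS // subsetI (subset_trans sPN) ?normG.
apply: pnat_dvd dv _; have [_ _ p'NP] := and3P sylP.
apply/pnatP=> [|r r_pr rNP]; first exact: indexg_gt0.
have := pnatPpi p'NP (p := r); rewrite mem_primes r_pr indexg_gt0 rNP => /(_ isT).
rewrite !inE => ->; rewrite andbT.
by have := pgroupP piN r r_pr (dvdn_trans rNP (dvdn_indexg _ _)); rewrite !inE.
Qed.

(** * Colouring the complement of the prime graph *)

(* Sources get colour 0, other sinks colour 2, and the remaining vertices colour 1. *)
Lemma arrow_coloring (E a : rel nat) (s : seq nat) :
  (forall u v, E u v -> u \in s /\ v \in s) -> symmetric E ->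
  (forall u v, a u v -> E u v) -> (forall u v, E u v -> a u v || a v u) ->
  (forall u v, a u v -> ~~ a v u) ->
  (forall u v w, E u v -> E u w -> E v w -> False) ->
  (forall p q r t, a p q -> a q r -> a r t -> p != t -> p != r -> q != t -> False) ->
  exists2 c : nat -> 'I_3, forall u v, E u v -> c u != c v
    & forall v, (forall u, ~~ a u v) -> c v = ord0.
Proof.
move=> Es symE aE totE asym noTri noPath.
pose c (v : nat) : 'I_3 :=
  if has (a^~ v) s then if has (a v) s then inord 1 else ord_max else ord0.
exists c => [|v nav]; last first.
  by rewrite /c; case: hasP => // - [u _ /= auv]; have := nav u; rewrite auv.
suff key u v : a u v -> c u != c v.
  by move=> u v /totE/orP[/key|/key]; rewrite // eq_sym.
move=> auv; have [us vs] := Es u v (aE u v auv).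
have out_u : has (a u) s by apply/hasP; exists v.
have in_v : has (a^~ v) s by apply/hasP; exists u.
rewrite /c out_u in_v; case: hasP => [[p ps apu]|_]; last first.
  by case: ifP => _; rewrite -val_eqE /= ?inordK.
case: hasP => [[t ts avt]|_]; last by rewrite -val_eqE /= inordK.
case: (noPath p u v t) => //.
- apply/eqP=> pt; subst t; apply: (noTri u v p); try exact: aE.
  by rewrite symE; apply: aE.
- by apply/eqP=> pv; have := asym _ _ auv; rewrite -pv apu.
by apply/eqP=> ut; have := asym _ _ auv; rewrite ut avt.
Qed.

Lemma nonadj_in_primes (gT : finGroupType) (G : {group gT}) u v :
  nonadj G u v -> u \in primes #|G| /\ v \in primes #|G|.
Proof. by case/nonadjP. Qed.

Lemma solvable_coloring (gT : finGroupType) (G : {group gT}) : solvable G ->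
  exists c : nat -> 'I_3, forall u v, nonadj G u v -> c u != c v.
Proof.
move=> solG.
have [c cE _] := @arrow_coloring (nonadj G) (arrow G) (primes #|G|)
  (@nonadj_in_primes _ G) (@nonadj_sym _ G) (@arrow_nonadj _ G)
  (fun u v => @arrow_total _ G u v solG) (fun u v => @arrow_asym _ G u v solG)
  (fun u v w => @solvable_no_triangle _ G u v w solG)
  (fun p q r t => @no_arrow_path _ G p q r t solG).
by exists c.
Qed.

Section NonsolvableColoring.
Variables (gT : finGroupType) (G : {group gT}).
Hypotheses (psG : pseudo_A6_solvable G) (nsolG : ~~ solvable G).

Local Notation inner := [:: 2; 3; 5]%N.

Lemma nonadj_supplement (K : {group gT}) p u v : K \subset G ->
  [pred r | (r \in inner) && (r != p)].-nat #|G : K| ->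
  (u \notin inner) || (u == p) -> (v \notin inner) || (v == p) ->
  nonadj G u v -> nonadj K u v.
Proof.
move=> sKG piK; have piP r : (r \notin inner) || (r == p) -> r \in \pi(G) -> r \in \pi(K).
  move=> rP; rewrite !mem_primes !cardG_gt0 => /and3P[r_pr _]; rewrite r_pr /=.
  rewrite -(Lagrange sKG) Euclid_dvdM // => /orP[//|rGK].
  have := pnatP _ (indexg_gt0 _ _) piK r r_pr rGK; rewrite -topredE /=.
  by case/andP=> rin rp; rewrite rin (negPf rp) in rP.
move=> uP vP nuv; have [piu piv _ _] := nonadjP _ _ _ nuv.
by apply: nonadjS nuv => //; apply: piP.
Qed.

Lemma other_color (a b : 'I_3) : exists x : 'I_3, (x != a) && (x != b).
Proof.
apply/existsP; rewrite -[[exists x, _]]negbK negb_exists; apply/negP=> /forallP all_ab.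
have : #|'I_3| <= #|[set a; b]|.
  apply/subset_leq_card/subsetP=> x _; have := all_ab x.
  by rewrite !inE negb_and !negbK.
by rewrite card_ord cards2; case: (_ != _).
Qed.

Lemma nonsolvable_coloring :
  exists c : nat -> 'I_3, forall u v, nonadj G u v -> c u != c v.
Proof.
have no3 t : t \notin inner -> ~~ nonadj G 3 t.
  by move=> t235; apply/negP; apply: nonadj_3_outside.
(* If 2 and 5 are opposite, then 2 and 3 are opposite to no outer prime: the supplement keeping 5
   and the outer primes is coloured, and 2 and 3 take the two colours different from that of 5. *)
have [n25|n25] := boolP (nonadj G 2 5).
  have no2 t : t \notin inner -> ~~ nonadj G 2 t.
    by move=> t235; apply/negP; apply: nonadj_2_outside.
  have [|K [_ sKG solK piK]] := solvable_supplement (p := 5) psG isT (sub1G G) (solvable1 _).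
    by rewrite /pgroup cards1.
  have [c cK] := solvable_coloring solK.
  have [c2 /andP[c25 _]] := other_color (c 5%N) (c 5%N).
  have [c3 /andP[c32 c35]] := other_color c2 (c 5%N).
  have c2P v : nonadj G 2 v -> v != 3 -> c2 != c v.
    move=> n2v v3; have [vin|/no2] := boolP (v \in inner); last by rewrite n2v.
    have [_ _ nv2] := nonadj_primes n2v.
    by move: vin nv2 v3; rewrite !inE => /or3P[]/eqP->.
  have c3P v : nonadj G 3 v -> v != 2 -> c3 != c v.
    move=> n3v v2; have [vin|/no3] := boolP (v \in inner); last by rewrite n3v.
    have [_ _ nv3] := nonadj_primes n3v.
    by move: vin nv3 v2; rewrite !inE => /or3P[]/eqP->.
  exists (fun v => if v == 2 then c2 else if v == 3 then c3 else c v) => u v nuv.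
  have nvu : nonadj G v u by rewrite nonadj_sym.
  have [_ _ neq] := nonadj_primes nuv.
  have [u2|u2] := eqVneq u 2; have [v2|v2] := eqVneq v 2; subst; rewrite ?eqxx // in neq *.
  - by have [v3|v3] := eqVneq v 3; [rewrite eq_sym | exact: c2P].
  - by have [u3|u3] := eqVneq u 3; [ | rewrite eq_sym; apply: c2P].
  have [u3|u3] := eqVneq u 3; have [v3|v3] := eqVneq v 3; subst; rewrite ?eqxx // in neq *.
  - exact: c3P.
  - by rewrite eq_sym; apply: c3P.
  apply: cK; apply: (nonadj_supplement sKG piK) nuv; rewrite !inE.
    by rewrite (negPf u2) (negPf u3) /= orNb.
  by rewrite (negPf v2) (negPf v3) /= orNb.
(* Now 3 can be opposite only to 2 and 5. One supplement keeps 2 and one keeps 5; their common Hall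
   subgroup [J] for the outer primes gives outer pairs one orientation. *)
have [|K2 [_ sK2G solK2 piK2]] := solvable_supplement (p := 2) psG isT (sub1G G) (solvable1 _).
  by rewrite /pgroup cards1.
pose outer : nat_pred := [pred r | r \notin inner].
have [J hallJ2] := Hall_exists outer solK2; have sJK2 := pHall_sub hallJ2.
have solJ := solvableS sJK2 solK2; have piJ := pHall_pgroup hallJ2.
have [K5 [sJK5 sK5G solK5 piK5]] :=
  solvable_supplement (p := 5) psG isT (subset_trans sJK2 sK2G) solJ piJ.
have hallJ : outer.-Hall(G) J.
  rewrite /pHall (subset_trans sJK2 sK2G) piJ -(Lagrange_index sK2G sJK2) pnatM.
  have [_ _ ->] := and3P hallJ2; rewrite andbT; apply: sub_in_pnat piK2 => r _.
  by rewrite !inE negbK => /andP[].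
have hallJ5 : outer.-Hall(K5) J by apply: pHall_subl hallJ.
have [K [sJK sKG solK piK]] : exists K : nat -> {group gT},
  [/\ forall p, p \in [:: 2; 5]%N -> outer.-Hall(K p) J,
    forall p, K p \subset G, forall p, solvable (K p)
    & forall p, p \in [:: 2; 5]%N -> [pred r | (r \in inner) && (r != p)].-nat #|G : K p|].
  exists (fun p => if p == 2 then K2 else K5).
  split=> p; case: (p =P 2%N) => // p2; first by move=> _; subst p.
  by rewrite in_cons mem_seq1 => /orP[]/eqP p5 //; rewrite p5.
(* Outer pairs are oriented as in [J], and 2 and 5 point outward. Being sources, 2 and 5 get colour
   0, which leaves colour 1 for the vertex 3. *)
pose a (u v : nat) := [&& nonadj G u v, v \notin inner &
  (u \in [:: 2; 5]%N) || (u \notin inner) && arrow J u v].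
pose E (u v : nat) := [&& nonadj G u v, u != 3 & v != 3].
have outerJ u v : u \notin inner -> v \notin inner -> nonadj G u v -> nonadj J u v.
  move=> uo vo nuv; have [piu piv _ _] := nonadjP _ _ _ nuv.
  by apply: nonadjS (pHall_sub hallJ) _ _ nuv; rewrite (pi_Hall hallJ).
have not25 u v : u \in [:: 2; 5]%N -> v \in [:: 2; 5]%N -> ~~ nonadj G u v.
  move=> u25 v25; apply: contra n25 => nuv; have [_ _] := nonadj_primes nuv.
  by move: u25 v25 nuv; rewrite !inE => /orP[]/eqP-> /orP[]/eqP->; rewrite // nonadj_sym.
have sub25 u : u \in [:: 2; 5]%N -> u \in inner.
  by rewrite !inE => /orP[]/eqP->.
have in25 u : u != 3 -> u \in inner -> u \in [:: 2; 5]%N.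
  by rewrite !inE => /negPf->.
have nK w u v : (u \notin inner) || (u == w) -> (v \notin inner) || (v == w) ->
    w \in [:: 2; 5]%N -> nonadj G u v -> nonadj (K w) u v.
  by move=> uP vP w25; apply: nonadj_supplement (sKG w) (piK w w25) uP vP.
have aJK w u v : w \in [:: 2; 5]%N -> u \notin inner -> v \notin inner ->
    nonadj G u v -> arrow J u v -> arrow (K w) u v.
  move=> w25 uo vo nuv auv; rewrite (arrow_Hall (solK w) (sJK w w25)) //.
  by rewrite auv nK ?uo ?vo.
have a25 w v : w \in [:: 2; 5]%N -> v \notin inner -> nonadj G w v -> arrow (K w) w v.
  move=> w25 vo nwv; have [w_pr v_pr _] := nonadj_primes nwv.
  have /orP[//|avw] := arrow_total (solK w) (nK w w v (introT orP (or_intror (eqxx w)))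
    (introT orP (or_introl vo)) w25 nwv).
  have piKw r : prime r -> r %| #|G : K w| -> (r \in inner) && (r != w).
    by move=> r_pr; apply: (pnatP _ (indexg_gt0 _ _) (piK w w25)).
  suff: ~~ arrow (K w) v w by rewrite avw.
  apply: (arrow_from_Alt6 psG nsolG (sKG w) (solK w) (sub25 w w25) vo _ _ nwv).
    by apply/negP=> /(piKw w w_pr); rewrite eqxx andbF.
  by apply/negP=> /(piKw v v_pr); rewrite (negPf vo).
have [|||||||c cE c0] := @arrow_coloring E a (primes #|G|).
- by move=> u v /andP[/nonadj_in_primes].
- by move=> u v; rewrite /E nonadj_sym (andbC (u != 3)).
- move=> u v /and3P[nuv vo uP]; rewrite /E nuv /=; apply/andP; split.
    by apply/eqP=> u3; rewrite u3 in uP.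
  by apply/eqP=> v3; rewrite v3 in vo.
- move=> u v /and3P[nuv u3 v3]; rewrite /a nuv nonadj_sym nuv /=.
  have [uin|uo] := boolP (u \in inner); have [vin|vo] := boolP (v \in inner).
  - by case/negP: (not25 u v (in25 u u3 uin) (in25 v v3 vin)).
  - by rewrite (in25 u u3 uin).
  - by rewrite (in25 v v3 vin).
  have /orP[->|->] := arrow_total solJ (outerJ u v uo vo nuv); rewrite ?orbT //.
- move=> u v /and3P[nuv vo uP]; apply/negP=> /and3P[_ uo].
  have out25 x : x \notin inner -> (x \in [:: 2; 5]%N) = false.
    by move=> xo; apply/negP=> /sub25; rewrite (negPf xo).
  move: uP; rewrite !out25 // uo vo /= => auv avu.
  by have := arrow_asym solJ auv; rewrite avu.
- move=> u v w /and3P[nuv u3 v3] /and3P[nuw _ w3] /and3P[nvw _ _].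
  (* A triangle contains at most one of 2 and 5, so it survives in one of the two solvable
     supplements. *)
  have [z z25 [zu zv zw]] : exists2 z, z \in [:: 2; 5]%N
      & [/\ (u \notin inner) || (u == z), (v \notin inner) || (v == z)
          & (w \notin inner) || (w == z)].
    have [uin|uo] := boolP (u \in inner).
      have u25 := in25 u u3 uin; exists u; rewrite ?eqxx ?orbT //; split=> //.
        apply/orP; left; apply/negP=> /(in25 v v3) v25.
        by case/negP: (not25 u v u25 v25).
      apply/orP; left; apply/negP=> /(in25 w w3) w25.
      by case/negP: (not25 u w u25 w25).
    have [vin|vo] := boolP (v \in inner).
      have v25 := in25 v v3 vin; exists v; rewrite ?eqxx ?orbT //; split=> //.
      apply/orP; left; apply/negP=> /(in25 w w3) w25.
      by case/negP: (not25 v w v25 w25).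
    have [win|wo] := boolP (w \in inner); last by exists 2%N.
    by exists w; rewrite ?eqxx ?orbT // in25.
  by apply: (solvable_no_triangle (solK z)); apply: nK; [exact: zu | exact: zv | | |
    exact: zu | exact: zw | | | exact: zv | exact: zw | |].
(* Heads of arrows are outer, so only the start of a path can be 2 or 5: the path lies in [J] or in
   the supplement for its start. *)
- move=> p q r t /and3P[npq qo pP] /and3P[nqr ro qP] /and3P[nrt to rP].
  have arr u v : u \notin inner -> (u \in [:: 2; 5]%N) || (u \notin inner) && arrow J u v ->
      arrow J u v.
    by move=> uo /orP[/sub25|/andP[_]//]; rewrite (negPf uo).
  have aqr := arr q r qo qP; have art := arr r t ro rP.
  case/orP: pP => [p25|/andP[po apq]]; last exact: no_arrow_path solJ apq aqr art.
  have aKqr := aJK p q r p25 qo ro nqr aqr; have aKrt := aJK p r t p25 ro to nrt art.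
  exact: no_arrow_path (solK p) (a25 p q p25 qo npq) aKqr aKrt.
have c25 w : w \in [:: 2; 5]%N -> c w = ord0.
  by move=> w25; apply: c0 => u; rewrite /a (sub25 w w25) andbF.
have n3c v : nonadj G 3 v -> c v = ord0.
  move=> n3v; have [_ _ v3] := nonadj_primes n3v; apply/c25/in25; first by rewrite eq_sym.
  by apply: contraLR n3v => /no3.
exists (fun v => if v == 3 then inord 1 else c v) => u v nuv.
have [_ _ neq] := nonadj_primes nuv.
have [u3|u3] := eqVneq u 3; have [v3|v3] := eqVneq v 3.
- by rewrite u3 v3 in neq.
- by rewrite n3c ?u3 // -?u3 // -val_eqE /= inordK.
- by rewrite n3c -?v3 // 1?nonadj_sym // -val_eqE /= inordK.
by apply: cE; rewrite /E nuv u3 v3.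
Qed.

End NonsolvableColoring.

Section PseudoA6.
Variables (gT : finGroupType) (G : {group gT}).
Hypothesis psG : pseudo_A6_solvable G.

Local Notation inner := [:: 2; 3; 5]%N.

Lemma triangle_nonsolvable p q r :
  nonadj G p q -> nonadj G p r -> nonadj G q r -> ~~ solvable G.
Proof. by move=> npq npr nqr; apply/negP=> /solvable_no_triangle/(_ npq npr). Qed.

(** Suppose [p] is outer; then neither [q] nor [r] is 3. If at most one of them is inner, the
    triangle survives in a solvable supplement; if they are 2 and 5, [nonadj_2_outside] applies. *)
Lemma triangle_inner p q r :
  nonadj G p q -> nonadj G p r -> nonadj G q r -> p \in inner.
Proof.
move=> npq npr nqr; have nsolG := triangle_nonsolvable npq npr nqr.
have [//|po] := boolP (p \in inner).
have no3 v : nonadj G p v -> v \in inner -> v \in [:: 2; 5]%N.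
  rewrite !inE; case: eqP => //= _ npv /orP[/eqP v3|-> //].
  by case: (nonadj_3_outside psG nsolG po); rewrite -v3 nonadj_sym.
have sup w : w \in [:: 2; 5]%N -> (q \notin inner) || (q == w) ->
    (r \notin inner) || (r == w) -> False.
  move=> w25 qw rw; have [|K [_ sKG solK piK]] :=
    solvable_supplement psG w25 (sub1G G) (solvable1 _).
    by rewrite /pgroup cards1.
  have pw : (p \notin inner) || (p == w) by rewrite po.
  have nK := nonadj_supplement sKG piK.
  exact: solvable_no_triangle solK (nK _ _ pw qw npq) (nK _ _ pw rw npr) (nK _ _ qw rw nqr).
have [qin|qo] := boolP (q \in inner); last first.
  have [rin|ro] := boolP (r \in inner); last by case: (sup 2%N); rewrite ?qo ?ro.
  by case: (sup r); rewrite ?qo ?eqxx ?orbT ?no3.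
have [rin|ro] := boolP (r \in inner); last first.
  by case: (sup q); rewrite ?ro ?eqxx ?orbT ?no3.
have [_ _ neq] := nonadj_primes nqr.
have n25 : nonadj G 2 5.
  move: (no3 q npq qin) (no3 r npr rin) neq (nqr); rewrite !inE.
  by move=> /orP[]/eqP-> /orP[]/eqP-> //; rewrite nonadj_sym.
case: (nonadj_2_outside psG nsolG po n25).
move: (no3 q npq qin) (no3 r npr rin) neq (npq) (npr); rewrite !inE.
by move=> /orP[]/eqP-> /orP[]/eqP-> //; rewrite ![nonadj G p _]nonadj_sym.
Qed.

Lemma triangle_isolated p q r u v :
  nonadj G p q -> nonadj G p r -> nonadj G q r -> u \in inner -> nonadj G u v ->
  v \in inner.
Proof.
move=> npq npr nqr uin nuv; have nsolG := triangle_nonsolvable npq npr nqr.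
have pin := triangle_inner npq npr nqr.
have nqp : nonadj G q p by rewrite nonadj_sym.
have nrp : nonadj G r p by rewrite nonadj_sym.
have nrq : nonadj G r q by rewrite nonadj_sym.
have qin := triangle_inner nqp nqr npr; have rin := triangle_inner nrp nrq npq.
have [_ _ neq_pq] := nonadj_primes npq; have [_ _ neq_pr] := nonadj_primes npr.
have [_ _ neq_qr] := nonadj_primes nqr.
have [n25 n35] : nonadj G 2 5 /\ nonadj G 3 5.
  move: pin qin rin neq_pq neq_pr neq_qr npq npr nqr; rewrite !inE.
  by do 3![case/or3P=> /eqP->] => // _ _ _ n1 n2 n3; split; rewrite // nonadj_sym.
have [//|vo] := boolP (v \in inner); move: uin nuv; rewrite !inE.
case/or3P=> /eqP-> nuv.
- by case: (nonadj_2_outside psG nsolG vo n25 nuv).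
- by case: (nonadj_3_outside psG nsolG vo nuv).
by case: (nonadj_5_outside psG nsolG vo n25 n35 nuv).
Qed.

Lemma nonadj_coloring :
  exists c : nat -> 'I_3, forall u v, nonadj G u v -> c u != c v.
Proof.
by have [/solvable_coloring|/(nonsolvable_coloring psG)] := boolP (solvable G).
Qed.

End PseudoA6.

Lemma compl_prime_adj (gT : finGroupType) (G : {group gT}) (p q : prime_graph G) :
  compl_adj p q = nonadj G (val p) (val q).
Proof.
have pP : val p \in primes #|G| by apply: valP.
have qP : val q \in primes #|G| by apply: valP.
rewrite /compl_adj /= /prime_adj /= /nonadj /= pP qP /= -val_eqE.
case: eqP => //= _; rewrite negb_exists; apply: eq_forallb => x.
by rewrite negb_and implybE.
Qed.

Lemma compl_isomorphic (gT : finGroupType) (G : {group gT}) (Gamma : sgraph)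
    (f : Gamma -> prime_graph G) :
  bijective f -> {mono f : x y / adj x y >-> adj x y} ->
  forall x y : Gamma, compl_adj x y = nonadj G (val (f x)) (val (f y)).
Proof.
move=> bij_f mono_f x y; rewrite -compl_prime_adj /compl_adj /=.
by rewrite (inj_eq (bij_inj bij_f)) -[adj x y]mono_f.
Qed.

Lemma prime_graph_compl (gT : finGroupType) (G : {group gT}) (Gamma : sgraph) :
  pseudo_A6_solvable G -> graph_isomorphic Gamma (prime_graph G) ->
  colorable 3 (complement Gamma) /\ at_most_one_triangle (complement Gamma) /\
  (forall T : {set complement Gamma}, triangle T -> isolated T).
Proof.
move=> psG [f bij_f mono_f]; pose g x := val (f x).
have adjE := compl_isomorphic bij_f mono_f.
have inj_g : injective g by apply: inj_comp val_inj (bij_inj bij_f).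
pose I : {set complement Gamma} := [set x | g x \in [:: 2; 3; 5]%N].
have leI : #|I| <= 3.
  rewrite cardE -(size_map g) -[3]/(size [:: 2; 3; 5]%N) uniq_leq_size //.
    by rewrite map_inj_uniq ?enum_uniq.
  by move=> _ /mapP[x xI ->]; rewrite mem_enum inE in xI.
have triP (T : {set complement Gamma}) x : triangle T -> x \in T ->
    exists y z, [/\ y \in T, z \in T, nonadj G (g x) (g y), nonadj G (g x) (g z)
      & nonadj G (g y) (g z)].
  move=> [T3 adjT] Tx; have : 1 < #|T :\ x|.
    by move: T3; rewrite (cardsD1 x) Tx add1n => -[->].
  case/card_gt1P=> y [z [/setD1P[yx Ty] /setD1P[zx Tz] yz]]; exists y, z.
  by rewrite -!adjE; split=> //; apply: adjT; rewrite // eq_sym.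
have triI (T : {set complement Gamma}) : triangle T -> T = I.
  move=> triT; apply/eqP; rewrite eqEcard (proj1 triT) leI andbT.
  apply/subsetP=> x Tx; have [y [z [_ _ nxy nxz nyz]]] := triP T x triT Tx.
  by rewrite inE (triangle_inner psG nxy nxz nyz).
split; [|split].
- have [c cE] := nonadj_coloring psG.
  by exists (c \o g) => x y /=; rewrite adjE; apply: cE.
- by move=> T1 T2 /triI-> /triI.
move=> T triT x y Tx Ty; apply/negP=> /=; rewrite adjE.
have [u [v [_ _ nxu nxv nuv]]] := triP T x triT Tx.
move/(triangle_isolated psG nxu nxv nuv (triangle_inner psG nxu nxv nuv)).
by move: Ty; rewrite (triI T triT) inE => /negPf->.
Qed.

(** * Realizing graphs *)

Section RootOfUnity.
Local Open Scope ring_scope.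

Lemma prod_map_Cyclotomic (F : fieldType) (n : nat) : (n > 0)%N ->
  \prod_(d <- divisors n) map_poly intr 'Phi_d = 'X^n - 1 :> {poly F}.
Proof.
move=> n_gt0; rewrite -rmorph_prod prod_Cyclotomic //=.
by rewrite rmorphB /= map_polyXn rmorph1.
Qed.

Lemma root_Cyclotomic_expr1 (F : fieldType) (n : nat) (a : F) :
  (n > 0)%N -> root (map_poly intr 'Phi_n) a -> a ^+ n = 1.
Proof.
move=> n_gt0 /rootP root_a; have: ('X^n - 1 : {poly F}).[a] == 0.
  rewrite -prod_map_Cyclotomic // (bigD1_seq n) ?divisors_uniq ?dvdn_divisors //=.
    by rewrite hornerM root_a mul0r.
  by rewrite -dvdn_divisors.
by rewrite hornerD hornerN hornerXn hornerC subr_eq0 => /eqP.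
Qed.

(* Otherwise [a] would be a multiple root of ['X^n - 1]. *)
Lemma root_Cyclotomic_primitive (F : fieldType) (n : nat) (a : F) :
  (n > 0)%N -> n%:R != 0 :> F -> root (map_poly intr 'Phi_n) a -> n.-primitive_root a.
Proof.
move=> n_gt0 nz_n root_a; have an1 := root_Cyclotomic_expr1 n_gt0 root_a.
have prodPhi := prod_map_Cyclotomic F.
have n_div : n \in divisors n by rewrite -dvdn_divisors.
have [m prim_a m_dv] := prim_order_exists n_gt0 an1.
have m_gt0 := prim_order_gt0 prim_a; have [<- //|neq_mn] := eqVneq m n.
have: ('X^m - 1 : {poly F}).[a] == 0.
  by rewrite hornerD hornerN hornerXn hornerC (prim_expr_order prim_a) subrr.
rewrite -prodPhi // horner_prod prodf_seq_eq0 => /hasP[d].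
rewrite -dvdn_divisors // => d_dv /= root_d.
have neq_dn : d != n by apply: contraNneq neq_mn => dn; rewrite eqn_dvd m_dv -dn.
have: separable_poly ('X^n - 1 : {poly F}) by apply: separable_Xn_sub_1.
rewrite -prodPhi // (bigD1_seq n) ?divisors_uniq //= separable_mul => /and3P[_ _].
rewrite (big_rem d) /=; last by rewrite -dvdn_divisors ?(dvdn_trans d_dv).
rewrite neq_dn => /coprimep_root/(_ root_a).
by rewrite hornerM (eqP root_d) mul0r eqxx.
Qed.

Lemma Cyclotomic_large (n : nat) : (n > 0)%N ->
  exists k : nat, (1 < `|(('Phi_n).[(n * k)%:R] : int)|)%N.
Proof.
(* The roots of [P] are the arguments where the cyclotomic polynomial takes a value 0, 1 or -1; the
   first [size P] multiples of [n] cannot all be among them. *)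
move=> n_gt0; pose P : {poly int} := 'Phi_n * ('Phi_n - 1) * ('Phi_n + 1).
have size_Phi : (1 < size 'Phi_n)%N by rewrite size_Cyclotomic ltnS totient_gt0.
have nzD c : 'Phi_n + c%:P != 0.
  rewrite -size_poly_gt0 size_polyDl ?(ltnW size_Phi) //.
  by rewrite (leq_ltn_trans (size_polyC_leq1 _)).
have nzP : P != 0.
  rewrite /P !mulf_neq0 // -?polyCN ?nzD // -size_poly_gt0; exact: ltnW.
pose s := [seq (n * k)%:R : int | k <- iota 0 (size P)].
have us : uniq s.
  rewrite map_inj_uniq ?iota_uniq // => i j /eqP.
  by rewrite !natz eqz_nat eqn_pmul2l // => /eqP.
have: ~~ all (root P) s.
  by apply/negP=> all_s; have := max_poly_roots nzP all_s us; rewrite size_map size_iota ltnn.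
rewrite all_map -has_predC => /hasP[k _ /=]; rewrite /P !rootM !negb_or => /andP[/andP[]].
rewrite /root !hornerE subr_eq0 addr_eq0; set v := _.[_] => v0 v1 vN1.
exists k; rewrite -/v; case: v v0 v1 vN1 => [[|[|m]]|[|m]] //.
Qed.

(** Take a prime divisor [r] of the cyclotomic value at [n * k]. The argument is a multiple of [n]
    so that [r] cannot divide [n]: the root would be 0 modulo [r], yet its [n]-th power is 1. *)
Lemma prime_primitive_root (n : nat) : (n > 0)%N ->
  exists2 r, prime r /\ ~~ (r %| n)%N & exists a : 'F_r, n.-primitive_root a.
Proof.
move=> n_gt0; have [k] := Cyclotomic_large n_gt0.
set v := _.[_] => v_gt1; pose r := pdiv `|v|%N; have r_pr : prime r by apply: pdiv_prime.
have charF := pchar_Fp r_pr; pose a : 'F_r := (n * k)%:R.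
have root_a : root (map_poly intr 'Phi_n) a.
  rewrite /root /a -[X in _.[X]](rmorph_nat intr) horner_map /=.
  by rewrite -(dvdz_pcharf charF) dvdzE absz_nat; apply: pdiv_dvd.
have [r_n|r'n] := boolP (r %| n)%N; last first.
  exists r => //; exists a; apply: root_Cyclotomic_primitive => //.
  by rewrite -(dvdn_pcharf charF).
have a0 : a = 0 by apply/eqP; rewrite -(dvdn_pcharf charF) dvdn_mulr.
have := root_Cyclotomic_expr1 n_gt0 root_a.
by move/eqP; rewrite a0 expr0n eqn0Ngt n_gt0 /= eq_sym oner_eq0.
Qed.

End RootOfUnity.

(** * Semidirect products with induced modules *)

Section Wreath.
Variables (gT : finGroupType) (F : finComNzRingType).

(** The regular wreath product provides the ambient group type; the semidirect product with an
    induced module is cut out of it as [twisted]. *)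
Definition wreath : predArgType := ({ffun gT -> F} * gT)%type.
HB.instance Definition _ := Finite.on wreath.

(* [gT] acts on the functions by [f^y k = f (y k)]. *)
Definition wreath_mul (u v : wreath) : wreath :=
  ([ffun k => (u.1 (v.2 * k)%g + v.1 k)%R], u.2 * v.2).
Definition wreath_one : wreath := ([ffun=> 0%R], 1).
Definition wreath_inv (u : wreath) : wreath :=
  ([ffun k => (- u.1 (u.2^-1 * k)%g)%R], u.2^-1).

Lemma wreath_mulA : associative wreath_mul.
Proof.
move=> u v w; congr (_, _); last by rewrite /= mulgA.
by apply/ffunP=> k; rewrite !ffunE /= mulgA addrA.
Qed.

Lemma wreath_mul1 : left_id wreath_one wreath_mul.
Proof.
case=> f x; congr (_, _); last by rewrite /= mul1g.
by apply/ffunP=> k; rewrite !ffunE add0r.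
Qed.

Lemma wreath_mulV : left_inverse wreath_one wreath_inv wreath_mul.
Proof.
case=> f x; congr (_, _); last by rewrite /= mulVg.
by apply/ffunP=> k; rewrite !ffunE /= mulKg addNr.
Qed.

HB.instance Definition _ := Finite_isGroup.Build wreath
  wreath_mulA wreath_mul1 wreath_mulV.

Variables (G L : {group gT}) (lam : gT -> F).

(* The representation of [G] induced from the character [lam] of [L]. *)
Definition induced : pred {ffun gT -> F} := fun f =>
  [forall (k | k \notin G), f k == 0%R]
  && [forall k in G, forall l in L, f (k * l)%g == (lam l * f k)%R].

Lemma inducedP (f : {ffun gT -> F}) : reflect
  ((forall k, k \notin G -> f k = 0%R) /\
   {in G & L, forall k l, f (k * l)%g = (lam l * f k)%R})
  (induced f).
Proof.
apply: (iffP andP) => [] [f0 fL]; split.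
- by move=> k Gk; apply/eqP; apply: (forall_inP f0).
- by move=> k l Gk Ll; apply/eqP; apply: (forall_inP (forall_inP fL k Gk)).
- by apply/forall_inP=> k Gk; rewrite f0.
by apply/forall_inP=> k Gk; apply/forall_inP=> l Ll; rewrite fL.
Qed.

Definition twisted : {set wreath} := [set u : wreath | induced u.1 & u.2 \in G].

Lemma twisted_group_set : group_set twisted.
Proof.
apply/group_setP; split.
  rewrite inE group1 andbT; apply/inducedP; split=> [k|k l] _; first by rewrite ffunE.
  by rewrite !ffunE mulr0.
move=> u v; rewrite !inE => /andP[/inducedP[u0 uL] Gu] /andP[/inducedP[v0 vL] Gv].
rewrite groupM // andbT; apply/inducedP; split=> [k Gk|k l Gk Ll] /=.
  by rewrite ffunE u0 ?v0 ?addr0 ?groupMl.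
by rewrite !ffunE mulgA uL ?groupM // vL // mulrDr.
Qed.
Canonical twisted_group := Group twisted_group_set.

Definition wreath_proj (u : wreath) : gT := u.2.
Lemma wreath_projM : {in twisted &, {morph wreath_proj : u v / u * v}}.
Proof. by []. Qed.
Canonical wreath_proj_morphism := Morphism wreath_projM.

Definition wreath_base (x : gT) : wreath := ([ffun=> 0%R], x).
Lemma wreath_baseM : {in G &, {morph wreath_base : x y / x * y}}.
Proof.
by move=> x y _ _; congr (_, _); apply/ffunP=> k; rewrite !ffunE addr0.
Qed.
Canonical wreath_base_morphism := Morphism wreath_baseM.

Lemma wreath_base_inj : 'injm wreath_base.
Proof. by apply/injmP=> x y _ _ []. Qed.

Lemma twisted_base x : x \in G -> wreath_base x \in twisted.
Proof.
move=> Gx; rewrite inE /= Gx andbT; apply/inducedP; split=> [k|k l] _; rewrite !ffunE //.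
by rewrite mulr0.
Qed.

Lemma wreath_proj_im : wreath_proj @* twisted = G.
Proof.
apply/setP=> x; apply/morphimP/idP=> [[u _ + ->]|Gx]; first by rewrite inE => /andP[].
by exists (wreath_base x); rewrite ?twisted_base.
Qed.

Lemma wreath_proj_ker u : (u \in 'ker wreath_proj) = induced u.1 && (u.2 == 1).
Proof.
by rewrite !inE -andbA; case: eqP => [->|]; rewrite ?group1 ?andbF.
Qed.

Lemma twisted_quotient_isog : twisted / 'ker wreath_proj \isog G.
Proof. by rewrite -[X in _ \isog X]wreath_proj_im; apply: first_isog. Qed.

Lemma card_twisted : #|twisted| = (#|'ker wreath_proj| * #|G|)%N.
Proof.
have nsK := ker_normal wreath_proj_morphism.
rewrite -(Lagrange (normal_sub nsK)) -(card_isog twisted_quotient_isog).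
by rewrite card_quotient ?normal_norm.
Qed.

Lemma wreath_ker_abelian : abelian ('ker wreath_proj).
Proof.
apply/centsP=> u + v; rewrite !wreath_proj_ker => /andP[_ /eqP u1] /andP[_ /eqP v1].
congr (_, _); last by rewrite /= u1 v1.
by apply/ffunP=> k; rewrite !ffunE u1 v1 !mul1g addrC.
Qed.

Lemma wreath_kerX (u : wreath) n : u.2 = 1 -> u ^+ n = ([ffun k => (u.1 k *+ n)%R], 1) :> wreath.
Proof.
move=> u1; elim: n => [|n IHn].
  by congr (_, _); apply/ffunP=> k; rewrite !ffunE mulr0n.
rewrite expgSr IHn; congr (_, _); last by rewrite /= u1 mulg1.
by apply/ffunP=> k; rewrite !ffunE u1 mul1g mulrSr.
Qed.

End Wreath.

Lemma nonadj_quotient_pgroup (gT : finGroupType) (H V : {group gT}) (r p q : nat) :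
  V <| H -> r.-group V -> p != r -> q != r -> p \in \pi(H / V) -> q \in \pi(H / V) ->
  nonadj H p q = nonadj (H / V) p q.
Proof.
move=> nsVH rV pr qr piVp piVq; apply/idP/idP; first exact: nonadj_quotient.
case/nonadjP=> _ _ neq no_pq; apply/nonadjP; split=> //.
- by apply: (pi_of_dvd (dvdn_quotient H V)) piVp; apply: cardG_gt0.
- by apply: (pi_of_dvd (dvdn_quotient H V)) piVq; apply: cardG_gt0.
move=> y Hy; apply/eqP=> oy; have [p_pr q_pr] : prime p /\ prime q.
  by move: piVp piVq; rewrite !mem_primes => /andP[-> _] /andP[-> _].
have Ny := subsetP (normal_norm nsVH) y Hy.
have coyV : coprime #|V| #|<[y]>|.
  rewrite -orderE oy; apply: pnat_coprime rV _; rewrite pnatM !pnatE //=.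
  by rewrite !inE pr qr.
have /negP[] := no_pq (coset V y) (mem_quotient V Hy); apply/eqP.
rewrite -oy /order -quotient_cycle //; symmetry; apply: card_isog.
by apply: quotient_isog; rewrite ?cycle_subG // coprime_TIg.
Qed.

Section Twisted.
Variables (gT : finGroupType) (G L M : {group gT}) (F : finFieldType) (r : nat) (lam : gT -> F).
Hypotheses (charF : r \in [pchar F]%R) (r'G : ~~ (r %| #|G|)) (nsLG : L <| G) (nsML : M <| L).
Hypothesis lamM : {in L &, forall x y, lam (x * y) = (lam x * lam y)%R}.
Hypothesis lam1 : {in L, forall x, (lam x == 1%R) = (x \in M)}.
Variable S : pred nat.

Let r_pr : prime r := pcharf_prime charF.
Hypothesis LM_S : {in G, forall x, prime #[x] -> (x \in L :\: M) = S #[x]}.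

Local Notation H := (twisted_group G L lam).
Local Notation V := ('ker (@wreath_proj_morphism gT F G L lam)).

Lemma twisted_kerX (u : wreath gT F) : u.2 = 1 -> u ^+ r = 1.
Proof.
move=> u1; rewrite wreath_kerX //; congr (_, _); apply/ffunP=> k; rewrite !ffunE -mulr_natr.
by rewrite (pcharf0 charF) mulr0.
Qed.

Lemma twisted_ker_pgroup : r.-group V.
Proof.
apply/pgroupP=> q q_pr /(Cauchy q_pr)[u Vu ou].
have u1 : u.2 = 1 by apply/eqP; move: Vu; rewrite wreath_proj_ker => /andP[].
by rewrite inE /= -dvdn_prime2 // -ou order_dvdn twisted_kerX.
Qed.

Lemma twisted_order_proj u : u \in H -> prime #[u] -> #[u] != r ->
  u.2 \in G /\ #[u.2] = #[u].
Proof.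
move=> Hu u_pr ur; have Gu : u.2 \in G by move: Hu; rewrite inE => /andP[].
split=> //; have /(prime_nt_dvdP u_pr)-> // : #[u.2] %| #[u].
  exact: (morph_order (wreath_proj_morphism G L lam) Hu).
rewrite order_eq1; apply: contraNneq ur => u1.
have Vu : u \in V by rewrite wreath_proj_ker u1 eqxx andbT; move: Hu; rewrite inE => /andP[].
have := mem_p_elt twisted_ker_pgroup Vu; rewrite /p_elt pnatE // inE /=.
Qed.

Lemma twisted_order_r u : u \in H -> #[u] = r -> u.2 = 1.
Proof.
move=> Hu ou; have Gu : u.2 \in G by move: Hu; rewrite inE => /andP[].
apply/eqP; rewrite -order_eq1 -dvdn1 -(eqP (_ : coprime r #|G|)) ?prime_coprime //.
rewrite dvdn_gcd order_dvdG // andbT -ou.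
exact: (morph_order (wreath_proj_morphism G L lam) Hu).
Qed.

Lemma lam_1 : lam 1 = 1%R.
Proof. by apply/eqP; rewrite lam1 ?group1. Qed.

Definition induced_delta : {ffun gT -> F} := [ffun k => if k \in L then lam k else 0%R].

Lemma induced_deltaP : induced G L lam induced_delta.
Proof.
have sLG := normal_sub nsLG; apply/inducedP; split=> [k Gk|k l Gk Ll]; rewrite !ffunE.
  by case: ifP => // /(subsetP sLG); rewrite (negPf Gk).
by rewrite groupMr //; case: ifP => Lk; rewrite ?mulr0 // lamM // mulrC.
Qed.

Lemma twisted_pi p : p \in \pi(H) = (p == r) || (p \in \pi(G)).
Proof.
have rV := twisted_ker_pgroup.
have Vd : (induced_delta, 1) \in V by rewrite wreath_proj_ker induced_deltaP /=.
have ntV : V :!=: 1.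
  apply/eqP=> V1; move: Vd; rewrite V1 => /set1P[/ffunP/(_ 1)].
  by rewrite !ffunE group1 lam_1 => /eqP; rewrite oner_eq0.
have piV : p \in \pi(V) = (p == r).
  have [_ r_dv _] := pgroup_pdiv rV ntV; rewrite mem_primes cardG_gt0 /=.
  apply/andP/eqP=> [[p_pr /(pgroupP rV p p_pr)/eqP]|->]; by [].
rewrite -piV !mem_primes !cardG_gt0 /= card_twisted.
by case: (boolP (prime p)) => //= p_pr; rewrite Euclid_dvdM.
Qed.

Lemma twisted_nonadj_old p q : p \in \pi(G) -> q \in \pi(G) ->
  nonadj H p q = nonadj G p q.
Proof.
have isoG := twisted_quotient_isog G L lam.
have pir s : s \in \pi(G) -> s != r.
  by apply: contraTneq => ->; rewrite mem_primes (negPf r'G) !andbF.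
move=> piGp piGq; have -> : nonadj G p q = nonadj (H / V) p q.
  by apply/idP/idP; apply: nonadj_isog; [rewrite isog_sym | ].
apply: nonadj_quotient_pgroup (ker_normal _) twisted_ker_pgroup _ _ _ _;
  rewrite ?pir //= (card_isog isoG) //.
Qed.

(** An element of order [p] has a nonzero fixed vector in the induced module exactly if it is not in
    [L :\: M]. *)
Lemma twisted_nonadj_new p : p \in \pi(G) -> nonadj H r p = S p.
Proof.
move=> piGp; have p_pr : prime p by move: piGp; rewrite mem_primes => /andP[].
have pr : p != r by apply: contraTneq piGp => ->; rewrite mem_primes (negPf r'G) !andbF.
have sLG := normal_sub nsLG; apply/idP/idP=> [nrp|Sp].
  have [x Gx ox] : {x | x \in G & #[x] = p}.
    by apply: Cauchy => //; move: piGp; rewrite mem_primes => /and3P[].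
  apply/idPn=> nSp; have {nSp} LMx : x \notin L :\: M by rewrite LM_S // ox.
  (* The sum of the orbit of [induced_delta]. Its value at 1 is [p] if [x] is in [M], and 1 if [x]
     is not in [L], since then [<[x]>] meets [L] trivially. *)
  pose f : {ffun gT -> F} := [ffun k => (\sum_(y in <[x]>) induced_delta (y * k)%g)%R].
  have fP : induced G L lam f.
    have /inducedP[d0 dL] := induced_deltaP; have sxG : <[x]> \subset G by rewrite cycle_subG.
    apply/inducedP; split=> [k Gk|k l Gk Ll]; rewrite !ffunE.
      by apply: big1 => y /(subsetP sxG) Gy; rewrite d0 ?groupMl.
    by rewrite mulr_sumr; apply: eq_bigr => y /(subsetP sxG) Gy; rewrite mulgA dL ?groupM.
  have fx k : f (x * k)%g = f k.
    rewrite !ffunE [RHS](reindex_inj (mulIg x)) /=.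
    by apply: eq_big => y; rewrite ?groupMr ?cycle_id ?mulgA.
  have f1 : f 1 != 0%R.
    rewrite ffunE; have [Lx|L'x] := boolP (x \in L).
      have Mx : <[x]> \subset M by move: LMx; rewrite inE Lx andbT negbK cycle_subG.
      rewrite (eq_bigr (fun=> 1%R)) => [|y /(subsetP Mx) My].
        by rewrite sumr_const -orderE ox -(dvdn_pcharf charF) dvdn_prime2 // eq_sym.
      have Ly := subsetP (normal_sub nsML) y My.
      by rewrite mulg1 ffunE Ly; apply/eqP; rewrite lam1.
    rewrite (big_setD1 1) ?group1 //= big1 ?addr0 => [|y /setD1P[y1 xy]].
      by rewrite mulg1 ffunE group1 lam_1 oner_eq0.
    rewrite mulg1 ffunE ifN //; apply: contra L'x => Ly.
    rewrite -cycle_subG (@nt_gen_prime _ <[x]>%G y) ?cycle_subG //= -?orderE ?ox //.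
    by rewrite !inE y1.
  pose u : wreath gT F := (f, 1); have Hu : u \in H by rewrite inE /= fP group1.
  have ou : #[u] = r.
    apply: nt_prime_order => //; first exact: twisted_kerX.
    by apply: contraNneq f1 => -[/ffunP/(_ 1)->]; rewrite ffunE.
  have ov : #[wreath_base F x] = p.
    by rewrite -ox; apply: (order_injm (wreath_base_inj F G)).
  apply: (nonadj_comm nrp Hu (twisted_base L lam Gx) ou ov).
  congr (_, _); last by rewrite /= mul1g mulg1.
  apply/ffunP=> k; rewrite [LHS]ffunE [RHS]ffunE /= fx.
  by rewrite ![[ffun=> 0%R] _]ffunE addr0 add0r.
apply/nonadjP; split; rewrite ?twisted_pi ?eqxx ?piGp ?orbT // 1?eq_sym //.
move=> y Hy; apply/eqP=> oy.
have ou : #[y ^+ p] = r by rewrite orderXdiv oy ?dvdn_mull // mulnK ?prime_gt0.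
have ov : #[y ^+ r] = p by rewrite orderXdiv oy ?dvdn_mulr // mulKn ?prime_gt0.
have cuv : commute (y ^+ p) (y ^+ r) by apply/commuteX2.
move: ou ov cuv (groupX p Hy) (groupX r Hy).
move: (y ^+ p) (y ^+ r) => u v ou ov cuv Hu Hv.
have u1 := twisted_order_r Hu ou.
have [||Gx ox] := twisted_order_proj Hv; rewrite ?ov //.
have /inducedP[u0 uL] : induced G L lam u.1 by move: Hu; rewrite inE => /andP[].
have u_fix k : u.1 (v.2 * k) = u.1 k.
  have := congr1 (fun w : wreath gT F => w.1 k) cuv.
  by rewrite !ffunE u1 mul1g addrC => /addrI.
(* For [k] in [G] the invariance reads [lam (v.2 ^ k) * u.1 k = u.1 k], and the factor is not 1. *)
have uf0 k : u.1 k = 0%R.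
  have [Gk|] := boolP (k \in G); last exact: u0.
  have : v.2 ^ k \in L :\: M by rewrite LM_S ?groupJ // orderJ ox ?ov.
  case/setDP=> Lx Mx; have := u_fix k; rewrite conjgC uL // => /eqP.
  rewrite -subr_eq0 -[X in (_ - X)%R]mul1r -mulrBl mulf_eq0 subr_eq0 lam1 //.
  by rewrite (negPf Mx) => /eqP.
have: u == 1.
  by rewrite -pair_eqE /= u1 eqxx andbT; apply/eqP/ffunP=> k; rewrite uf0 ffunE.
by rewrite -order_eq1 ou => /eqP r1; move: r_pr; rewrite r1.
Qed.

End Twisted.

(* In the representation of [G] induced from a faithful character of [L / M], an
   element of prime order has no fixed points if and only if its order is in [S]. *)
Definition splits (gT : finGroupType) (G L M : {group gT}) (S : pred nat) :=
  [/\ L <| G, M <| L, cyclic (L / M)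
    & {in G, forall x, prime #[x] -> (x \in L :\: M) = S #[x]}].

Lemma cyclic_quotient_character (gT : finGroupType) (L M : {group gT}) (F : fieldType) n (a : F) :
  M <| L -> cyclic (L / M) -> (n.-primitive_root a)%R -> #|L| %| n ->
  exists2 lam : gT -> F, {in L &, forall x y, lam (x * y) = (lam x * lam y)%R}
    & {in L, forall x, (lam x == 1%R) = (x \in M)}.
Proof.
move=> nsML /cyclicP[c defLM] prim_a Ln.
have nML := subsetP (normal_norm nsML).
have mn : #[c] %| n by rewrite /order -defLM (dvdn_trans (dvdn_quotient _ _)).
have prim_b := dvdn_prim_root prim_a mn; set b := (a ^+ _)%R in prim_b.
(* The generator [c] goes to a root of unity of the same order; the default exponent 0 does not
   occur on [L]. *)
pose lam x : F :=
  (b ^+ odflt (Ordinal (order_gt0 c)) [pick i : 'I_#[c] | coset M x == (c ^+ i)%g])%R.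
have lamP x : x \in L -> exists2 i, coset M x = c ^+ i & lam x = (b ^+ i)%R.
  move=> Lx; have : coset M x \in <[c]> by rewrite -defLM mem_quotient.
  case/cyclePmin=> i ltic xi; rewrite /lam; case: pickP => [j /eqP xj|/(_ (Ordinal ltic))].
    by exists j.
  by rewrite xi eqxx.
exists lam => [x y Lx Ly|x Lx].
  have [i xi ->] := lamP x Lx; have [j yj ->] := lamP y Ly.
  have [k xyk ->] := lamP _ (groupM Lx Ly).
  apply/eqP; rewrite -exprD (eq_prim_root_expr prim_b) -eq_expg_mod_order expgD -xi -yj -xyk.
  by rewrite morphM ?nML.
have [i xi ->] := lamP x Lx.
rewrite -(prim_order_dvd prim_b) order_dvdn -xi.
by apply/eqP/idP=> [/coset_idr->//|]; [apply: nML | apply: coset_id].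
Qed.

(** A criterion on elements, which passes to images and preimages without comparing quotient
    groups. *)
Lemma cyclic_quotientP (gT : finGroupType) (L M : {group gT}) : M <| L ->
  cyclic (L / M) <-> exists2 z, z \in L & forall x, x \in L -> exists i, x * z ^- i \in M.
Proof.
move=> nsML; have nML := subsetP (normal_norm nsML); split=> [/cyclicP[c defLM]|[z Lz Mz]].
  have : c \in L / M by rewrite defLM cycle_id.
  case/morphimP=> z Nz Lz cz; exists z => // x Lx.
  have : coset M x \in <[c]> by rewrite -defLM mem_quotient.
  case/cycleP=> i xi; exists i; apply: coset_idr; first by rewrite groupM ?groupV ?groupX ?nML.
  by rewrite morphM ?groupV ?groupX ?nML // morphV ?groupX ?nML //= morphX ?nML // xi cz mulgV.
apply: cyclicS (cycle_cyclic (coset M z)); apply/subsetP=> _ /morphimP[x Nx Lx ->].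
have [i Mi] := Mz x Lx; apply/cycleP; exists i.
rewrite -morphX ?nML //= -{1}[x](mulgKV (z ^+ i)).
have Nw := subsetP (normG M) _ Mi.
have Nz := groupX i (nML z Lz).
by rewrite [LHS](morphM (coset_morphism M) Nw Nz) /= (coset_id Mi) mul1g.
Qed.

Lemma cyclic_quotient_morphim (gT rT : finGroupType) (D : {group gT})
    (f : {morphism D >-> rT}) (L M : {group gT}) :
  L \subset D -> M <| L -> cyclic (L / M) -> cyclic (f @* L / f @* M).
Proof.
move=> sLD nsML /cyclic_quotientP[] // z Lz Mz.
apply/cyclic_quotientP; first exact: morphim_normal.
have sD := subsetP sLD; exists (f z); first by rewrite mem_morphim ?sD.
move=> _ /morphimP[x Dx Lx ->]; have [i Mi] := Mz x Lx; exists i.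
rewrite -morphX ?sD // -morphV ?groupX ?sD // -morphM ?groupV ?groupX ?sD //.
by rewrite mem_morphim // groupM ?groupV ?groupX ?sD.
Qed.

Lemma cyclic_quotient_morphpre (gT rT : finGroupType) (D : {group gT})
    (f : {morphism D >-> rT}) (L M : {group rT}) :
  L \subset f @* D -> M <| L -> cyclic (L / M) -> cyclic (f @*^-1 L / f @*^-1 M).
Proof.
move=> sLD nsML /cyclic_quotientP[] // z Lz Mz; have sMD := subset_trans (normal_sub nsML) sLD.
apply/cyclic_quotientP; first by rewrite morphpre_normal.
have /morphimP[y Dy _ zy] := subsetP sLD z Lz; exists y; first by rewrite !inE Dy -zy.
move=> u /morphpreP[Du Lu]; have [i Mi] := Mz _ Lu; exists i.
rewrite inE groupM ?groupV ?groupX //= inE morphM ?groupV ?groupX // morphV ?groupX //.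
by rewrite morphX // -zy.
Qed.

Section TwistedSplits.
Variables (gT : finGroupType) (G L M : {group gT}) (F : finFieldType) (r : nat) (lam : gT -> F).
Hypotheses (charF : r \in [pchar F]%R) (r'G : ~~ (r %| #|G|)).
Variable S : pred nat.
Hypothesis splLM : splits G L M S.
Hypothesis lamM : {in L &, forall x y, lam (x * y) = (lam x * lam y)%R}.
Hypothesis lam1 : {in L, forall x, (lam x == 1%R) = (x \in M)}.

Let r_pr : prime r := pcharf_prime charF.
Local Notation H := (twisted_group G L lam).
Local Notation V := ('ker (@wreath_proj_morphism gT F G L lam)).
Local Notation f := (wreath_proj_morphism G L lam).

Lemma mem_twisted_pre u (A : {set gT}) : u \in H -> (u \in f @*^-1 A) = (u.2 \in A).
Proof. by move=> Hu; rewrite morphpreE in_setI Hu inE. Qed.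

Lemma twisted_pre_normal (N : {group gT}) : N <| G -> f @*^-1 N <| H.
Proof.
have imf : f @* H = G by apply: wreath_proj_im.
move=> nsNG; rewrite -[X in _ <| X](_ : f @*^-1 G = H).
  by rewrite morphpre_normal ?imf // normal_sub.
by rewrite -imf morphimGK ?subsetIl.
Qed.

(** Both preimages contain the new Sylow subgroup, so elements of order [r] do not lie in their
    difference. *)
Lemma splits_pullback (L1 M1 : {group gT}) S1 : splits G L1 M1 S1 -> ~~ S1 r ->
  splits H (f @*^-1 L1) (f @*^-1 M1) S1.
Proof.
case=> nsL1 nsM1 cyc LM_S1 S1'r; have imf : f @* H = G by apply: wreath_proj_im.
have sL1 := normal_sub nsL1; have sM1 := normal_sub nsM1.
split.
- rewrite -[X in _ <| X](_ : f @*^-1 G = H) ?morphpre_normal ?imf //.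
  by rewrite -imf morphimGK ?subsetIl.
- by rewrite morphpre_normal ?imf // (subset_trans sM1).
- by rewrite cyclic_quotient_morphpre ?imf.
move=> u Hu u_pr; rewrite in_setD !mem_twisted_pre //.
have [ur|ur] := eqVneq #[u] r.
  by rewrite ur (negPf S1'r) (twisted_order_r charF r'G Hu ur) group1.
have [Gu ou] := twisted_order_proj charF Hu u_pr ur.
by rewrite -ou -LM_S1 ?ou // !inE.
Qed.

Hypothesis L_G : L = G.
Hypothesis cardF : #|F| = r.

Let nsMG : M <| G. Proof. by rewrite -L_G; case: splLM. Qed.
Let LG x : (x \in L) = (x \in G). Proof. by rewrite L_G. Qed.

(** As [L = G], a function in the module is determined by its value at 1. *)
Lemma twisted_ker_cyclic : cyclic V.
Proof.
have [V1|ntV] := eqVneq V 1%G; first by rewrite V1 cyclic1.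
have [_ rV _] := pgroup_pdiv (twisted_ker_pgroup G L lam charF) ntV.
apply: prime_cyclic; suff -> : #|V| = r by [].
apply/eqP; rewrite eqn_leq (dvdn_leq _ rV) ?cardG_gt0 // andbT -cardF.
rewrite -(card_in_imset (f := fun u : wreath gT F => u.1 1)) ?max_card // => u v.
rewrite !wreath_proj_ker => /andP[/inducedP[u0 uL] /eqP u1] /andP[/inducedP[v0 vL] /eqP v1] uv.
apply/eqP; rewrite -pair_eqE /= u1 v1 eqxx andbT; apply/eqP/ffunP=> k.
have [Gk|G'k] := boolP (k \in G); last by rewrite u0 ?v0.
by rewrite -[k]mul1g uL ?vL ?LG // uv.
Qed.

Lemma twisted_ker_commute x u : x \in M -> u \in V -> commute (wreath_base F x) u.
Proof.
rewrite wreath_proj_ker => Mx /andP[/inducedP[u0 uL] /eqP u1].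
have Gx := subsetP (normal_sub nsMG) x Mx.
congr (_, _); last by rewrite /= u1 mul1g mulg1.
apply/ffunP=> k; rewrite [LHS]ffunE [RHS]ffunE ![[ffun=> 0%R] _]ffunE /= add0r addr0.
have [Gk|G'k] := boolP (k \in G); last by rewrite !u0 ?groupMl.
have Mxk : x ^ k \in M by rewrite memJ_norm // (subsetP (normal_norm nsMG)).
have Lxk : x ^ k \in L by rewrite LG groupJ.
by have := lam1 Lxk; rewrite Mxk conjgC uL // => /eqP->; rewrite mul1r.
Qed.

(** Since [S] and [S1] are disjoint and [L = G], elements of prime order in [S1] lie in [M], so the
    pair can be cut down to [M], which centralises [V]. Adding [V] only to the upper group puts the
    elements of order [r] in the difference. *)
Lemma splits_extend (L1 M1 : {group gT}) S1 : splits G L1 M1 S1 ->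
  (forall p, p \in \pi(G) -> S p -> ~~ S1 p) ->
  splits H (f @*^-1 (L1 :&: M)) (wreath_base_morphism F G @* (M1 :&: M))
    [pred p | (p == r) || S1 p].
Proof.
case: splLM => nsLG _ _ LM_S.
case=> nsL1 nsM1 cyc LM_S1 S_S1; pose b := wreath_base_morphism F G.
have sMG := normal_sub nsMG; have sL1 := normal_sub nsL1; have sM1 := normal_sub nsM1.
pose w u : wreath gT F := (wreath_base F u.2)^-1 * u.
have wP u : u \in H -> u = wreath_base F u.2 * w u /\ w u \in V.
  move=> Hu; have Gu : u.2 \in G by move: Hu; rewrite inE => /andP[].
  split; first by rewrite mulKVg.
  have: w u \in H by rewrite groupM ?groupV ?twisted_base.
  by rewrite wreath_proj_ker inE => /andP[-> _]; rewrite /= mulVg.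
have defL : f @*^-1 (L1 :&: M) = b @* (L1 :&: M) * V.
  apply/setP=> u; apply/morphpreP/mulsgP=> [[Hu LMu]|[_ v /morphimP[x Gx LMx ->] Vv ->]].
    have [Eu Vw] := wP u Hu; exists (wreath_base F u.2) (w u) => //.
    by rewrite (mem_morphim b) //; case/setIP: LMu => /(subsetP sL1).
  have Hv : v \in H by apply: subsetP Vv; apply: subsetIl.
  split; first by rewrite groupM ?twisted_base.
  by move: Vv; rewrite wreath_proj_ker /wreath_proj /= => /andP[_ /eqP->]; rewrite mulg1.
have nsM2 : M1 :&: M <| L1 :&: M.
  by rewrite /normal setSI //= normsIG ?normal_norm.
have sLMG : L1 :&: M \subset G by rewrite subIset ?sL1.
have cVb (A : {set gT}) : A \subset M -> V \subset 'C(b @* A).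
  move=> sAM; apply/centsP=> u Vu _ /morphimP[x _ Ax ->].
  exact: commute_sym (twisted_ker_commute (subsetP sAM x Ax) Vu).
have nVM : V \subset 'N(b @* (M1 :&: M)) by rewrite cents_norm ?cVb ?subsetIr.
have nsbM : b @* (M1 :&: M) <| b @* (L1 :&: M) by apply: morphim_normal.
split.
- exact: (twisted_pre_normal (normalI nsL1 nsMG)).
- rewrite /normal /= defL (subset_trans (normal_sub nsbM)) ?mulG_subl //=.
  exact: mul_subG (normal_norm nsbM) nVM.
(* The two factors, a copy of a section of [L1 / M1] and the image of [V], are cyclic, commute and
   have coprime orders. *)
- rewrite /= defL quotientMl ?(normal_norm nsbM) //; apply: cyclicM.
  + apply: cyclic_quotient_morphim => //=.
    have -> : M1 :&: M = M1 :&: (L1 :&: M) by rewrite setIA (setIidPl sM1).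
    rewrite (isog_cyclic (second_isog _)) ?(cyclicS _ cyc) ?quotientS ?subsetIl //.
    exact: subset_trans (subsetIl _ _) (normal_norm nsM1).
  + exact: quotient_cyclic twisted_ker_cyclic.
  + by rewrite quotient_cents ?cVb ?subsetIr.
  rewrite (coprime_dvdl (dvdn_quotient _ _)) // (coprime_dvdr (dvdn_quotient _ _)) //.
  rewrite [#|_ @* _|](card_injm (wreath_base_inj F G)) // (coprime_dvdl (cardSg sLMG)) //.
  rewrite coprime_sym.
  by apply: pnat_coprime (twisted_ker_pgroup G L lam charF) _; rewrite p'natE.
move=> u Hu u_pr; rewrite in_setD mem_twisted_pre // in_setI.
have memb (A : {set gT}) : u \in b @* A -> u = wreath_base F u.2 /\ u.2 \in A.
  by case/morphimP=> x _ Ax ->.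
have [ur|ur] := eqVneq #[u] r.
  rewrite ur (twisted_order_r charF r'G Hu ur) !group1 /= eqxx !andbT /=.
  apply/negP=> bu; have [Eu _] := memb _ bu; move: u_pr.
  rewrite Eu (twisted_order_r charF r'G Hu ur).
  by rewrite [wreath_base F 1](morph1 b) order1.
have [Gu ou] := twisted_order_proj charF Hu u_pr ur.
have u2_pr : prime #[u.2] by rewrite ou.
have piGu : #[u] \in \pi(G) by apply: (pi_of_order u_pr Gu).
rewrite inE (negPf ur) /=; have [Mu|M'u] := boolP (u.2 \in M); last first.
  rewrite !andbF; apply/esym/negbTE; apply: S_S1 => //.
  by rewrite -ou -LM_S // inE M'u LG Gu.
(* The factor of [u] in [V] commutes with the other one, so its order divides both [r] and [#[u]];
   hence [u] lies in the base copy of [M]. *)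
have [Eu Vw] := wP u Hu; have cbw := twisted_ker_commute Mu Vw.
have wr : w u ^+ r = 1.
  by apply: (twisted_kerX charF); apply/eqP; move: Vw; rewrite wreath_proj_ker => /andP[].
have wp : w u ^+ #[u] = 1.
  have := expg_order u; rewrite {1}Eu expgMn // -{1}ou.
  by rewrite -[wreath_base F _ ^+ _](morphX b) // expg_order (morph1 b) mul1g.
have w1 : w u = 1.
  apply/eqP; rewrite -order_eq1 -dvdn1 -(eqP (_ : coprime #[u] r)).
    by rewrite dvdn_gcd !order_dvdn wp wr eqxx.
  by rewrite prime_coprime // dvdn_prime2.
rewrite w1 mulg1 in Eu; rewrite andbT -ou -LM_S1 // in_setD; congr (~~ _ && _).
apply/idP/idP=> [/memb[_ /setIP[]//]|M1u].
by rewrite Eu (mem_morphim b) // inE M1u.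
Qed.

End TwistedSplits.

Lemma eq_splits (gT : finGroupType) (G L M : {group gT}) (S1 S2 : pred nat) :
  S1 =1 S2 -> splits G L M S1 -> splits G L M S2.
Proof.
move=> eqS [nsLG nsML cyc LM]; split=> // x Gx x_pr; rewrite -eqS; exact: LM.
Qed.

Lemma splits_none (gT : finGroupType) (G : {group gT}) (S : pred nat) :
  (forall p, ~~ S p) -> splits G G G S.
Proof.
move=> S0; split=> // [|x _ _]; first by rewrite trivg_quotient cyclic1.
by rewrite setDv inE (negPf (S0 _)).
Qed.

Lemma nonadj_xx (gT : finGroupType) (G : {group gT}) p : nonadj G p p = false.
Proof. by rewrite /nonadj eqxx !andbF. Qed.

Lemma splits_new_prime (gT : finGroupType) (G L M : {group gT}) (S : pred nat) :
  splits G L M S ->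
  exists (rT : finGroupType) (H : {group rT}) (r : nat),
  [/\ r \notin \pi(G), pseudo_A6_solvable G -> pseudo_A6_solvable H,
      forall p, (p \in \pi(H)) = (p == r) || (p \in \pi(G)),
      {in \pi(G) &, forall p q, nonadj H p q = nonadj G p q}
      /\ {in \pi(G), forall p, nonadj H r p = S p}
    & forall (L1 M1 : {group gT}) S1, splits G L1 M1 S1 ->
      (~~ S1 r -> exists L2 M2 : {group rT}, splits H L2 M2 S1 /\ (L1 = G -> L2 = H))
      /\ (L = G -> (forall p, p \in \pi(G) -> S p -> ~~ S1 p) ->
          exists L2 M2 : {group rT}, splits H L2 M2 [pred p | (p == r) || S1 p]
            /\ (L1 = G -> M = G -> L2 = H))].
Proof.
move=> splLM; have [nsLG nsML cycLM LM_S] := splLM.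
have [r [r_pr r'G] prim_r] := prime_primitive_root (cardG_gt0 G).
have [F charF [cardF [a prim_a]]] : exists2 F : finFieldType, r \in [pchar F]%R
    & #|F| = r /\ exists a : F, (#|G|.-primitive_root a)%R.
  by exists 'F_r; [apply: pchar_Fp | split; [apply: card_Fp | ]].
have [lam lamM lam1] := cyclic_quotient_character nsML cycLM prim_a (cardSg (normal_sub nsLG)).
have piG : r \notin \pi(G) by rewrite mem_primes (negPf r'G) !andbF.
have preG : (wreath_proj_morphism G L lam @*^-1 G)%G = twisted_group G L lam.
  apply: val_inj; rewrite /= -[X in _ @*^-1 X = _](wreath_proj_im G L lam).
  by rewrite morphimGK ?subsetIl.
exists (wreath gT F), (twisted_group G L lam), r; split=> //.
- move=> psG; apply/(pseudo_A6_extension (ker_normal _)); split.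
    by apply/solvable_pseudo_A6/abelian_sol/wreath_ker_abelian.
  by apply: pseudo_A6_isog psG; rewrite isog_sym twisted_quotient_isog.
- by move=> p; apply: (twisted_pi charF nsLG lamM lam1).
- split; first by move=> p q; apply: (twisted_nonadj_old L lam charF r'G).
  by move=> p; apply: (twisted_nonadj_new charF r'G nsLG nsML lamM lam1 LM_S).
move=> L1 M1 S1 splL1; split=> [S1'r|LG disj].
  do 2!eexists; split; first exact: (splits_pullback L lam charF r'G splL1 S1'r).
  by move=> ->.
do 2!eexists; split.
  by apply: (splits_extend charF r'G splLM lam1 LG cardF splL1 disj).
by move=> -> ->; rewrite -[RHS]preG; apply: val_inj; rewrite /= setIid.
Qed.

(** * Adding vertices in the order of their colours *)

Section Realization.
Variables (Gamma : sgraph) (T : {set Gamma}) (c : Gamma -> 'I_3).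
Hypothesis cP : forall x y : Gamma, compl_adj x y -> c x != c y.
Hypothesis isoT : forall x y : Gamma, x \in T -> y \notin T -> ~~ compl_adj x y.
Hypothesis no_tri : forall v x y : Gamma,
  v \notin T -> compl_adj v x -> compl_adj v y -> compl_adj x y -> False.

Definition labels (pr : Gamma -> nat) (X : {set Gamma}) : pred nat :=
  [pred p | [exists x in X, pr x == p]].

(* By the last clause a new vertex can be joined to any independent set [X] of
   vertices of colours 0 and 1.  If they all have colour 0 then [L = G], and the new
   Sylow subgroup is cyclic, as it must be for the new vertex to occur in such sets. *)
Definition realized (A : {set Gamma}) (gT : finGroupType) (G : {group gT}) (pr : Gamma -> nat) :=
  [/\ pseudo_A6_solvable G, {in A &, injective pr}, (forall p, (p \in \pi(G)) = labels pr A p),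
      {in A &, forall x y, nonadj G (pr x) (pr y) = compl_adj x y}
    & forall X : {set Gamma}, X \subset A :\: T -> {in X, forall x, c x <= 1} ->
        {in X &, forall x y, ~~ compl_adj x y} ->
        exists L M : {group gT}, splits G L M (labels pr X)
          /\ ({in X, forall x, c x = ord0} -> L = G)].

Lemma labelsP pr (X : {set Gamma}) p : reflect (exists2 x, x \in X & pr x = p) (labels pr X p).
Proof.
by apply: (iffP exists_inP) => [[x Xx /eqP]|[x Xx <-]]; exists x.
Qed.

(** The neighbours [N] of [v] have smaller colours, and they are independent since [v] is in no
    triangle; so the last clause of [realized] supplies the groups from which the new module is
    induced. *)
Lemma realized_step (A : {set Gamma}) v (gT : finGroupType) (G : {group gT}) pr :
  T \subset A -> v \notin A -> {in A :\: T, forall x, c x <= c v} -> realized A G pr ->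
  exists (rT : finGroupType) (H : {group rT}) pr', realized (v |: A) H pr'.
Proof.
move=> sTA vA cA [psG inj_pr piG adjG goodG]; have vT := contra (subsetP sTA v) vA.
have eC x y : compl_adj x y = compl_adj y x by apply: compl_adj_sym.
pose N := [set x in A | compl_adj v x].
have sNA : N \subset A :\: T.
  apply/subsetP=> x; rewrite !inE => /andP[-> vx]; rewrite andbT.
  by apply: contraL vx => Tx; rewrite eC isoT.
have ltc x : x \in N -> c x < c v.
  move=> Nx; rewrite ltn_neqAle cA ?(subsetP sNA) // andbT.
  by move: Nx; rewrite inE eC => /andP[_ /cP].
(* For colour 0 the set [N] is empty and the module is trivial; for colour 1 all of [N] has colour
   0, whence [L = G]. *)
have [L [M [splN LG MG]]] : exists L M : {group gT}, [/\ splits G L M (labels pr N),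
    c v <= 1 -> L = G & c v = ord0 -> M = G].
  have [cv0|cv0] := eqVneq (c v) ord0.
    exists G, G; split=> //; apply: splits_none => p; apply/labelsP=> -[x /ltc].
    by rewrite cv0.
  have [||L [M [splN LG]]] := goodG N sNA.
  - by move=> x /ltc cx; rewrite -ltnS (leq_trans cx) // -ltnS ltn_ord.
  - move=> x y; rewrite !inE => /andP[_ vx] /andP[_ vy]; apply/negP.
    exact: no_tri vT vx vy.
  exists L, M; split=> // [cv1|cv]; last by rewrite cv in cv0.
  apply: LG => x /ltc cx; apply/val_inj/eqP.
  by rewrite /= -leqn0 -ltnS (leq_trans cx).
have [rT [H [r [r'G psH piH [oldH newH] splH]]]] := splits_new_prime splN.
pose pr' x := if x == v then r else pr x.
have pr'A x : x \in A -> pr' x = pr x by rewrite /pr'; case: eqP => // ->; rewrite (negPf vA).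
have pr'v : pr' v = r by rewrite /pr' eqxx.
have piA x : x \in A -> pr x \in \pi(G) by move=> Ax; rewrite piG; apply/labelsP; exists x.
have r'A x : x \in A -> pr x != r by move=> Ax; apply: contraNneq r'G => <-; apply: piA.
have labels_v (X : {set Gamma}) p : v \in X -> X \subset v |: A ->
    labels pr' X p = (p == r) || labels pr (X :\ v) p.
  move=> Xv sXA; apply/labelsP/orP=> [[x Xx <-]|[/eqP->|/labelsP[x /setD1P[xv Xx] <-]]].
  - have [->|xv] := eqVneq x v; [by left; rewrite pr'v | right].
    apply/labelsP; exists x; rewrite ?inE ?xv //; move: (subsetP sXA x Xx).
    by rewrite !inE (negPf xv) => /pr'A.
  - by exists v.
  exists x => //; move: (subsetP sXA x Xx).
  by rewrite !inE (negPf xv) => /pr'A.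
have labels_A (X : {set Gamma}) p : X \subset A -> labels pr' X p = labels pr X p.
  move=> sXA; apply/labelsP/labelsP=> [[x Xx <-]|[x Xx <-]]; exists x => //;
    by rewrite pr'A ?(subsetP sXA).
exists rT, H, pr'; split.
- exact: psH.
- move=> x y /setU1P[->|Ax] /setU1P[->|Ay]; rewrite ?pr'v ?pr'A // => /eqP.
  + by rewrite eq_sym (negPf (r'A y Ay)).
  + by rewrite (negPf (r'A x Ax)).
  by move/eqP; apply: inj_pr.
- move=> p; rewrite piH labels_v ?setU11 // setU1K // piG //.
- move=> x y /setU1P[->|Ax] /setU1P[->|Ay]; rewrite ?pr'v ?pr'A //.
  + by rewrite nonadj_xx compl_adj_irrefl.
  + rewrite newH ?piA //; apply/labelsP/idP=> [[z]|vy]; last by exists y; rewrite ?inE ?Ay.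
    by rewrite inE => /andP[Az vz] /inj_pr <-.
  + rewrite nonadj_sym newH ?piA // eC.
    apply/labelsP/idP=> [[z]|vx]; last by exists x; rewrite ?inE ?Ax.
    by rewrite inE => /andP[Az vz] /inj_pr <-.
  by rewrite oldH ?piA ?adjG.
move=> X sXA cX indX; have [Xv|X'v] := boolP (v \in X); last first.
  have sXAT : X \subset A :\: T.
    apply/subsetP=> x Xx; have := subsetP sXA x Xx; rewrite !inE => /andP[->].
    by case/predU1P=> [xv|->//]; rewrite -xv Xx in X'v.
  have [L1 [M1 [splX LG1]]] := goodG X sXAT cX indX.
  have sXA' := subset_trans sXAT (subsetDl _ _).
  have [|L2 [M2 [splX2 LG2]]] := (splH _ _ _ splX).1.
    by apply/labelsP=> -[x /(subsetP sXA') Ax]; apply/eqP; apply: r'A.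
  exists L2, M2; split; last by move/LG1/LG2.
  by apply: eq_splits splX2 => p; rewrite labels_A.
have sX1 : X :\ v \subset A :\: T.
  apply/subsetP=> x /setD1P[xv Xx]; have := subsetP sXA x Xx; rewrite !inE (negPf xv) //.
have [||L1 [M1 [splX LG1]]] := goodG (X :\ v) sX1.
- by move=> x /setD1P[_]; apply: cX.
- by move=> x y /setD1P[_ Xx] /setD1P[_ Xy]; apply: indX.
(* [X] contains [v], so [v] has colour at most 1 and [L = G]. The labels of [N] and of [X :\ v] are
   disjoint because [X] is independent. *)
have [||L2 [M2 [splX2 LG2]]] := (splH _ _ _ splX).2.
- exact/LG/cX.
- move=> p _ /labelsP[x Nx prx]; apply/labelsP=> -[y Xy pry].
  have [Ay _] := setDP (subsetP sX1 y Xy); have [Ax _] := setDP (subsetP sNA x Nx).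
  have xy : x = y by apply: inj_pr; rewrite ?prx ?pry.
  case/setD1P: Xy => _ Xy; have := indX v y Xv Xy.
  by move: Nx; rewrite inE xy => /andP[_ ->].
exists L2, M2; split.
  apply: eq_splits splX2 => p; rewrite labels_v // (subset_trans sXA) ?subsetDl //.
by move=> cX0; apply: LG2; [apply: LG1 => x /setD1P[_]; apply: cX0 | apply/MG/cX0].
Qed.

Lemma realized_full (A : {set Gamma}) (gT : finGroupType) (G : {group gT}) pr : T \subset A ->
  (forall x y, x \in A :\: T -> y \notin A -> c x <= c y) -> realized A G pr ->
  exists (rT : finGroupType) (H : {group rT}) pr', realized setT H pr'.
Proof.
have [n] := ubnP #|~: A|; elim: n => // n IHn in A gT G pr *.
move=> /ltnSE-leAn sTA lowA realA; have [AT|[v0 v0A]] := set_0Vmem (~: A).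
  by exists gT, G, pr; rewrite -(setCK A) AT setC0 in realA *.
have [v] := arg_minnP (P := [in ~: A]) (fun v => c v : nat) v0A; rewrite inE /= => vA minv.
have [|rT [H [pr' realH]]] := realized_step sTA vA _ realA.
  by move=> x Ax; apply: lowA.
apply: IHn realH.
- apply: leq_trans leAn; rewrite setCU setIC -setDE.
  by apply: proper_card; rewrite properD1 ?inE.
- by apply: subset_trans sTA (subsetUr _ _).
move=> x y; rewrite !inE => /andP[xT /predU1P[->|Ax]]; rewrite negb_or => /andP[_ yA].
  by apply: minv; rewrite inE.
by apply: lowA; rewrite ?inE ?xT.
Qed.

Lemma realized_empty (gT : finGroupType) : T = set0 -> realized set0 (1 : {group gT})%G (fun=> 0%N).
Proof.
move=> T0; split=> [|x y|p|x y|X]; rewrite ?inE //.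
- exact/solvable_pseudo_A6/solvable1.
- by rewrite /= cards1; apply/esym/labelsP=> -[x]; rewrite inE.
rewrite set0D subset0 => /eqP-> _ _; exists 1%G, 1%G; split=> //.
by apply: splits_none => p; apply/labelsP=> -[x]; rewrite inE.
Qed.

Lemma realized_triangle : triangle (A := complement Gamma) T ->
  realized T 'Alt_('I_6)%G (fun x => nth 0 [:: 2; 3; 5] (index x (enum T)))%N.
Proof.
move=> [T3 adjT]; set pr := fun x => _.
have idx x : x \in T -> index x (enum T) < 3.
  by move=> Tx; rewrite -T3 cardE index_mem mem_enum.
have inj_pr : {in T &, injective pr}.
  move=> x y Tx Ty /eqP; rewrite nth_uniq ?idx // => /eqP /(congr1 (nth x (enum T))).
  by rewrite !nth_index ?mem_enum.
have prP x : x \in T -> pr x \in [:: 2; 3; 5]%N by move=> Tx; rewrite mem_nth ?idx.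
split=> //.
- apply/pseudo_A6_simple; first by apply: simple_Alt5; rewrite card_ord.
  by rewrite /abelian_or_Alt6 isog_refl orbT.
- move=> p; rewrite pi_Alt6; apply/idP/labelsP=> [p235|[x Tx <-]]; last exact: prP.
  have ltp : index p [:: 2; 3; 5]%N < 3 by rewrite index_mem.
  have sT : index p [:: 2; 3; 5]%N < size (enum T) by rewrite -cardE T3.
  have /set0Pn[x0 _] : T != set0 by rewrite -card_gt0 T3.
  exists (nth x0 (enum T) (index p [:: 2; 3; 5]%N)); first by rewrite -mem_enum mem_nth.
  by rewrite /pr index_uniq ?enum_uniq // nth_index.
- move=> x y Tx Ty; have [<-|xy] := eqVneq x y.
    by rewrite nonadj_xx compl_adj_irrefl.
  rewrite [RHS](adjT x y Tx Ty xy); apply: Alt6_nonadj; rewrite ?prP //.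
  by apply: contra xy => /eqP/inj_pr->.
move=> X; rewrite setDv subset0 => /eqP-> _ _; do 2!exists 'Alt_('I_6)%G; split=> //.
by apply: splits_none => p; apply/labelsP=> -[x]; rewrite inE.
Qed.

End Realization.

Lemma realized_isomorphic (Gamma : sgraph) (T : {set Gamma}) (c : Gamma -> 'I_3)
    (gT : finGroupType) (G : {group gT}) pr :
  realized T c setT G pr -> pseudo_A6_solvable G /\ graph_isomorphic Gamma (prime_graph G).
Proof.
case=> psG inj_pr piG adjG _; split=> //.
have prP x : pr x \in primes #|G| by have := piG (pr x) => /= ->; apply/labelsP; exists x.
pose f x : prime_graph G := SeqSub (prP x).
have inj_f : injective f by move=> x y [/inj_pr]; apply.
exists f.
  apply: (inj_card_bij (f := f)) => [//|]; rewrite -(card_codom inj_f).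
  apply/subset_leq_card/subsetP=> p _.
  have pP : val p \in primes #|G| by apply: valP.
  have := piG (val p) => /=; rewrite pP => /esym/labelsP[x _ prx].
  by apply/codomP; exists x; apply: val_inj.
move=> x y; have [->|xy] := eqVneq x y; first by rewrite !adj_irrefl.
have := adjG x y (in_setT x) (in_setT y); rewrite -(compl_prime_adj (f x) (f y)).
by rewrite /compl_adj /= (inj_eq inj_f) xy => /negb_inj.
Qed.

Lemma triangle_set3 (Gamma : sgraph) (x y z : Gamma) :
  adj x y -> adj x z -> adj y z -> triangle [set x; y; z].
Proof.
move=> xy xz yz; have neq u v : adj u v -> u != v.
  by move=> uv; apply: contraTneq uv => ->; rewrite adj_irrefl.
split.
  by rewrite -setUA cardsU1 cards2 !inE negb_or !neq.
move=> u v; rewrite !inE -!orbA => /or3P[]/eqP-> /or3P[]/eqP-> //;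
  by rewrite ?eqxx // adj_sym.
Qed.

Lemma compl_realizable (Gamma : sgraph) : colorable 3 (complement Gamma) ->
  at_most_one_triangle (complement Gamma) ->
  (forall T : {set complement Gamma}, triangle T -> isolated T) ->
  exists (gT : finGroupType) (G : {group gT}),
    pseudo_A6_solvable G /\ graph_isomorphic Gamma (prime_graph G).
Proof.
case=> c cP one_tri iso_tri.
have real (T : {set Gamma}) (gT : finGroupType) (G : {group gT}) pr :
    (forall T' : {set complement Gamma}, triangle T' -> T' = T) ->
    (forall x y : Gamma, x \in T -> y \notin T -> ~~ compl_adj x y) ->
    realized T c T G pr -> 
    exists (gT : finGroupType) (G : {group gT}),
    pseudo_A6_solvable G /\ graph_isomorphic Gamma (prime_graph G).
  move=> triT isoT realT; have no_tri v x y : v \notin T ->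
      compl_adj v x -> compl_adj v y -> compl_adj x y -> False.
    move=> vT vx vy xy; have := triT _ (@triangle_set3 (complement Gamma) v x y vx vy xy).
    by move/setP/(_ v); rewrite !inE eqxx (negPf vT).
  have [|rT [H [pr' realH]]] :=
    realized_full (Gamma := Gamma) (c := c) cP isoT no_tri (subxx T) _ realT.
    by move=> x y; rewrite setDv inE.
  by exists rT, H; apply: realized_isomorphic realH.
have [/existsP[T /andP[/eqP T3 /'forall_in_'forall_in_implyP adjT]]|noT] :=
  boolP [exists T : {set complement Gamma}, (#|T| == 3)
    && [forall x in T, forall y in T, (x != y) ==> adj x y]].
  have triT : triangle (A := complement Gamma) T by split=> // x y Tx Ty; apply: adjT.
  apply: real (realized_triangle (Gamma := Gamma) c triT); last exact: iso_tri triT.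
  by move=> T' triT'; apply: one_tri.
(* An arbitrary group type to hold the trivial group. *)
have real0 := realized_empty (Gamma := Gamma) (T := set0) c {perm 'I_1} (erefl _).
apply: real real0 => [T [T3 adjT]|x y].
  case/existsP: noT; exists T; rewrite T3 eqxx /=.
  apply/'forall_in_'forall_in_implyP => x Tx y Ty; exact: adjT.
by rewrite inE.
Qed.

Theorem theorem1p4 (Gamma : sgraph) :
  (exists (gT : finGroupType) (G : {group gT}),
     pseudo_A6_solvable G /\ graph_isomorphic Gamma (prime_graph G))
  <->
  (colorable 3 (complement Gamma) /\
   at_most_one_triangle (complement Gamma) /\
   (forall T : {set complement Gamma}, triangle T -> isolated T)).
Proof.
split=> [[gT [G [psG isoG]]]|[colG [one_tri iso_tri]]].
  exact: prime_graph_compl psG isoG.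
exact: compl_realizable.
Qed.
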